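(* Let $N \geq 1$, $p \geq 2$, and $s \in (0,1)$ satisfy $sp < N$. Then there exists a constant $C = C(N,s,p) > 0$ such that $$\delta_{s,p}(u) \geq C\,\big(d_{s,p}(u)\big)^{2p} \int_{\mathbb{R}^N} \frac{|u(x)|^p}{|x|^{sp}}\, dx$$ holds for all (nonzero, real-valued) $u \in \dot W^{s,p}(\mathbb{R}^{N})$.
   Context: Functions are real-valued. For $1\le p<N/s$, $\dot W^{s,p}(\mathbb{R}^N)$ is the closure of $C_c^\infty(\mathbb{R}^N)$ with respect to the seminorm $[u]^p=\int_{\mathbb{R}^N}\int_{\mathbb{R}^N}\frac{|u(x)-u(y)|^p}{|x-y|^{N+sp}}\,dx\,dy$ (identified with a space of functions via the fractional Sobolev embedding). The fractional Hardy deficit is $$\delta_{s,p}(u):=\int_{\mathbb{R}^N}\int_{\mathbb{R}^N}\frac{|u(x)-u(y)|^p}{|x-y|^{N+sp}}\,dx\,dy-\mathcal C_{N,s,p}\int_{\mathbb{R}^N}\frac{|u(x)|^p}{|x|^{sp}}\,dx,$$ where $\mathcal{C}_{N,s,p} := 2 \int_{0}^{1} r^{sp-1} \bigl|1-r^{(N-sp)/p}\bigr|^{p} \Phi_{N,s,p}(r) \, dr$ (the sharp fractional Hardy constant), with $\Phi_{N,s,p}(r) := |\mathbb{S}^{N-2}| \int_{-1}^{1} \frac{(1-t^{2})^{(N-3)/2}}{(1-2rt+r^{2})^{(N+sp)/2}} \, dt$ for $N\ge 2$, and $\Phi_{1,s,p}(r) := \frac{1}{(1-r)^{1+sp}} +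 \frac{1}{(1+r)^{1+sp}}$ for $N=1$. Let $p_s^*=\frac{Np}{N-sp}$ and $\omega_a(x)=a|x|^{-\frac{N-sp}{p}}$ for $a\in\mathbb{R}$. For measurable $f$ on $\mathbb{R}^N$ let $f^*(t)=\inf\{\lambda>0: |\{x:|f(x)|>\lambda\}|\le t\}$, and for $0<P<\infty$ set $\|f\|_{L^{P,Q}(\mathbb{R}^N)}=\left(\int_0^\infty (t^{1/P}f^*(t))^Q\frac{dt}{t}\right)^{1/Q}$ if $0<Q<\infty$ and $\|f\|_{L^{P,\infty}(\mathbb{R}^N)}=\sup_{t>0}t^{1/P}f^*(t)$. The distance is $$d_{s,p}(u)=\inf_{a\in\mathbb{R}}\frac{\|u-\omega_a\|_{L^{p_s^*,\infty}(\mathbb{R}^N)}}{\|u\|_{L^{p_s^*,p}(\mathbb{R}^N)}}.$$ *)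

(* Defs.v *)
From HB Require Import structures.
From mathcomp Require Import all_boot all_order all_algebra.
From mathcomp Require Import all_classical all_reals all_analysis.

Set Implicit Arguments.
Unset Strict Implicit.
Unset Printing Implicit Defensive.

Import Order.TTheory GRing.Theory Num.Theory.
Import numFieldNormedType.Exports.

Local Open Scope classical_set_scope.
Local Open Scope ring_scope.

Definition rV_display : measure_display.
Proof. exact: default_measure_display. Qed.

Section rV_measurable.
Context (R : realType) (N : nat).

Let coord : 'I_N -> 'rV[R]_N -> R := fun i x => x 0 i.

Let rV_set0 : g_sigma_preimage coord set0.
Proof. exact: sigma_algebra0. Qed.

Let rV_setC A : g_sigma_preimage coord A -> g_sigma_preimage coord (~` A).
Proof. exact: sigma_algebraC. Qed.

Let rV_bigcup (F : (set 'rV[R]_N)^nat) :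
  (forall i, g_sigma_preimage coord (F i)) ->
  g_sigma_preimage coord (\bigcup_i (F i)).
Proof. exact: sigma_algebra_bigcup. Qed.

(* The sigma-algebra generated by the coordinates, i.e. the Borel sets of R^N. *)
HB.instance Definition _ := @isMeasurable.Build
  rV_display 'rV[R]_N (g_sigma_preimage coord) rV_set0 rV_setC rV_bigcup.

Lemma measurable_rV_coord (i : 'I_N) :
  measurable_fun [set: 'rV[R]_N] (fun x : 'rV[R]_N => x 0 i).
Proof.
move=> _ Y mY; rewrite setTI; apply: sub_sigma_algebra => /=.
rewrite -bigcup_seq/=; exists i => /=; first by rewrite mem_index_enum.
by exists Y => //; rewrite setTI.
Qed.

Lemma measurable_fun_rVP d (T : measurableType d) (f : T -> 'rV[R]_N) :
  measurable_fun [set: T] f <->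
  forall i, measurable_fun [set: T] (fun t => f t 0 i).
Proof.
split=> [mf i|mf]; first exact: (measurableT_comp (measurable_rV_coord i) mf).
move=> _ A mA; rewrite setTI.
suff : g_sigma_preimage coord `<=` [set B | measurable (f @^-1` B)] by exact.
apply: smallest_sub => /=.
  split => /=.
  - by rewrite preimage_set0; exact: measurable0.
  - by move=> B mB; rewrite setTD preimage_setC; exact: measurableC.
  - by move=> F mF; rewrite preimage_bigcup; exact: bigcupT_measurable.
move=> B; rewrite -bigcup_seq/= => -[i _ [C mC <-]] /=.
rewrite setTI -comp_preimage -[X in measurable X]setTI; exact: mf.
Qed.

End rV_measurable.

Lemma sigma_finite_product_measure d1 d2 (T1 : measurableType d1)
    (T2 : measurableType d2) (R : realType)
    (m1 : {sigma_finite_measure set T1 -> \bar R})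
    (m2 : {sigma_finite_measure set T2 -> \bar R}) :
  sigma_finite [set: T1 * T2] (m1 \x m2)%E.
Proof.
have /sigma_finiteP[F [TF ndF Foo]] := sigma_finiteT m1.
have /sigma_finiteP[G [TG ndG Goo]] := sigma_finiteT m2.
exists (fun n => F n `*` G n).
  rewrite -setXTT TF TG predeqE => -[x y]; split=> [[/= [n _ Fnx] [k _ Gky]]|].
    exists (maxn n k) => //; split.
    - by move: x Fnx; exact/subsetPset/ndF/leq_maxl.
    - by move: y Gky; exact/subsetPset/ndG/leq_maxr.
  by move=> [n _ []/= ? ?]; split; exists n.
move=> k; have [? ?] := Foo k; have [? ?] := Goo k.
split; first exact: measurableX.
by rewrite product_measure1E// lte_mul_pinfty// ge0_fin_numE.
Qed.

Section rV_lebesgue.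
Context {R : realType}.

Definition rV_cons n (x : R * 'rV[R]_n) : 'rV[R]_n.+1 :=
  row_mx (x.1)%:M x.2 : 'rV_(1 + n).

Lemma rV_cons0 n (x : R * 'rV[R]_n) : rV_cons x 0 0 = x.1.
Proof.
have -> : (0 : 'I_n.+1) = @lshift 1 n 0 by exact: val_inj.
by rewrite /rV_cons (@row_mxEl _ 1 1 n) mxE eqxx.
Qed.

Lemma rV_consS n (x : R * 'rV[R]_n) j : rV_cons x 0 (lift ord0 j) = x.2 0 j.
Proof.
have -> : lift ord0 j = @rshift 1 n j by exact: val_inj.
by rewrite /rV_cons (@row_mxEr _ 1 1 n).
Qed.

Lemma measurable_rV_cons n : measurable_fun [set: R * 'rV[R]_n] (@rV_cons n).
Proof.
apply/measurable_fun_rVP => i; case: (unliftP ord0 i) => [j ->|->].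
  under eq_fun do rewrite rV_consS.
  exact: (measurableT_comp (measurable_rV_coord j)).
under eq_fun do rewrite rV_cons0; exact: measurable_fst.
Qed.

Definition rV_uncons n (v : 'rV[R]_n.+1) : R * 'rV[R]_n :=
  (v 0 0, \row_j v 0 (lift ord0 j)).

Lemma rV_consK n : cancel (@rV_cons n) (@rV_uncons n).
Proof.
move=> [x v]; congr (_, _); first by rewrite rV_cons0.
by apply/rowP => j; rewrite mxE rV_consS.
Qed.

Lemma measurable_rV_uncons n : measurable_fun [set: 'rV[R]_n.+1] (@rV_uncons n).
Proof.
apply/measurable_fun_prod; first exact: measurable_rV_coord.
apply/measurable_fun_rVP => j.
under eq_fun do rewrite mxE; exact: measurable_rV_coord.
Qed.

Section rV_lebesgue_step.
Variables (n : nat) (mu : {sigma_finite_measure set 'rV[R]_n -> \bar R}).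

Definition rV_lebesgue_step : set 'rV[R]_n.+1 -> \bar R :=
  pushforward (@lebesgue_measure R \x mu)%E (@rV_cons n).

Let step0 : rV_lebesgue_step set0 = 0%E.
Proof. by rewrite /rV_lebesgue_step /pushforward preimage_set0 measure0. Qed.

Let step_ge0 A : (0 <= rV_lebesgue_step A)%E.
Proof. exact: (measure_ge0 (@lebesgue_measure R \x mu)%E). Qed.

Let step_sigma_additive : semi_sigma_additive rV_lebesgue_step.
Proof.
have mf := @measurable_rV_cons n.
exact: (@measure_semi_sigma_additive _ _ _
  (pushforward (@lebesgue_measure R \x mu)%E (@rV_cons n))).
Qed.

HB.instance Definition _ := isMeasure.Build _ _ _ rV_lebesgue_step
  step0 step_ge0 step_sigma_additive.

Let step_sigma_finite : sigma_finite [set: 'rV[R]_n.+1] rV_lebesgue_step.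
Proof.
have [F FT mF] : sigma_finite setT (@lebesgue_measure R \x mu)%E.
  exact: sigma_finite_product_measure.
exists (fun k => @rV_uncons n @^-1` F k).
  by rewrite -preimage_bigcup -FT preimage_setT.
move=> k; have [mFk Fkoo] := mF k; split.
  by rewrite -[X in measurable X]setTI; exact: measurable_rV_uncons.
rewrite /rV_lebesgue_step /pushforward -comp_preimage.
rewrite (_ : _ \o _ = id) ?preimage_id//.
by apply/funext; exact: rV_consK.
Qed.

HB.instance Definition _ := Measure_isSigmaFinite.Build _ _ _ rV_lebesgue_step
  step_sigma_finite.
End rV_lebesgue_step.

(* Lebesgue measure on R^N, as the N-fold product of the one on R. *)
Fixpoint lebesgueN N : {sigma_finite_measure set 'rV[R]_N -> \bar R} :=
  if N is n.+1 then rV_lebesgue_step (lebesgueN n) else dirac (0 : 'rV[R]_0).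

Lemma lebesgueN_box N (A : 'I_N -> set R) : (forall i, measurable (A i)) ->
  lebesgueN N [set x | forall i, A i (x 0 i)] =
  (\prod_(i < N) lebesgue_measure (A i))%E.
Proof.
elim: N A => [|n IH] A mA.
  by rewrite big_ord0/= /dirac indicE mem_set// => -[].
rewrite big_ord_recl -IH; last by move=> i; exact: mA.
rewrite /= /rV_lebesgue_step /pushforward -product_measure1E//.
  congr ((_ \x _)%E _); apply/seteqP; split => -[x v] /=.
    move=> Av; split=> [|i]; first by have := Av 0; rewrite rV_cons0.
    by have := Av (lift ord0 i); rewrite rV_consS.
  move=> [/= Ax Av] i; case: (unliftP ord0 i) => [j ->|->].
    by rewrite rV_consS; exact: Av.
  by rewrite rV_cons0.
  exact: mA.
rewrite [X in measurable X](_ : _ =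
  \bigcap_(i in [set: 'I_n]) ((fun v : 'rV[R]_n => v 0 i) @^-1` A (lift ord0 i))).
  apply: fin_bigcap_measurable => // i _; rewrite -[X in measurable X]setTI.
  exact: measurable_rV_coord.
by apply/seteqP; split => [v Av i _|v Av i]; exact: Av.
Qed.
End rV_lebesgue.

Section fractional_hardy.
Context {R : realType} {N : nat}.
Implicit Types (s p : R) (u f : 'rV[R]_N -> R).

(* The library's norm on 'rV[R]_N is the sup norm. *)
Definition enorm {m} (x : 'rV[R]_m) : R := Num.sqrt (\sum_i x 0 i ^+ 2).

Definition gagliardo s p u : \bar R :=
  (\int[lebesgueN N]_x \int[lebesgueN N]_y
    (`|u x - u y| `^ p / enorm (x - y) `^ (N%:R + s * p))%:E)%E.

Definition hardy_term s p u : \bar R :=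
  (\int[lebesgueN N]_x (`|u x| `^ p / enorm x `^ (s * p))%:E)%E.

Definition partial (i : 'I_N) f : 'rV[R]_N -> R := 'D_(delta_mx 0 i) f.

(* [js] lists the directions of an iterated partial derivative. *)
Definition smooth f : Prop := forall js : seq 'I_N,
  let g := foldr partial f js in
  continuous g /\ forall i x, derivable g x (delta_mx 0 i).

Definition Cc_infty : set ('rV[R]_N -> R) :=
  [set f : 'rV[R]_N -> R | smooth f /\ compact (closure [set x | f x != 0])].

Definition sobolev_exp s p : R := N%:R * p / (N%:R - s * p).

(* The closure of C_c^oo for the Gagliardo seminorm, whose elements are realised
   as functions through the embedding into L^{p_s^*}: the approximating sequence
   converges to u in the seminorm and in L^{p_s^*}.  Elements are represented
   by Borel functions, two of them being identified when equal almost
   everywhere. *)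
Definition dotW s p : set ('rV[R]_N -> R) :=
  [set u : 'rV[R]_N -> R | measurable_fun [set: 'rV[R]_N] u /\
    exists phi : nat -> 'rV[R]_N -> R,
      [/\ forall k, Cc_infty (phi k),
          gagliardo s p (u \- phi k) @[k --> \oo] --> 0%E &
          'N[lebesgueN N]_((sobolev_exp s p)%:E)[EFin \o (u \- phi k)%R]%E @[k --> \oo] --> 0%E]].

(* |S^{m-1}| for m > 0: the surface measure of the unit sphere of R^m
   is m times the volume of the unit ball, S^0 having measure 2. *)
Definition sphere_area (m : nat) : \bar R :=
  (m%:R%:E * lebesgueN m [set x | (enorm x <= 1)%R])%E.

Definition Phi s p (r : R) : \bar R :=
  if N == 1%N then
    (((1 - r) `^ (1 + s * p))^-1 + ((1 + r) `^ (1 + s * p))^-1)%:E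
  else
    (sphere_area N.-1 * \int[lebesgue_measure]_(t in `](-1)%R, 1%R[)
      ((1 - t ^+ 2) `^ ((N%:R - 3) / 2)
       / (1 - 2 * r * t + r ^+ 2) `^ ((N%:R + s * p) / 2))%:E)%E.

Definition hardy_const s p : \bar R :=
  (2%:E * \int[lebesgue_measure]_(r in `]0%R, 1%R[)
    ((r `^ (s * p - 1) * `|1 - r `^ ((N%:R - s * p) / p)| `^ p)%:E
     * Phi s p r))%E.

Definition hardy_deficit s p u : \bar R :=
  (gagliardo s p u - hardy_const s p * hardy_term s p u)%E.

Definition omega s p (a : R) (x : 'rV[R]_N) : R :=
  a * enorm x `^ (- ((N%:R - s * p) / p)).

(* The infimum of the empty set is +oo. *)
Definition rearrangement f (t : R) : \bar R :=
  ereal_inf [set l%:E | l in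
    [set l : R | 0 < l /\ (lebesgueN N [set x | (l < `|f x|)%R] <= t%:E)%E]].

Definition lorentz_norm (P Q : R) f : \bar R :=
  ((\int[lebesgue_measure]_(t in `]0%R, +oo[)
     (((t `^ P^-1)%:E * rearrangement f t) `^ Q * (t^-1)%:E)) `^ Q^-1)%E.

Definition weak_lorentz_norm (P : R) f : \bar R :=
  ereal_sup [set ((t `^ P^-1)%:E * rearrangement f t)%E | t in [set t : R | 0 < t]].

Definition hardy_dist s p u : \bar R :=
  ereal_inf (range (fun a : R =>
    (weak_lorentz_norm (sobolev_exp s p) (u \- omega s p a)%R
     / lorentz_norm (sobolev_exp s p) p u)%E)).
End fractional_hardy.

(* Main.v *)
(* Write al = (N - s p) / p. Splitting the double integral along |x| < |y| and using
   Jensen's inequality with t = (|x| / |y|)^al bounds the Gagliardo integral of u below by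
   C_{N,s,p} H + 2 E, where H is the Hardy term and E integrates a nonnegative
   remainder dominating |X^{p/2} - Y^{p/2}|^2 with X = |x|^al |u x| and Y = |y|^al |u y|;
   that H is finite follows by applying this to truncations of u.
   Let m be the measure of a level set {|u| > l} nearly realizing the weak norm W.
   Either much of it is far from the origin: then at a nearby point, of comparable
   weight, |u| < l/4, so that W^p <= C E. Or much of it lies in an annulus: averaging the
   oscillation of X^{p/2} between x and all dilation shells q < |y| / |x| <= q^2 and
   optimizing by AM-GM gives W^{2p} <= C E H. So W^{2p} <= C E (E + H). Finally H is
   at most the p-th power of the L^{P,p} norm by a layer-cake argument, W is at most that norm up
   to a constant, and the distance is bounded by its value at a = 0. *)

Require Import Defs.
From HB Require Import structures.
From mathcomp Require Import all_boot all_order all_algebra.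
From mathcomp Require Import all_classical all_reals all_analysis.
From mathcomp Require Import measurable_realfun.
From mathcomp Require Import ring lra.

Set Implicit Arguments.
Unset Strict Implicit.
Unset Printing Implicit Defensive.

Import Order.TTheory GRing.Theory Num.Theory.
Import numFieldNormedType.Exports.

Local Open Scope classical_set_scope.
Local Open Scope ring_scope.

(** * Lebesgue measure on row vectors *)

(** The Jensen splitting cannot be integrated directly over the cone |x| < |y|: the weights carried
    by |u x|^p and |u y|^p may both have infinite mass near |x| = |y|. The cone is therefore
    narrowed to |x| < th |y| with th < 1. The inversion y -> y / |y|^2 shows that the masses of the
    two weights differ exactly by the part of the Hardy constant seen by that cone, so their common
    finite part cancels, and th tends to 1. The cancellation also requires a finite Hardy term,
    which is why truncations come first. No surface measure is introduced: polar coordinates and the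
    inversion both come from Tonelli's theorem applied to dilation-invariant integrals, with
    constants read off on the unit ball. The power 2p stems from W^{2p} <= C E (E + H). If the
    deficit delta is below H, then E <= delta gives W^{2p} H <= 2 C delta H^2, and H^2 is at most a
    constant times the 2p-th power of the Lorentz norm; dividing by that power leaves the distance.
    If delta >= H, it is enough that the distance is at most 1. *)

Section integral_rV.
Context {R : realType}.
Local Notation leb := (@lebesgue_measure R).

(** Lebesgue measure and c times its image under x -> a + c x agree on half-open intervals, hence
    everywhere. *)
Lemma ge0_integral_affine (f : R -> \bar R) (a c : R) : 0 < c ->
  measurable_fun [set: R] f -> (forall x, 0 <= f x)%E ->
  (\int[leb]_x f x = c%:E * \int[leb]_x f (a + c * x)%R)%E.
Proof.
move=> c0 mf f0.
pose T := fun x : R => a + c * x.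
have mT : measurable_fun [set: measurableTypeR R] (T : measurableTypeR R -> measurableTypeR R).
  by apply: measurable_funD => //; apply: measurable_funM.
pose nu0 : {measure set (measurableTypeR R) -> \bar R} :=
  mscale (NngNum (ltW c0)) (pushforward leb (T : R -> measurableTypeR R)).
pose nu := nu0 mT.
have E A : measurable A -> leb A = nu A.
  apply: lebesgue_measure_unique => _ [[u v] _ <-]/=.
  rewrite /nu /mscale /= /pushforward.
  rewrite (_ : T @^-1` _ = `](u - a) / c, (v - a) / c]%classic); last first.
    apply/seteqP; split => x /=; rewrite !in_itv/= /T ltr_pdivrMr// ler_pdivlMr//;
    by move=> /andP[? ?]; apply/andP; split; lra.
  rewrite !lebesgue_measure_itv/= !lte_fin ltr_pM2r ?invr_gt0// ltrD2r.
  case: ifPn => // uv; last by rewrite mule0.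
  rewrite -!EFinD -EFinM; congr EFin; rewrite -mulrBl; field; lra.
rewrite (eq_measure_integral nu); last by move=> A mA _; exact: E.
rewrite ge0_integral_mscale//=.
have := @ge0_integral_pushforward _ _ _ _ R _ mT leb _ f measurableT mf (fun y _ => f0 y).
by rewrite preimage_setT => <-.
Qed.

Lemma ge0_integral_lebesgueNS n (f : 'rV[R]_n.+1 -> \bar R) :
  measurable_fun [set: 'rV[R]_n.+1] f -> (forall x, 0 <= f x)%E ->
  (\int[lebesgueN n.+1]_x f x =
   \int[leb]_a \int[lebesgueN n]_v f (rV_cons (a, v)))%E.
Proof.
move=> mf f0.
have mc : measurable_fun [set: measurableTypeR R * 'rV[R]_n] (@rV_cons R n).
  exact: measurable_rV_cons.
pose m : {measure set (measurableTypeR R * 'rV[R]_n) -> \bar R} := (leb \x lebesgueN n)%E.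
transitivity (\int[m]_x (f \o @rV_cons R n) x)%E.
  rewrite -[setT in RHS](@preimage_setT _ _ (@rV_cons R n)).
  by rewrite -(@ge0_integral_pushforward _ _ _ _ _ _ mc m).
apply: (@fubini_tonelli1 _ _ _ _ R leb (lebesgueN n) (f \o @rV_cons R n)) => //=.
exact: measurableT_comp mc.
Qed.
End integral_rV.

Section rV_meas.
Context {R : realType}.
Context d (T : measurableType d) (N : nat).
Implicit Types (f g : T -> 'rV[R]_N) (a b : T -> R).

Lemma measurable_rVD f g : measurable_fun [set: T] f -> measurable_fun [set: T] g ->
  measurable_fun [set: T] (fun t => f t + g t).
Proof.
move=> /measurable_fun_rVP mf /measurable_fun_rVP mg; apply/measurable_fun_rVP => i.
by under eq_fun do rewrite mxE; exact: measurable_funD.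
Qed.

Lemma measurable_rVZ a f : measurable_fun [set: T] a -> measurable_fun [set: T] f ->
  measurable_fun [set: T] (fun t => a t *: f t).
Proof.
move=> ma /measurable_fun_rVP mf; apply/measurable_fun_rVP => i.
by under eq_fun do rewrite mxE; exact: measurable_funM.
Qed.

Lemma measurable_rVN f : measurable_fun [set: T] f ->
  measurable_fun [set: T] (fun t => - f t).
Proof.
move=> /measurable_fun_rVP mf; apply/measurable_fun_rVP => i.
by under eq_fun do rewrite mxE; exact: measurableT_comp.
Qed.

Lemma measurable_rVB f g : measurable_fun [set: T] f -> measurable_fun [set: T] g ->
  measurable_fun [set: T] (fun t => f t - g t).
Proof. by move=> mf mg; apply: measurable_rVD => //; exact: measurable_rVN. Qed.

Lemma measurable_fun_enorm f : measurable_fun [set: T] f ->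
  measurable_fun [set: T] (fun t => enorm (f t)).
Proof.
move=> /measurable_fun_rVP mf; rewrite /enorm.
apply: measurableT_comp => //.
  apply: continuous_measurable_fun; exact: sqrt_continuous.
by apply: measurable_sum => i; apply: measurable_funX.
Qed.

Lemma measurable_lt_natr a b : measurable_fun [set: T] a -> measurable_fun [set: T] b ->
  measurable_fun [set: T] (fun t => (a t < b t)%R%:R : R).
Proof.
move=> ma mb.
rewrite (_ : (fun _ => _) = (fun t => if (a t < b t)%R then 1 else 0)); last first.
  by apply/funext => t; case: ifPn.
by apply: measurable_fun_ifT => //; exact: measurable_fun_ltr.
Qed.

Lemma measurable_le_natr a b : measurable_fun [set: T] a -> measurable_fun [set: T] b ->
  measurable_fun [set: T] (fun t => (a t <= b t)%R%:R : R).
Proof.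
move=> ma mb.
rewrite (_ : (fun _ => _) = (fun t => if (a t <= b t)%R then 1 else 0)); last first.
  by apply/funext => t; case: ifPn.
by apply: measurable_fun_ifT => //; exact: measurable_fun_ler.
Qed.
End rV_meas.

Lemma measurable_fun_inv {R : realType} d (T : measurableType d) (f : T -> R) :
  measurable_fun [set: T] f -> measurable_fun [set: T] (fun t => (f t)^-1).
Proof.
move=> mf.
(* The power -1 is the inverse only on nonnegative reals, so negative values pass through their
   opposite. *)
rewrite (_ : (fun t => _) = (fun t => if f t < 0 then - ((- f t) `^ (-1)) else (f t) `^ (-1))).
  apply: measurable_fun_ifT.
  - by apply: measurable_fun_ltr.
  - apply: measurableT_comp => //; apply: (measurableT_comp (@measurable_powR _ _)).
    exact: measurableT_comp.
  - exact: (measurableT_comp (@measurable_powR _ _)).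
apply/funext => t; case: ltP => h; last by rewrite powR_inv1.
by rewrite powR_inv1 ?oppr_ge0 ?ltW// invrN opprK.
Qed.

Ltac mfun_step := match goal with
  | h : measurable_fun _ ?f |- measurable_fun _ ?g => constr_eq f g; exact: h
  | |- measurable_fun _ (fun x => ?c) => exact: measurable_cst
  | |- measurable_fun _ (fun x => x) => exact: measurable_id
  | |- measurable_fun _ (fun x => fst x) => exact: measurable_fst
  | |- measurable_fun _ (fun x => snd x) => exact: measurable_snd
  | h : measurable_fun _ ?f |- measurable_fun _ (fun x => ?f' (@?g x)) =>
      constr_eq f f'; refine (@measurableT_comp _ _ _ _ _ _ f _ g h _)
  | |- measurable_fun _ (fun x => (@?a x) ^+ _) => apply: measurable_funX
  | |- measurable_fun _ (fun x => @?a x * @?b x) => apply: measurable_funM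
  | |- measurable_fun _ (fun x => (@?a x) `^ _) => apply: (measurableT_comp (@measurable_powR _ _))
  | |- measurable_fun _ (fun x => GRing.natmul _ (nat_of_bool (@?b x))) =>
      first [apply: measurable_lt_natr | apply: measurable_le_natr]
  | |- measurable_fun _ (fun x => enorm (@?a x)) => apply: measurable_fun_enorm
  | |- measurable_fun _ (fun x => (@?a x)^-1) => apply: measurable_fun_inv
  | |- measurable_fun _ (fun x => `|@?a x|) => apply: (measurableT_comp (@normr_measurable _ _))
  | |- measurable_fun _ (fun x => @?a x - @?b x) =>
      first [apply: measurable_funB | apply: measurable_rVB]
  | |- measurable_fun _ (fun x => @?a x + @?b x) =>
      first [apply: measurable_funD | apply: measurable_rVD]
  | |- measurable_fun _ (fun x => - @?a x) =>
      first [apply: (measurableT_comp (@oppr_measurable _ _)) | apply: measurable_rVN]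
  | |- measurable_fun _ (fun x => @?a x *: @?b x) => apply: measurable_rVZ
  | |- measurable_fun _ (fun x => (@?a x, @?b x)) => apply: measurable_fun_pair
  | |- _ => exact: measurable_rV_coord
  | |- _ => exact: measurable_id
  | |- _ => exact: measurable_cst
  | |- _ => exact: measurable_fst
  | |- _ => exact: measurable_snd
  | |- _ => assumption
  | |- _ => apply: measurable_funX
  | |- _ => apply: measurable_funM
  | |- _ => apply: (measurableT_comp (@measurable_powR _ _))
  | |- _ => apply: measurable_lt_natr
  | |- _ => apply: measurable_le_natr
  | |- _ => apply: measurable_fun_enorm
  | |- _ => apply: measurable_fun_inv
  | |- _ => apply: measurable_funB
  | |- _ => apply: measurable_funD
  | |- _ => apply: (measurableT_comp (@normr_measurable _ _))
  | h : measurable_fun _ ?f |- _ => apply: (measurableT_comp h)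
  | |- _ => apply: measurable_rVB
  | |- _ => apply: measurable_rVD
  | |- _ => apply: measurable_rVZ
  | |- _ => apply: measurable_rVN
  | |- _ => apply: measurable_fun_pair
  end.
Ltac mfun := repeat mfun_step.

Section rV_invariance.
Context {R : realType}.
Local Notation leb := (@lebesgue_measure R).

Lemma ge0_integral_opp (f : R -> \bar R) :
  measurable_fun [set: R] f -> (forall x, 0 <= f x)%E ->
  (\int[leb]_x f x = \int[leb]_x f (- x)%R)%E.
Proof.
move=> mf f0.
have mT : measurable_fun [set: measurableTypeR R] (-%R : measurableTypeR R -> measurableTypeR R).
  exact: (measurableT_comp (@oppr_measurable R setT)).
pose nu0 : {measure set (measurableTypeR R) -> \bar R} :=
  pushforward leb (-%R : R -> measurableTypeR R).
pose nu := nu0 mT.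
rewrite (eq_measure_integral nu); last first.
  by move=> A mA _; rewrite /nu /= lebesgue_measureN.
have := @ge0_integral_pushforward _ _ _ _ R _ mT leb _ f measurableT mf (fun y _ => f0 y).
by rewrite preimage_setT => <-.
Qed.

Lemma rV_consD n (a b : R) (v w : 'rV[R]_n) :
  rV_cons (a + b, v + w) = rV_cons (a, v) + rV_cons (b, w).
Proof.
apply/rowP => i; rewrite [RHS]mxE; case: (unliftP ord0 i) => [j ->|->].
  by rewrite ?[X in _ + X]rV_consS ?[in RHS]rV_consS [LHS]rV_consS /= mxE.
by rewrite [LHS]rV_cons0 ?[in RHS]rV_cons0.
Qed.

Lemma rV_consZ n (c a : R) (v : 'rV[R]_n) :
  rV_cons (c * a, c *: v) = c *: rV_cons (a, v).
Proof.
apply/rowP => i; rewrite [RHS]mxE; case: (unliftP ord0 i) => [j ->|->].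
  by rewrite ?[X in _ + X]rV_consS ?[in RHS]rV_consS [LHS]rV_consS /= mxE.
by rewrite [LHS]rV_cons0 ?[in RHS]rV_cons0.
Qed.

Lemma rV_consN n (a : R) (v : 'rV[R]_n) : rV_cons (- a, - v) = - rV_cons (a, v).
Proof. by rewrite -[RHS]scaleN1r -rV_consZ mulN1r scaleN1r. Qed.

(** Induction on the dimension: the first coordinate yields one factor c by the one-dimensional
    substitution, the others yield the remaining n. *)
Lemma ge0_integral_rV_affine N (f : 'rV[R]_N -> \bar R) (a : 'rV[R]_N) (c : R) : 0 < c ->
  measurable_fun [set: 'rV[R]_N] f -> (forall x, 0 <= f x)%E ->
  (\int[lebesgueN N]_x f x = (c ^+ N)%:E * \int[lebesgueN N]_x f (a + c *: x)%R)%E.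
Proof.
move=> c0; elim: N f a => [|n IH] f a mf f0.
  rewrite expr0 mul1e; apply: eq_integral => x _; congr f.
  by apply/rowP => -[].
have mfc : measurable_fun [set: measurableTypeR R * 'rV[R]_n] (f \o @rV_cons R n).
  exact: measurableT_comp (@measurable_rV_cons R n).
have ma : measurable_fun [set: 'rV[R]_n.+1] (fun x => a + c *: x) by mfun.
have mfa := measurableT_comp mf ma.
have mfac : measurable_fun [set: measurableTypeR R * 'rV[R]_n]
   ((fun x => f (a + c *: x)) \o @rV_cons R n).
  exact: measurableT_comp (@measurable_rV_cons R n).
rewrite (ge0_integral_lebesgueNS mf f0) (ge0_integral_lebesgueNS mfa (fun x => f0 _)).
have mF := @measurable_fun_fubini_tonelli_F _ _ _ _ _ (lebesgueN n) _ mfc (fun x => f0 _).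
have mG := @measurable_fun_fubini_tonelli_F _ _ _ _ _ (lebesgueN n) _ mfac (fun x => f0 _).
rewrite (@ge0_integral_affine R (fun t => \int[lebesgueN n]_v f (rV_cons (t, v)))%E (a 0 0) c c0 mF (fun x => integral_ge0 _ (fun _ _ => f0 _))).
rewrite exprS EFinM -muleA; congr (_ * _)%E.
rewrite -ge0_integralZl//; last 2 first.
- by move=> x _; apply: integral_ge0 => v _; exact: f0.
- by rewrite lee_fin exprn_ge0// ltW.
apply: eq_integral => t _.
rewrite (IH (fun v => f (rV_cons (a 0 0 + c * t, v))) (\row_j a 0 (lift ord0 j)))//; last first.
  apply: (measurableT_comp mf); apply: (measurableT_comp (@measurable_rV_cons R n)).
  exact: measurable_fun_pair.
congr (_ * _)%E; apply: eq_integral => v _; congr f.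
rewrite rV_consD rV_consZ; congr (_ + _).
apply/rowP => i; case: (unliftP ord0 i) => [j ->|->].
  by rewrite rV_consS/= mxE.
by rewrite rV_cons0.
Qed.

Lemma ge0_integral_rV_opp N (f : 'rV[R]_N -> \bar R) :
  measurable_fun [set: 'rV[R]_N] f -> (forall x, 0 <= f x)%E ->
  (\int[lebesgueN N]_x f x = \int[lebesgueN N]_x f (- x)%R)%E.
Proof.
elim: N f => [|n IH] f mf f0.
  by apply: eq_integral => x _; congr f; apply/rowP => -[].
have mfc : measurable_fun [set: measurableTypeR R * 'rV[R]_n] (f \o @rV_cons R n).
  exact: measurableT_comp (@measurable_rV_cons R n).
have ma : measurable_fun [set: 'rV[R]_n.+1] (fun x : 'rV[R]_n.+1 => - x) by mfun.
have mfa := measurableT_comp mf ma.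
rewrite (ge0_integral_lebesgueNS mf f0) (ge0_integral_lebesgueNS mfa (fun x => f0 _)).
have mF := @measurable_fun_fubini_tonelli_F _ _ _ _ _ (lebesgueN n) _ mfc (fun x => f0 _).
rewrite (@ge0_integral_opp (fun t => \int[lebesgueN n]_v f (rV_cons (t, v)))%E mF (fun x => integral_ge0 _ (fun _ _ => f0 _))).
apply: eq_integral => t _.
rewrite (IH (fun v => f (rV_cons (- t, v))))//; last first.
  apply: (measurableT_comp mf); apply: (measurableT_comp (@measurable_rV_cons R n)).
  exact: measurable_fun_pair.
apply: eq_integral => v _; congr f.
exact: rV_consN.
Qed.
End rV_invariance.

(** * The Euclidean norm and its isometries *)

Section enorm.
Context {R : realType}.

Definition dotr n (x y : 'rV[R]_n) : R := \sum_i x 0 i * y 0 i.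

Lemma dotrDl n (x y z : 'rV[R]_n) : dotr (x + y) z = dotr x z + dotr y z.
Proof. by rewrite /dotr -big_split/=; apply: eq_bigr => i _; rewrite mxE mulrDl. Qed.

Lemma dotrZl n c (x z : 'rV[R]_n) : dotr (c *: x) z = c * dotr x z.
Proof. by rewrite /dotr mulr_sumr; apply: eq_bigr => i _; rewrite mxE mulrA. Qed.

Lemma dotrC n (x z : 'rV[R]_n) : dotr x z = dotr z x.
Proof. by rewrite /dotr; apply: eq_bigr => i _; rewrite mulrC. Qed.

Lemma dotrNl n (x z : 'rV[R]_n) : dotr (- x) z = - dotr x z.
Proof. by rewrite -scaleN1r dotrZl mulN1r. Qed.

Lemma dotr_ge0 n (x : 'rV[R]_n) : 0 <= dotr x x.
Proof. by apply: sumr_ge0 => i _; rewrite -expr2 sqr_ge0. Qed.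

Lemma dotr_eq0 n (x : 'rV[R]_n) : (dotr x x == 0) = (x == 0).
Proof.
apply/eqP/eqP => [/eqP|->]; last by rewrite /dotr big1// => i _; rewrite mxE mul0r.
rewrite psumr_eq0 => [/allP h|i _]; last by rewrite -expr2 sqr_ge0.
apply/rowP => i; rewrite mxE.
by have := h i (mem_index_enum i); rewrite /= -expr2 sqrf_eq0 => /eqP.
Qed.

Lemma enormE n (x : 'rV[R]_n) : enorm x = Num.sqrt (dotr x x).
Proof. by congr Num.sqrt; apply: eq_bigr => i _; rewrite expr2. Qed.

Lemma enorm_ge0 n (x : 'rV[R]_n) : 0 <= enorm x.
Proof. exact: sqrtr_ge0. Qed.

Lemma sqr_enorm n (x : 'rV[R]_n) : enorm x ^+ 2 = dotr x x.
Proof. by rewrite enormE sqr_sqrtr// dotr_ge0. Qed.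

Lemma enorm_eq0 n (x : 'rV[R]_n) : (enorm x == 0) = (x == 0).
Proof. by rewrite -dotr_eq0 -sqr_enorm sqrf_eq0. Qed.

Lemma enorm_gt0 n (x : 'rV[R]_n) : (0 < enorm x) = (x != 0).
Proof. by rewrite lt_def enorm_ge0 andbT enorm_eq0. Qed.

Lemma enorm0 n : enorm (0 : 'rV[R]_n) = 0.
Proof. by apply/eqP; rewrite enorm_eq0. Qed.

Lemma enormZ n c (x : 'rV[R]_n) : enorm (c *: x) = `|c| * enorm x.
Proof.
by rewrite !enormE dotrZl dotrC dotrZl mulrA -expr2 sqrtrM ?sqr_ge0// sqrtr_sqr.
Qed.

Lemma enormN n (x : 'rV[R]_n) : enorm (- x) = enorm x.
Proof. by rewrite -scaleN1r enormZ normrN1 mul1r. Qed.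

Lemma enormB n (x y : 'rV[R]_n) : enorm (x - y) = enorm (y - x).
Proof. by rewrite -opprB enormN. Qed.

Lemma ler_coord_enorm n (x : 'rV[R]_n) i : `|x 0 i| <= enorm x.
Proof.
rewrite -ler_sqr ?nnegrE ?enorm_ge0// sqr_enorm real_normK ?num_real// /dotr.
rewrite (bigD1 i)//= -expr2 lerDl; apply: sumr_ge0 => j _; by rewrite -expr2 sqr_ge0.
Qed.

Lemma enorm_rV_cons n a (v : 'rV[R]_n) : enorm (rV_cons (a, v)) ^+ 2 = a ^+ 2 + enorm v ^+ 2.
Proof.
rewrite !sqr_enorm /dotr big_ord_recl rV_cons0 -expr2; congr (_ + _).
by apply: eq_bigr => i _; rewrite rV_consS.
Qed.

Lemma dotr_delta n (x : 'rV[R]_n.+1) : dotr (delta_mx 0 0) x = x 0 0.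
Proof.
rewrite /dotr big_ord_recl mxE !eqxx mul1r big1 ?addr0// => i _.
by rewrite mxE eqxx/= mul0r.
Qed.

Lemma enorm_delta n : enorm (delta_mx 0 0 : 'rV[R]_n.+1) = 1.
Proof. by rewrite enormE dotr_delta mxE !eqxx sqrtr1. Qed.

(** Reflections already act transitively on the unit sphere, so isometries are taken to be
    self-inverse: [O] serves as its own inverse in changes of variables. *)
Definition rV_isometry n (O : 'rV[R]_n -> 'rV[R]_n) :=
  [/\ measurable_fun [set: 'rV[R]_n] O, involutive O, {morph O : x y / x + y} &
      forall x, enorm (O x) = enorm x].

Lemma rV_isometryN n (O : 'rV[R]_n -> 'rV[R]_n) : rV_isometry O -> {morph O : x / - x}.
Proof.
move=> [_ _ OD _] x; apply/eqP; rewrite -subr_eq0 opprK -OD addNr.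
by have /eqP := OD 0 0; rewrite addr0 -subr_eq0 opprD addrA subrr sub0r oppr_eq0.
Qed.

Lemma rV_isometryB n (O : 'rV[R]_n -> 'rV[R]_n) : rV_isometry O ->
  {morph O : x y / x - y}.
Proof. by move=> hO x y; rewrite -(rV_isometryN hO); case: hO => _ _ ->. Qed.

Lemma measurable_dotr n z : measurable_fun [set: 'rV[R]_n] (fun x => dotr x z).
Proof. by apply: measurable_sum => i; mfun. Qed.

(* The Householder reflection exchanging the first basis vector and x. *)
Lemma exists_rV_isometry n (x : 'rV[R]_n.+1) : enorm x = 1 ->
  exists2 O, rV_isometry O & O (delta_mx 0 0) = x.
Proof.
move=> x1; pose e : 'rV[R]_n.+1 := delta_mx 0 0; pose w := x - e.
have [xe|xe] := eqVneq x e.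
  by exists id => //; split=> //; exact: measurable_id.
have w0 : dotr w w != 0 by rewrite dotr_eq0 subr_eq0.
pose O y := y - (2 * dotr y w / dotr w w) *: w.
have xx : dotr x x = 1 by rewrite -sqr_enorm x1 expr1n.
have ee : dotr e e = 1 by rewrite -sqr_enorm enorm_delta expr1n.
have ww : dotr w w = 2 - 2 * dotr e x.
  rewrite /w !dotrDl !dotrNl ![dotr _ (x - e)]dotrC !dotrDl !dotrNl xx ee [dotr x e]dotrC.
  ring.
have ew : dotr e w = dotr e x - 1.
  by rewrite dotrC /w dotrDl dotrNl ee dotrC.
have OD : {morph O : y z / y + z}.
  move=> y z; rewrite /O dotrDl mulrDr mulrDl scalerDl opprD addrACA; congr (_ + _ + _).
have Ow y : dotr (O y) w = - dotr y w.
  rewrite /O dotrDl dotrNl dotrZl mulfVK//; ring.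
exists O.
  split => //.
  - rewrite /O; apply: measurable_rVB => //; apply: measurable_rVZ => //.
    apply: measurable_funM => //; apply: measurable_funM => //.
    exact: measurable_dotr.
  - move=> y; rewrite [LHS]/O Ow /O mulrN mulNr scaleNr opprK subrK//.
  - move=> y; rewrite !enormE; congr Num.sqrt.
    rewrite {1}/O dotrDl dotrNl dotrZl [dotr w (O y)]dotrC Ow.
    rewrite [dotr y (O y)]dotrC /O dotrDl dotrNl dotrZl [dotr w y]dotrC; ring.
have -> : O e = e + w.
  rewrite /O ew -scaleNr; congr (_ + _).
  rewrite (_ : - _ = 1) ?scale1r//.
  by apply: (mulIf w0); rewrite -mulNr mulfVK// mul1r ww; ring.
by rewrite /w addrC subrK.
Qed.
End enorm.

(** * Balls, and invariance of Lebesgue measure under translations, dilations and isometries *)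

Section isometry_invariance.
Context {R : realType} (N : nat).
Local Notation leb := (@lebesgue_measure R).
Local Notation mu := (@lebesgueN R N).

Lemma ge0_integral_rV_shift (f : 'rV[R]_N -> \bar R) (a : 'rV[R]_N) :
  measurable_fun [set: 'rV[R]_N] f -> (forall x, 0 <= f x)%E ->
  (\int[mu]_x f x = \int[mu]_x f (a + x)%R)%E.
Proof.
move=> mf f0; rewrite (ge0_integral_rV_affine a ltr01 mf f0) expr1n mul1e.
by apply: eq_integral => x _; rewrite scale1r.
Qed.

Lemma ge0_integral_rV_scale (f : 'rV[R]_N -> \bar R) (c : R) : 0 < c ->
  measurable_fun [set: 'rV[R]_N] f -> (forall x, 0 <= f x)%E ->
  (\int[mu]_x f x = (c ^+ N)%:E * \int[mu]_x f (c *: x)%R)%E.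
Proof.
move=> c0 mf f0; rewrite (ge0_integral_rV_affine 0 c0 mf f0); congr (_ * _)%E.
by apply: eq_integral => x _; rewrite add0r.
Qed.

Lemma measurable_enorm : measurable_fun [set: 'rV[R]_N] (@enorm R N).
Proof. exact: (measurable_fun_enorm (@measurable_id _ _ _)). Qed.

Definition rV_ball (r : R) : set 'rV[R]_N := [set x | enorm x <= r].

Lemma measurable_rV_ball r : measurable (rV_ball r).
Proof.
rewrite (_ : rV_ball r = (@enorm R N) @^-1` `]-oo, r]); last first.
  by apply/seteqP; split => x; rewrite /rV_ball /= in_itv.
rewrite -[X in measurable X]setTI; exact: measurable_enorm.
Qed.

Definition rV_box (A : 'I_N -> set R) : set 'rV[R]_N := [set x | forall i, A i (x 0 i)].

Lemma lebesgueN_cube (A : 'I_N -> set R) (c : R) : (forall i, measurable (A i)) ->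
  (forall i, leb (A i) = c%:E) ->
  mu (rV_box A) = (c ^+ N)%:E.
Proof.
move=> mA Ac; rewrite /rV_box lebesgueN_box// (eq_bigr (fun=> c%:E)); last by move=> i _; exact: Ac.
rewrite big_const card_ord; elim: N => //= n ->; by rewrite exprS EFinM.
Qed.

Lemma measurable_rV_box (A : 'I_N -> set R) : (forall i, measurable (A i)) ->
  measurable (rV_box A).
Proof.
move=> mA; rewrite [X in measurable X](_ : _ =
    \bigcap_(i in [set: 'I_N]) ((fun v : 'rV[R]_N => v 0 i) @^-1` A i)).
  apply: fin_bigcap_measurable => // i _; rewrite -[X in measurable X]setTI.
  exact: measurable_rV_coord.
by apply/seteqP; split => [v Av i _|v Av i]; exact: Av.
Qed.

Lemma rV_ball_lty r : (mu (rV_ball r) < +oo)%E.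
Proof.
have [r0|r0] := leP r 0.
  apply: (@le_lt_trans _ _ (mu (rV_box (fun=> `[0, 0]%classic)))).
    apply: le_measure; rewrite ?inE.
    - exact: measurable_rV_ball.
    - by apply: measurable_rV_box.
    - move=> x xr i /=; rewrite in_itv/= -eq_le eq_sym -normr_eq0 eq_le normr_ge0 andbT.
      exact: le_trans (ler_coord_enorm x i) (le_trans xr r0).
  rewrite (@lebesgueN_cube _ 0)// ?ltry// => i.
  by rewrite lebesgue_measure_itv/= ltxx.
apply: (@le_lt_trans _ _ (mu (rV_box (fun=> `[- r, r]%classic)))).
  apply: le_measure; rewrite ?inE.
  - exact: measurable_rV_ball.
  - by apply: measurable_rV_box.
  - move=> x xr i /=; rewrite in_itv/= -ler_norml.
    exact: le_trans (ler_coord_enorm x i) xr.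
rewrite (@lebesgueN_cube _ (r + r))// ?ltry// => i.
by rewrite lebesgue_measure_itv/= lte_fin ifT ?opprK// ; lra.
Qed.

Lemma rV_ball_gt0 r : 0 < r -> (0 < mu (rV_ball r))%E.
Proof.
move=> r0; pose a := r / (N%:R + 1).
have N1 : 0 < N%:R + 1 :> R by rewrite ltr_wpDl.
have a0 : 0 < a by rewrite divr_gt0.
apply: (@lt_le_trans _ _ (mu (rV_box (fun=> `[0, a]%classic)))).
  rewrite (@lebesgueN_cube _ a)// ?lte_fin ?exprn_gt0// => i.
  by rewrite lebesgue_measure_itv/= lte_fin a0 -EFinB subr0.
apply: le_measure; rewrite ?inE.
- by apply: measurable_rV_box.
- exact: measurable_rV_ball.
- move=> x xa; rewrite /rV_ball/= -ler_sqr ?nnegrE ?enorm_ge0 ?(ltW r0)//.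
  rewrite sqr_enorm; apply: (@le_trans _ _ (\sum_(i < N) a ^+ 2)).
    apply: ler_sum => i _; have := xa i; rewrite /= in_itv/= => /andP[x0 xia].
    by rewrite -expr2 ler_sqr// nnegrE ltW.
  rewrite sumr_const card_ord -mulr_natl /a expr_div_n mulrA ler_pdivrMr ?exprn_gt0//.
  rewrite mulrC ler_pM2l ?exprn_gt0//.
  have : 0 <= N%:R :> R by []. nra.
Qed.

Definition rV_unit_ball_vol : R := fine (mu (rV_ball 1)).

Lemma rV_unit_ball_volE : mu (rV_ball 1) = rV_unit_ball_vol%:E.
Proof. by rewrite fineK// ge0_fin_numE// rV_ball_lty. Qed.

Lemma rV_unit_ball_vol_gt0 : 0 < rV_unit_ball_vol.
Proof. by rewrite -lte_fin -rV_unit_ball_volE rV_ball_gt0. Qed.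

Lemma integral_rV_ball r : (\int[mu]_x ((enorm x <= r)%R%:R : R)%:E = mu (rV_ball r))%E.
Proof.
have := integral_indic mu measurableT (measurable_rV_ball r); rewrite setIT => <-.
by apply: eq_integral => x _; rewrite indicE/= /rV_ball mem_setE.
Qed.

(* Uniqueness of Haar measure: both sides, multiplied by the volume of a ball,
   are [\int \int f (x + O y) \1_B (y)]. *)
Lemma ge0_integral_rV_isometry (f : 'rV[R]_N -> \bar R) O : rV_isometry O ->
  measurable_fun [set: 'rV[R]_N] f -> (forall x, 0 <= f x)%E ->
  (\int[mu]_x f x = \int[mu]_x f (O x))%E.
Proof.
move=> hO mf f0; have [mO OK OD Oe] := hO.
pose G y : \bar R := ((enorm (y : 'rV[R]_N) <= 1)%R%:R : R)%:E.
have mG : measurable_fun [set: 'rV[R]_N] G.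
  by apply/measurable_EFinP; apply: measurable_le_natr => //; exact: measurable_enorm.
have G0 y : (0 <= G y)%E by rewrite lee_fin.
have IG : (\int[mu]_y G y = rV_unit_ball_vol%:E)%E.
  by rewrite /G integral_rV_ball rV_unit_ball_volE.
have mfO : measurable_fun [set: 'rV[R]_N] (f \o O) by exact: measurableT_comp.
suff : ((\int[mu]_x f x) * rV_unit_ball_vol%:E = (\int[mu]_x f (O x)) * rV_unit_ball_vol%:E)%E.
  have b0 := rV_unit_ball_vol_gt0.
  move=> /(congr1 (fun z => z * (rV_unit_ball_vol^-1)%:E)%E).
  by rewrite -!muleA -!EFinM divff ?gt_eqF// !mule1.
have I0 (h : 'rV[R]_N -> \bar R) : (forall x, 0 <= h x)%E -> (0 <= \int[mu]_x h x)%E.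
  by move=> h0; apply: integral_ge0.
transitivity (\int[mu]_y \int[mu]_x (f (x + O y)%R * G y))%E.
  rewrite -IG -ge0_integralZl//; last by apply: I0.
  apply: eq_integral => y _.
  rewrite ge0_integralZr//; last first.
    by apply: (measurableT_comp mf); mfun.
  congr (_ * _)%E; rewrite (ge0_integral_rV_shift (O y) mf f0).
  by apply: eq_integral => x _; rewrite addrC.
transitivity (\int[mu]_x \int[mu]_y (f (x + O y)%R * G y))%E.
  have mH : measurable_fun [set: 'rV[R]_N * 'rV[R]_N] (fun z => f (z.2 + O z.1)%R * G z.1)%E.
    apply: emeasurable_funM.
      apply: (measurableT_comp mf); mfun.
    exact: (measurableT_comp mG).
  exact: (@fubini_tonelli _ _ _ _ R mu mu _ mH (fun z => mule_ge0 (f0 _) (G0 _))).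
transitivity (\int[mu]_x \int[mu]_y (f (O y) * G (O y - x)%R))%E.
  apply: eq_integral => x _.
  (* Replacing y by y - O x frees f from x, because O (y - O x) = O y - x; and [G] depends only on
     the norm, which [O] preserves. *)
  rewrite (@ge0_integral_rV_shift (fun y => f (x + O y)%R * G y)%E (- O x)).
  - apply: eq_integral => y _; rewrite OD (rV_isometryN hO) OK addrA subrr add0r.
    congr (_ * _)%E; rewrite /G -[X in enorm X <= _]OK OD Oe (rV_isometryN hO) OK addrC.
    by rewrite -Oe (rV_isometryB hO) OK.
  - apply: emeasurable_funM => //.
    apply: (measurableT_comp mf); mfun.
  - by move=> y; rewrite mule_ge0.
transitivity (\int[mu]_y \int[mu]_x (f (O y) * G (O y - x)%R))%E.
  have mH : measurable_fun [set: 'rV[R]_N * 'rV[R]_N] (fun z => f (O z.2) * G (O z.2 - z.1)%R)%E.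
    apply: emeasurable_funM.
      exact: (measurableT_comp mfO).
    by apply: (measurableT_comp mG); mfun.
  exact: (@fubini_tonelli _ _ _ _ R mu mu _ mH (fun z => mule_ge0 (f0 _) (G0 _))).
rewrite -IG -ge0_integralZr//; last by apply: I0.
apply: eq_integral => y _.
rewrite ge0_integralZl//; last first.
  by apply: (measurableT_comp mG); mfun.
congr (_ * _)%E.
rewrite (@ge0_integral_rV_opp R N (fun x => G (O y - x)%R))//; last first.
  by apply: (measurableT_comp mG); mfun.
rewrite [RHS](ge0_integral_rV_shift (O y))//.
by apply: eq_integral => x _; rewrite opprK.
Qed.
End isometry_invariance.

(** * Homogeneous kernels and polar coordinates *)

Section real_integrals.
Context {R : realType}.

Lemma ge0_integralZl_real d (T : measurableType d) (m : {measure set T -> \bar R})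
    (c : R) (f : T -> R) : 0 <= c -> measurable_fun [set: T] f -> (forall x, 0 <= f x) ->
  (\int[m]_x (c * f x)%:E = c%:E * \int[m]_x (f x)%:E)%E.
Proof.
move=> c0 mf f0; rewrite -ge0_integralZl//.
- exact/measurable_EFinP.
- by move=> x _; rewrite lee_fin.
Qed.

Lemma ge0_le_integral_real d (T : measurableType d) (m : {measure set T -> \bar R})
    (f g : T -> R) : measurable_fun [set: T] f -> measurable_fun [set: T] g ->
    (forall x, 0 <= f x) -> (forall x, f x <= g x) ->
  (\int[m]_x (f x)%:E <= \int[m]_x (g x)%:E)%E.
Proof.
move=> mf mg f0 fg; apply: ge0_le_integral => //.
- by move=> x _; rewrite lee_fin.
- exact/measurable_EFinP.
- exact/measurable_EFinP.
- by move=> x _; rewrite lee_fin.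
Qed.

Lemma ge0_integralD_real d (T : measurableType d) (m : {measure set T -> \bar R})
    (f g : T -> R) : measurable_fun [set: T] f -> measurable_fun [set: T] g ->
    (forall x, 0 <= f x) -> (forall x, 0 <= g x) ->
  (\int[m]_x (f x + g x)%:E = \int[m]_x (f x)%:E + \int[m]_x (g x)%:E)%E.
Proof.
move=> mf mg f0 g0; under eq_integral do rewrite EFinD.
apply: ge0_integralD => //.
- by move=> x _; rewrite lee_fin.
- exact/measurable_EFinP.
- by move=> x _; rewrite lee_fin.
- exact/measurable_EFinP.
Qed.

Lemma tonelli_real d1 d2 (T1 : measurableType d1) (T2 : measurableType d2)
    (m1 : {sigma_finite_measure set T1 -> \bar R})
    (m2 : {sigma_finite_measure set T2 -> \bar R}) (f : T1 -> T2 -> R) :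
  measurable_fun [set: T1 * T2] (fun z => f z.1 z.2) -> (forall x y, 0 <= f x y) ->
  (\int[m1]_x \int[m2]_y (f x y)%:E = \int[m2]_y \int[m1]_x (f x y)%:E)%E.
Proof.
move=> mf f0.
have mH : measurable_fun [set: T1 * T2] (fun z => (f z.1 z.2)%:E) by exact/measurable_EFinP.
exact: (@fubini_tonelli _ _ _ _ R m1 m2 _ mH (fun z => f0 _ _)).
Qed.

Lemma ge0_integral_real d (T : measurableType d) (m : {measure set T -> \bar R})
    (f : T -> R) : (forall x, 0 <= f x) -> (0 <= \int[m]_x (f x)%:E)%E.
Proof. by move=> f0; apply: integral_ge0 => x _; rewrite lee_fin. Qed.

Lemma measurable_integral_real d1 d2 (T1 : measurableType d1) (T2 : measurableType d2)
    (m2 : {sigma_finite_measure set T2 -> \bar R}) (f : T1 -> T2 -> R) :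
  measurable_fun [set: T1 * T2] (fun z => f z.1 z.2) -> (forall x y, 0 <= f x y) ->
  measurable_fun [set: T1] (fun x => \int[m2]_y (f x y)%:E)%E.
Proof.
move=> mf f0.
have mH : measurable_fun [set: T1 * T2] (fun z => (f z.1 z.2)%:E) by exact/measurable_EFinP.
exact: (@measurable_fun_fubini_tonelli_F _ _ _ _ R m2 _ mH (fun z => f0 _ _)).
Qed.

Lemma measurable_section2 d1 d2 (T1 : measurableType d1) (T2 : measurableType d2)
    (f : T1 -> T2 -> R) x : measurable_fun [set: T1 * T2] (fun z => f z.1 z.2) ->
  measurable_fun [set: T2] (f x).
Proof. by move=> mf; exact: (measurableT_comp mf (measurable_fun_pair (measurable_cst x) (@measurable_id _ _ _))). Qed.

Lemma measurable_section1 d1 d2 (T1 : measurableType d1) (T2 : measurableType d2)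
    (f : T1 -> T2 -> R) y : measurable_fun [set: T1 * T2] (fun z => f z.1 z.2) ->
  measurable_fun [set: T1] (f ^~ y).
Proof. by move=> mf; exact: (measurableT_comp mf (measurable_fun_pair (@measurable_id _ _ _) (measurable_cst y))). Qed.
End real_integrals.

(** * Homogeneous kernels invariant under isometries *)

Section kelvin.
Context {R : realType} (n : nat).
Local Notation N := n.+1.
Local Notation mu := (@lebesgueN R N).
Local Notation e := (delta_mx 0 0 : 'rV[R]_N).
Local Notation beta := (@rV_unit_ball_vol R N).

Lemma lebesgueN_set0 : mu [set 0] = 0.
Proof.
have -> : [set (0 : 'rV[R]_N)] = rV_box (fun=> `[0, 0]%classic).
  apply/seteqP; split => [x -> i|x xi]; first by rewrite /= mxE in_itv/= lexx.
  apply/rowP => i; rewrite mxE; apply/eqP; rewrite eq_le.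
  by have := xi i; rewrite /= in_itv/= andbC.
rewrite (@lebesgueN_cube _ _ _ 0) ?expr0n// => i.
by rewrite lebesgue_measure_itv/= ltxx.
Qed.

Lemma integral_punctured_ball :
  (\int[mu]_x ((0 < enorm x)%R%:R * (enorm x <= 1)%R%:R : R)%:E = beta%:E)%E.
Proof.
rewrite -rV_unit_ball_volE -integral_rV_ball.
apply: ge0_ae_eq_integral => //.
- apply/measurable_EFinP; have me := @measurable_enorm R N; mfun.
- apply/measurable_EFinP; have me := @measurable_enorm R N; mfun.
exists [set 0]; split.
- rewrite (_ : [set 0] = rV_ball 0); first exact: measurable_rV_ball.
  apply/seteqP; split => [x ->|x]; rewrite /rV_ball/= ?enorm0//.
  by rewrite le_eqVlt ltNge enorm_ge0 orbF enorm_eq0 => /eqP.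
- exact: lebesgueN_set0.
- move=> x /=; apply: contra_notP => /eqP x0 _.
  by rewrite enorm_gt0 x0 mul1r.
Qed.

Variables (k : 'rV[R]_N -> 'rV[R]_N -> R) (g : R).
Hypotheses (g0 : 0 < g) (k0 : forall x y, 0 <= k x y)
  (mk : measurable_fun [set: 'rV[R]_N * 'rV[R]_N] (fun z => k z.1 z.2))
  (kC : forall x y, k x y = k y x)
  (kZ : forall c x y, 0 < c -> k (c *: x) (c *: y) = c `^ (- (N%:R + g)) * k x y)
  (kO : forall O x y, rV_isometry O -> k (O x) (O y) = k x y).

Let mkx x : measurable_fun [set: 'rV[R]_N] (k x).
Proof. exact: measurable_section2. Qed.

(** Scaling by |x| and reflecting x / |x| onto e reduce the pole x to e: the measure contributes
    |x|^N and the kernel |x|^{-(N + g)}. At x = 0 both sides vanish, as division by 0 gives 0, F 0 =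
    0, and 0 to the power -g is 0. *)
Lemma homogeneous_kernel_integral (F : R -> R) (x : 'rV[R]_N) :
  measurable_fun [set: R] F -> (forall r, 0 <= F r) -> F 0 = 0 ->
  (\int[mu]_y (F (enorm y / enorm x) * k x y)%R%:E =
   (enorm x `^ (- g))%:E * \int[mu]_y (F (enorm y) * k e y)%R%:E)%E.
Proof.
move=> mF F0 F00; have me := @measurable_enorm R N.
have [->|x0] := eqVneq x 0.
  rewrite enorm0 powR0 ?oppr_eq0 ?gt_eqF// mul0e; under eq_integral do rewrite invr0 mulr0 F00 mul0r.
  exact: integral0.
have nx0 : 0 < enorm x by rewrite enorm_gt0.
have [T hT Te] : exists2 T, rV_isometry T & T e = (enorm x)^-1 *: x.
  apply: exists_rV_isometry; rewrite enormZ gtr0_norm ?invr_gt0// mulVf// gt_eqF//.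
have [mT TK TD Tn] := hT.
rewrite (ge0_integral_rV_scale nx0); last 2 first.
- by apply/measurable_EFinP; mfun.
- by move=> y; rewrite lee_fin mulr_ge0.
have E y : (F (enorm (enorm x *: y) / enorm x) * k x (enorm x *: y) =
   enorm x `^ (- (N%:R + g)) * (F (enorm y) * k (T e) y))%R.
  rewrite enormZ gtr0_norm//.
  have -> : enorm x * enorm y / enorm x = enorm y by rewrite mulrC mulKf ?gt_eqF.
  have -> : k x (enorm x *: y) = k (enorm x *: (T e)) (enorm x *: y).
    by rewrite Te scalerA divff ?gt_eqF// scale1r.
  by rewrite kZ// mulrCA.
under eq_integral do rewrite E.
rewrite ge0_integralZl_real ?powR_ge0//; last 2 first.
- by mfun.
- by move=> y; rewrite mulr_ge0.
rewrite muleA -EFinM; congr (_%:E * _)%E.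
  rewrite -powR_mulrn ?enorm_ge0// -powRD; first by rewrite opprD addrA subrr add0r.
  by rewrite (gt_eqF nx0) implybT.
rewrite (ge0_integral_rV_isometry hT).
- by apply: eq_integral => y _; rewrite Tn -(kO e (T y) hT) TK.
- by apply/measurable_EFinP; mfun.
- by move=> y; rewrite lee_fin mulr_ge0.
Qed.

(* The kernel is invariant under the inversion [y |-> y / |y|^2]; integrating
   [chi |x| F (|y| / |x|) k x y] in both orders gives it on radial functions. *)
Lemma homogeneous_kernel_inversion (F : R -> R) :
  measurable_fun [set: R] F -> (forall r, 0 <= F r) -> F 0 = 0 ->
  (\int[mu]_y (F (enorm y) * k e y)%R%:E =
   \int[mu]_y (F (enorm y)^-1 * enorm y `^ (g - N%:R) * k e y)%R%:E)%E.
Proof.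
move=> mF F0 F00; have me := @measurable_enorm R N.
(* Chosen so that chi(|x|) |x|^{-g} is the indicator of the punctured unit ball; its integral is
   positive and finite and can be cancelled at the end. *)
pose chi (r : R) : R := (r <= 1)%R%:R * r `^ g.
have chi0 r : 0 <= chi r by rewrite mulr_ge0 ?powR_ge0.
have mchi : measurable_fun [set: R] chi.
  by rewrite /chi; mfun.
have IA : (\int[mu]_x (chi (enorm x) * enorm x `^ (- g))%R%:E = beta%:E)%E.
  rewrite -integral_punctured_ball; apply: eq_integral => x _; congr EFin.
  rewrite /chi -mulrA mulrC; have [x0|] := ltP 0 (enorm x).
    by rewrite powRN mulfV ?mul1r// gt_eqF// powR_gt0.
  rewrite le_eqVlt ltNge enorm_ge0 orbF => /eqP ->.
  by rewrite powR0 ?gt_eqF// !mul0r.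
clearbody chi.
suff : (beta%:E * \int[mu]_y (F (enorm y) * k e y)%R%:E =
   beta%:E * \int[mu]_y (F (enorm y)^-1 * enorm y `^ (g - N%:R) * k e y)%R%:E)%E.
  have b0 := @rV_unit_ball_vol_gt0 R N.
  move=> /(congr1 (fun z => (beta^-1)%:E * z)%E).
  by rewrite !muleA -!EFinM mulVf ?gt_eqF// !mul1e.
have Q0 : (0 <= \int[mu]_y (F (enorm y) * k e y)%R%:E)%E.
  by apply: ge0_integral_real => y; rewrite mulr_ge0.
rewrite -IA -ge0_integralZr//; last 2 first.
- by apply/measurable_EFinP; mfun.
- by move=> x _; rewrite lee_fin mulr_ge0 ?powR_ge0.
have m1 : measurable_fun [set: 'rV[R]_N * 'rV[R]_N]
    (fun z => chi (enorm z.1) * (F (enorm z.2 / enorm z.1) * k z.1 z.2)).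
  by mfun.
transitivity (\int[mu]_x \int[mu]_y (chi (enorm x) * (F (enorm y / enorm x) * k x y))%R%:E)%E.
  apply: eq_integral => x _; rewrite ge0_integralZl_real//; last 2 first.
  - by have mkx' := @mkx x; mfun.
  - by move=> y; rewrite mulr_ge0.
  by rewrite homogeneous_kernel_integral// EFinM muleA.
rewrite (@tonelli_real _ _ _ _ _ mu mu
  (fun x y => chi (enorm x) * (F (enorm y / enorm x) * k x y)) m1); last by move=> x y; rewrite !mulr_ge0 ?powR_ge0.
have m2 : measurable_fun [set: 'rV[R]_N * 'rV[R]_N]
    (fun z => enorm z.1 `^ (- g) * (chi (enorm z.2 * enorm z.1) * F (enorm z.2)^-1 * k e z.2)).
  by have mke := @mkx e; mfun.
transitivity (\int[mu]_y \int[mu]_x (enorm y `^ (- g) *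
   (chi (enorm x * enorm y) * F (enorm x)^-1 * k e x))%R%:E)%E.
  apply: eq_integral => y _.
  rewrite ge0_integralZl_real ?powR_ge0//; last 2 first.
  - by have mke := @mkx e; mfun.
  - by move=> x; rewrite !mulr_ge0.
  have [y0|y0] := eqVneq y 0.
    rewrite y0 enorm0 powR0 ?oppr_eq0 ?gt_eqF// mul0e.
    by under eq_integral do rewrite mul0r F00 mul0r mulr0; rewrite integral0.
  (* With x and y exchanged by symmetry of the kernel, this is the reduction to e for the pole y: at
     r = |x| / |y| the two factors are chi(|x|) and F(|y| / |x|). *)
  rewrite -(@homogeneous_kernel_integral (fun r => chi (r * enorm y) * F r^-1)).
  - apply: eq_integral => x _; rewrite divfK ?enorm_eq0// invf_div kC; congr EFin; ring.
  - by mfun.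
  - by move=> r; rewrite mulr_ge0.
  - by rewrite invr0 F00 mulr0.
rewrite (@tonelli_real _ _ _ _ _ mu mu (fun y x => enorm y `^ (- g) *
   (chi (enorm x * enorm y) * F (enorm x)^-1 * k e x)) m2); last by move=> x y; rewrite !mulr_ge0 ?powR_ge0.
rewrite IA -ge0_integralZl_real ?ltW ?rV_unit_ball_vol_gt0//; last 2 first.
- by have mke := @mkx e; mfun.
- by move=> y; rewrite !mulr_ge0 ?powR_ge0.
apply: eq_integral => x _.
have [x0|x0] := eqVneq x 0.
  rewrite x0 enorm0 invr0 F00; under eq_integral do rewrite mulr0 mul0r mulr0.
  by rewrite integral0 !mul0r mulr0.
have nx0 : 0 < enorm x by rewrite enorm_gt0.
have nx1 : 0 < (enorm x)^-1 by rewrite invr_gt0.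
transitivity (\int[mu]_y ((F (enorm x)^-1 * k e x) * (enorm y `^ (- g) * chi (enorm x * enorm y)))%:E)%E.
  by apply: eq_integral => y _; congr EFin; ring.
rewrite ge0_integralZl_real ?mulr_ge0//; last 2 first.
- by mfun.
- by move=> y; rewrite mulr_ge0 ?powR_ge0.
rewrite (ge0_integral_rV_scale nx1); last 2 first.
- by apply/measurable_EFinP; mfun.
- by move=> y; rewrite lee_fin mulr_ge0 ?powR_ge0.
transitivity ((F (enorm x)^-1 * k e x)%:E * (((enorm x)^-1 ^+ N)%:E *
   \int[mu]_y (enorm x `^ g * (chi (enorm y) * enorm y `^ (- g)))%:E))%E.
  congr (_ * (_ * _))%E; apply: eq_integral => y _; congr EFin.
  rewrite enormZ gtr0_norm// mulVKf ?gt_eqF// powRM ?enorm_ge0 ?(ltW nx1)//.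
  by rewrite -powR_inv1 ?enorm_ge0// -powRrM mulN1r opprK; ring.
rewrite ge0_integralZl_real ?powR_ge0//; last 2 first.
- by mfun.
- by move=> y; rewrite mulr_ge0 ?powR_ge0.
rewrite IA -!EFinM; congr EFin.
rewrite powRB; last by rewrite (gt_eqF nx0) implybT.
rewrite powR_mulrn ?enorm_ge0// exprVn; ring.
Qed.
End kelvin.

Ltac nneg := intros; rewrite ?lee_fin; repeat first
  [ assumption | done | apply: mulr_ge0 | apply: powR_ge0 | apply: enorm_ge0 | apply: addr_ge0
  | (rewrite invr_ge0) | apply: exprn_ge0 ].

(** * Polar coordinates for radial functions *)

Section radial.
Context {R : realType} (n : nat).
Local Notation leb := (@lebesgue_measure R).
Local Notation N := n.+1.
Local Notation mu := (@lebesgueN R N).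
Local Notation beta := (@rV_unit_ball_vol R N).
Implicit Types (h g : R -> R).

Lemma integral_lebesgue_pow01 :
  (\int[leb]_r ((0 < r)%R%:R * (r <= 1)%R%:R * r ^+ n : R)%:E = (N%:R^-1)%:E)%E.
Proof.
pose F (r : R) := N%:R^-1 * r ^+ N.
have dF (r : R) : is_derive r 1 F (r ^+ n).
  rewrite (_ : F = N%:R^-1 *: (@id R) ^+ N); last by apply/funext => x; rewrite /F !fctE.
  apply: is_derive_eq.
  by rewrite -[_ *: 1]/(_ * _) mulr1 scalerA mulVf// scale1r.
have cF : continuous F.
  by move=> r; apply: differentiable_continuous; apply/derivable1_diffP; case: (dF r).
transitivity (\int[leb]_(r in `[0%R, 1%R]) (r ^+ n)%:E)%E.
  rewrite -integral_itv_obnd_cbnd; last first.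
    by apply/measurable_EFinP; apply: measurable_funTS; mfun.
  rewrite [RHS]integral_mkcond; apply: eq_integral => r _; rewrite patchE mem_setE in_itv/=.
  by case: (0 < r); case: (r <= 1); rewrite ?(mul0r, mul1r).
rewrite (@continuous_FTC2 R _ F)//.
- by rewrite -EFinB /F expr1n expr0n mulr0 subr0 mulr1.
- by apply: continuous_subspaceT => r; exact: exprn_continuous.
- split.
  + by move=> r _; case: (dF r).
  + by apply: cvg_at_right_filter; exact: cF.
  + by apply: cvg_at_left_filter; exact: cF.
- by move=> r _; rewrite derive1E; case: (dF r).
Qed.

(** Integration against |y|^{-N} dy, which dilations leave invariant; [D] is integration against dr
    / r, the Haar measure of the positive reals. *)
Let I h := (\int[mu]_y (h (enorm y) * (enorm y ^+ N)^-1)%:E)%E.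
Let D h := (\int[leb]_r ((0 < r)%R%:R * h r * r^-1)%:E)%E.

Let I_scale h (c : R) : 0 < c -> measurable_fun [set: R] h -> (forall r, 0 <= h r) ->
  (\int[mu]_y (h (c * enorm y) * (enorm y ^+ N)^-1)%:E)%E = I h.
Proof.
move=> c0 mh h0; have me := @measurable_enorm R N.
apply/esym; rewrite /I (ge0_integral_rV_scale c0); last 2 first.
- by apply/measurable_EFinP; mfun.
- by move=> y; rewrite lee_fin mulr_ge0// invr_ge0 exprn_ge0// enorm_ge0.
rewrite -ge0_integralZl_real ?exprn_ge0 ?(ltW c0)//; last 2 first.
- by mfun.
- by move=> y; rewrite mulr_ge0// invr_ge0 exprn_ge0// enorm_ge0.
apply: eq_integral => y _; congr EFin.
rewrite enormZ gtr0_norm// exprMn invfM mulrCA; congr (_ * _).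
by rewrite mulrA mulfV ?mul1r// gt_eqF// exprn_gt0.
Qed.

(** Both sides integrate h(r) g(|y| / r) against the product of dr / r and |y|^{-N} dy. Dilating y
    by r separates the factors in one order; replacing r by r |y| separates them in the other. *)
Let D_I h g : measurable_fun [set: R] h -> (forall r, 0 <= h r) -> h 0 = 0 ->
  measurable_fun [set: R] g -> (forall r, 0 <= g r) -> g 0 = 0 ->
  (D h * I g = D (fun r => g r^-1%R) * I h)%E.
Proof.
move=> mh h0 h00 mg g0 g00; have me := @measurable_enorm R N.
have pN (y : 'rV[R]_N) : 0 <= (enorm y ^+ N)^-1 by rewrite invr_ge0 exprn_ge0// enorm_ge0.
have pr (r : R) : 0 <= (0 < r)%R%:R * r^-1.
  by have [r0|] := ltP 0 r; rewrite ?mul0r// mul1r invr_ge0 ltW.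
have m1 : measurable_fun [set: measurableTypeR R * 'rV[R]_N]
    (fun z => (0 < z.1)%R%:R * z.1^-1 * h z.1 * (g (enorm z.2 / z.1) * (enorm z.2 ^+ N)^-1)).
  by mfun.
have m2 : measurable_fun [set: measurableTypeR R * 'rV[R]_N]
    (fun z => (0 < z.1)%R%:R * z.1^-1 * g z.1^-1 * (h (z.1 * enorm z.2) * (enorm z.2 ^+ N)^-1)).
  by mfun.
have mI0 (f : R -> R) : measurable_fun [set: R] f -> (forall r, 0 <= f r) -> (0 <= I f)%E.
  by move=> mf f0; apply: ge0_integral_real => y; rewrite mulr_ge0.
transitivity (\int[leb]_r \int[mu]_y ((0 < r)%R%:R * r^-1 * h r *
    (g (enorm y / r) * (enorm y ^+ N)^-1))%R%:E)%E.
  rewrite /D -ge0_integralZr//; last 3 first.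
  - by apply/measurable_EFinP; mfun.
  - by move=> r _; rewrite lee_fin mulrAC mulr_ge0.
  - exact: mI0.
  apply: eq_integral => r _; rewrite (ge0_integralZl_real _ (mulr_ge0 (pr r) (h0 r))); last 2 first.
  - by mfun.
  - by move=> y; rewrite mulr_ge0.
  rewrite [(0 < r)%R%:R * _ * _]mulrAC.
  have [r0|r0] := ltP 0 r; last by rewrite !mul0r !mul0e.
  congr (_ * _)%E; rewrite -(@I_scale g r^-1) ?invr_gt0//.
  by apply: eq_integral => y _; rewrite [_^-1 * enorm y]mulrC.
rewrite (@tonelli_real _ _ _ _ _ leb mu (fun r y => (0 < r)%R%:R * r^-1 * h r *
    (g (enorm y / r) * (enorm y ^+ N)^-1)) m1); last first.
  by nneg.
transitivity (\int[mu]_y \int[leb]_r ((0 < r)%R%:R * r^-1 * g r^-1 *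
   (h (r * enorm y) * (enorm y ^+ N)^-1))%R%:E)%E.
  apply: eq_integral => y _.
  have [y0|y0] := eqVneq y 0.
    rewrite y0 enorm0; apply: eq_integral => r _.
    by rewrite mulr0 h00 mul0r g00 !mul0r !mulr0.
  have ny : 0 < enorm y by rewrite enorm_gt0.
  rewrite [LHS](@ge0_integral_affine R _ 0 (enorm y) ny); last 2 first.
  - by apply/measurable_EFinP; mfun.
  - by nneg.
  rewrite -ge0_integralZl_real ?(ltW ny)//; last 2 first.
  - by mfun.
  - by nneg.
  apply: eq_integral => r _; congr EFin; rewrite add0r pmulr_rgt0//.
  have [r0|r0] := ltP 0 r; last by rewrite !(mul0r, mulr0).
  rewrite [enorm y / (enorm y * r)](_ : _ = r^-1); last first.
    by rewrite invfM mulrA mulfV ?mul1r// gt_eqF.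
  rewrite [r * enorm y]mulrC; field; rewrite ?gt_eqF ?exprn_gt0//.
rewrite -(@tonelli_real _ _ _ _ _ leb mu (fun r y => (0 < r)%R%:R * r^-1 * g r^-1 *
   (h (r * enorm y) * (enorm y ^+ N)^-1)) m2); last first.
  by nneg.
rewrite /D -ge0_integralZr//; last 3 first.
- by apply/measurable_EFinP; mfun.
- by move=> r _; rewrite lee_fin mulrAC mulr_ge0.
- exact: mI0.
apply: eq_integral => r _; rewrite (ge0_integralZl_real _ (mulr_ge0 (pr r) (g0 r^-1))); last 2 first.
- by mfun.
- by move=> y; rewrite mulr_ge0.
rewrite [(0 < r)%R%:R * _ * _]mulrAC.
have [r0|r0] := ltP 0 r; last by rewrite !mul0r !mul0e.
by rewrite I_scale.
Qed.

(* Uniqueness of Haar measure on the positive reals, with [D h] and [I h] both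
   dilation invariant; the constant is found by testing on the unit ball. *)
Lemma ge0_integral_radial h : measurable_fun [set: R] h -> (forall r, 0 <= h r) -> h 0 = 0 ->
  (\int[mu]_y (h (enorm y))%:E =
   (N%:R * beta)%:E * \int[leb]_r ((0 < r)%R%:R * h r * r ^+ n)%:E)%E.
Proof.
move=> mh h0 h00.
have I01 : I (fun r => (0 < r)%R%:R * (r <= 1)%R%:R * r ^+ N) = beta%:E.
  rewrite /I -integral_punctured_ball; apply: eq_integral => y _; congr EFin.
  have [y0|y0] := ltP 0 (enorm y); last by rewrite !mul0r.
  by rewrite mulfK// gt_eqF// exprn_gt0.
have D01 : D (fun r => (0 < r)%R%:R * (r <= 1)%R%:R * r ^+ N) = (N%:R^-1)%:E.
  rewrite /D -integral_lebesgue_pow01; apply: eq_integral => r _; congr EFin.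
  have [r0|r0] := ltP 0 r; last by rewrite !mul0r.
  by rewrite !mul1r exprS; field; rewrite gt_eqF.
have b0 := @rV_unit_ball_vol_gt0 R N.
pose g r : R := (0 < r)%R%:R * (r <= 1)%R%:R * r ^+ N.
have mg : measurable_fun [set: R] g by rewrite /g; mfun.
have g0 r : 0 <= g r.
  by rewrite /g; case: ltP => r0; rewrite ?mul0r// mul1r mulr_ge0// exprn_ge0// ltW.
have g00 : g 0 = 0 by rewrite /g ltxx !mul0r.
(* This is [D_I] with h = g: the common factor [I g], equal to the volume of the unit ball,
   cancels. *)
have c0 : (D (fun r => g r^-1%R) = (N%:R^-1)%:E)%E.
  have := D_I mg g0 g00 mg g0 g00; rewrite I01 D01.
  move=> /(congr1 (fun z => z * (beta^-1)%:E)%E).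
  by rewrite -!muleA -!EFinM divff ?gt_eqF// !mule1 mulr1 => <-.
(* The extra power turns [I hN] into the plain integral of the radial function and [D hN] into the
   integral against r^n dr, where N = n + 1. *)
pose hN r := h r * r `^ N%:R.
have mhN : measurable_fun [set: R] hN by rewrite /hN; mfun.
have hN0 r : 0 <= hN r by rewrite mulr_ge0// powR_ge0.
have hN00 : hN 0 = 0 by rewrite /hN h00 mul0r.
have := D_I mhN hN0 hN00 mg g0 g00; rewrite I01 c0.
move=> /(congr1 (fun z => N%:R%:E * z)%E).
rewrite [RHS]muleA -EFinM mulfV// mul1e /I /D.
under [in RHS]eq_integral => y _.
  have -> : (hN (enorm y) * (enorm y ^+ N)^-1) = h (enorm y).
    rewrite /hN powR_mulrn ?enorm_ge0//.
    have [->|y0] := eqVneq y 0; first by rewrite enorm0 h00 !mul0r.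
    by rewrite mulfK// expf_neq0// enorm_eq0.
  over.
move=> <-; rewrite [RHS]muleC muleA EFinM muleAC [RHS]muleC; congr (_ * _)%E.
apply: eq_integral => r _; congr EFin; rewrite /hN.
have [r0|r0] := ltP 0 r; last by rewrite !mul0r.
by rewrite powR_mulrn ?(ltW r0)// exprS; field; rewrite gt_eqF.
Qed.
End radial.

(** * The substitution from cotangents to cosines *)

Section projective_substitution.
Context {R : realType}.
Local Notation leb := (@lebesgue_measure R).
Implicit Types (t x : R).

(** For t = cot phi with 0 < phi < pi, [c t] is sin phi, and [Fp t] below is cos phi. *)
Let c t : R := (1 + t ^+ 2) `^ (- 2^-1).

Let q_gt0 t : 0 < 1 + t ^+ 2.
Proof. by rewrite ltr_pwDl// sqr_ge0. Qed.

Let c_gt0 t : 0 < c t.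
Proof. exact: powR_gt0. Qed.

Let sqr_c t : c t ^+ 2 = (1 + t ^+ 2)^-1.
Proof.
rewrite -powR_mulrn ?powR_ge0// /c -powRrM mulNr mulVf// powR_inv1//.
exact: ltW.
Qed.

Let Fp t : R := t * c t.

Let sqr_Fp t : 1 - Fp t ^+ 2 = c t ^+ 2.
Proof. by rewrite exprMn sqr_c; field; rewrite gt_eqF. Qed.

Let dFp t : is_derive t 1 Fp (c t ^+ 3).
Proof.
have dq : is_derive t 1 (fun x : R => 1 + x ^+ 2) (2 * t).
  have h := is_deriveD (is_derive_cst (1 : R) t 1) (is_deriveX 2 (is_derive_id t 1)).
  suff -> : 2 * t = 0 + 2 * t ^+ 1 * 1 by exact: h.
  by rewrite add0r mulr1.
have dc : is_derive t 1 c (- (t * c t ^+ 3)).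
  have h := @is_derive1_comp R (fun x => x `^ (- 2^-1)) (fun x => 1 + x ^+ 2) t _ _
    (is_derive1_powR (- 2^-1) (q_gt0 t)) dq.
  suff -> : - (t * c t ^+ 3) = - 2^-1 * (1 + t ^+ 2) `^ (- 2^-1 - 1) * (2 * t) by exact: h.
  rewrite powRB; last by rewrite (gt_eqF (q_gt0 t)) implybT.
  rewrite powRr1 ?(ltW (q_gt0 t))// -/(c t) exprS sqr_c; field; by rewrite gt_eqF.
have h := is_deriveM (is_derive_id t 1) dc.
suff -> : c t ^+ 3 = t * - (t * c t ^+ 3) + c t * 1 by exact: h.
have : c t ^+ 2 * (1 + t ^+ 2) = 1 by rewrite sqr_c mulVf// gt_eqF.
move=> h2.
transitivity (c t * (1 - t ^+ 2 * c t ^+ 2)); last ring.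
rewrite exprS; congr (_ * _); rewrite -h2; ring.
Qed.

Let cFp : continuous Fp.
Proof. by move=> t; apply: differentiable_continuous; apply/derivable1_diffP; case: (dFp t). Qed.

Let cc : continuous c.
Proof.
move=> t; apply: (@continuous_comp _ _ _ (fun x : R => 1 + x ^+ 2) (fun x => x `^ (- 2^-1))).
  by apply: cvgD; [exact: cvg_cst|exact: exprn_continuous].
apply: differentiable_continuous; apply/derivable1_diffP.
by case: (is_derive1_powR (- 2^-1) (q_gt0 t)).
Qed.

Let derFp : Fp^`()%classic = (fun t => c t ^+ 3).
Proof. by apply/funext => t; rewrite derive1E; case: (dFp t). Qed.

Let cc3 : continuous (fun t => c t ^+ 3).
Proof. by move=> t; apply: (@continuous_comp _ _ _ c (fun x => x ^+ 3)); [exact: cc|exact: exprn_continuous]. Qed.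

Let Fp_lt1 t : -1 < Fp t < 1.
Proof.
rewrite -ltr_norml -(ltr_sqr (normr_ge0 _))// ?nnegrE//.
by rewrite real_normK ?num_real// expr1n -subr_gt0 sqr_Fp exprn_gt0.
Qed.

Let Fp_mono : {homo Fp : x y / x < y}.
Proof.
move=> x y xy; have [z] := @MVT R Fp (fun t => c t ^+ 3) x y xy (fun t _ => dFp t)
  (continuous_subspaceT cFp).
by move=> _ h; rewrite -subr_gt0 h mulr_gt0 ?exprn_gt0// subr_gt0.
Qed.

Let Fp_inv t : -1 < t < 1 -> Fp (t * (1 - t ^+ 2) `^ (- 2^-1)) = t.
Proof.
move=> t1; have h : 0 < 1 - t ^+ 2.
  by rewrite subr_gt0 -[ltRHS](expr1n _ 2) -(real_normK (num_real t)) ltr_sqr ?nnegrE// ltr_norml.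
have e2 : ((1 - t ^+ 2) `^ (- 2^-1)) ^+ 2 = (1 - t ^+ 2)^-1.
  by rewrite -powR_mulrn ?powR_ge0// -powRrM mulNr mulVf// powR_inv1// ltW.
rewrite /Fp /c exprMn e2.
have -> : 1 + t ^+ 2 * (1 - t ^+ 2)^-1 = (1 - t ^+ 2)^-1.
  by field; rewrite gt_eqF.
rewrite -mulrA -powRM ?(ltW h) ?invr_ge0 ?(ltW h)// mulfV ?gt_eqF// powR1 mulr1//.
Qed.

(** With x = [Fp t] one has 1 - x^2 = c(t)^2 and dx = c(t)^3 dt. The image reaches -1 and 1 only in
    the limit, so the substitution is made on the intervals [-k, k] and k tends to infinity. *)
Lemma ge0_integral_projective (a : R) (g : R -> R) :
  measurable_fun [set: R] g -> (forall t, 0 <= g t) ->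
  (forall t, -1 < t < 1 -> {for t, continuous g}) ->
  (\int[leb]_t ((1 + t ^+ 2) `^ (- 2^-1) `^ (2 * a + 3) *
      g (t * (1 + t ^+ 2) `^ (- 2^-1)))%R%:E =
   \int[leb]_(t in `](-1)%R, 1%R[) ((1 - t ^+ 2) `^ a * g t)%R%:E)%E.
Proof.
move=> mg g0 cg.
pose G t := (1 - t ^+ 2) `^ a * g t.
have mG : measurable_fun [set: R] G by rewrite /G; mfun.
have G0 t : 0 <= G t by rewrite /G; nneg.
have E t : c t `^ (2 * a + 3) * g (Fp t) = ((G \o Fp) * Fp^`()%classic) t.
  rewrite derFp fctE/= /G sqr_Fp mulrAC; congr (_ * _).
  rewrite powRD; last by rewrite (gt_eqF (c_gt0 t)) implybT.
  by rewrite powRrM !powR_mulrn ?(ltW (c_gt0 _)).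
have S k : (\int[leb]_(t in `[Fp (- k%:R)%R, Fp k%:R%R]) (G t)%:E =
    \int[leb]_(t in `[(- k%:R)%R, k%:R%R]) (c t `^ (2 * a + 3) * g (Fp t))%:E)%E.
  under [RHS]eq_integral do rewrite E.
  apply: integration_by_substitution_increasing.
  - by have : 0 <= k%:R :> R by []; lra.
  - by move=> x y _ _; exact: Fp_mono.
  - by move=> t _; rewrite derFp; exact: cc3.
  - by rewrite derFp; apply/cvg_ex; eexists; apply: cvg_at_right_filter; exact: cc3.
  - by rewrite derFp; apply/cvg_ex; eexists; apply: cvg_at_left_filter; exact: cc3.
  - split.
    + by move=> t _; case: (dFp t).
    + by apply: cvg_at_right_filter; exact: cFp.
    + by apply: cvg_at_left_filter; exact: cFp.
  - apply: continuous_in_subspaceT => t; rewrite inE/= in_itv/= => /andP[t1 t2].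
    have t01 : -1 < t < 1.
      have /andP[? _] := Fp_lt1 (- k%:R); have /andP[_ ?] := Fp_lt1 k%:R.
      by apply/andP; split; [exact: lt_le_trans t1|exact: le_lt_trans t2 _].
    have h : 0 < 1 - t ^+ 2.
      by rewrite subr_gt0 -[ltRHS](expr1n _ 2) -(real_normK (num_real t)) ltr_sqr ?nnegrE// ltr_norml.
    apply: cvgM; last exact: cg.
    apply: (@continuous_comp _ _ _ (fun x : R => 1 - x ^+ 2) (fun x => x `^ a)).
      by apply: cvgB; [exact: cvg_cst|exact: exprn_continuous].
    apply: differentiable_continuous; apply/derivable1_diffP.
    by case: (is_derive1_powR a h).
have mI b1 b2 (f : R -> R) : measurable_fun [set: R] f ->
    measurable_fun (`[b1, b2] : set R) (fun t => (f t)%:E).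
  by move=> mf; apply/measurable_EFinP; exact: measurable_funTS.
have mc : measurable_fun [set: R] (fun t => c t `^ (2 * a + 3) * g (Fp t)).
  by rewrite /Fp /c; mfun.
have cvL : (\int[leb]_(t in `[Fp (- k%:R)%R, Fp k%:R%R]) (G t)%:E @[k --> \oo] -->
    \int[leb]_(t in \bigcup_(k : nat) `[Fp (- k%:R)%R, Fp k%:R%R]%classic) (G t)%:E)%E.
  apply: ge0_nondecreasing_set_cvg_integral => //.
  - move=> i j ij; apply/subsetPset => t /=; rewrite !in_itv/= => /andP[h1 h2].
    have ij' : i%:R <= j%:R :> R by rewrite ler_nat.
    have := ltW_homo Fp_mono => Fm.
    by rewrite (le_trans _ h1) ?(le_trans h2)//; apply: Fm => //; rewrite lerN2.
  - by move=> i; exact: mI.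
  - by move=> i t _; rewrite lee_fin.
have cvR : (\int[leb]_(t in `[(- k%:R)%R, k%:R%R]) (c t `^ (2 * a + 3) * g (Fp t))%:E @[k --> \oo] -->
    \int[leb]_(t in \bigcup_(k : nat) `[(- k%:R)%R, k%:R%R]%classic) (c t `^ (2 * a + 3) * g (Fp t))%:E)%E.
  apply: ge0_nondecreasing_set_cvg_integral => //.
  - move=> i j ij; apply/subsetPset => t /=; rewrite !in_itv/= => /andP[h1 h2].
    have ij' : i%:R <= j%:R :> R by rewrite ler_nat.
    by apply/andP; split; lra.
  - by move=> i; exact: mI.
  - by move=> i t _; rewrite lee_fin mulr_ge0// powR_ge0.
move: cvL; under eq_fun do rewrite S; move=> cvL.
have eT : \bigcup_(k : nat) `[(- k%:R)%R, k%:R%R]%classic = [set: R].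
  apply/seteqP; split => // t _.
  exists (Num.truncn `|t|).+1 => //=; rewrite in_itv/= -ler_norml.
  by rewrite ltW// truncnS_gt.
have eI : \bigcup_(k : nat) `[Fp (- k%:R)%R, Fp k%:R%R]%classic = `](-1)%R, 1%R[%classic.
  apply/seteqP; split => t.
    move=> [k _]/=; rewrite !in_itv/= => /andP[t1 t2].
    have /andP[? _] := Fp_lt1 (- k%:R); have /andP[_ ?] := Fp_lt1 k%:R.
    by apply/andP; split; [exact: lt_le_trans t1|exact: le_lt_trans t2 _].
  rewrite /= in_itv/= => t1.
  pose x := t * (1 - t ^+ 2) `^ (- 2^-1).
  exists (Num.truncn `|x|).+1 => //=; rewrite in_itv/= -(Fp_inv t1) -/x.
  have Fm := ltW_homo Fp_mono.
  have : `|x| <= (Num.truncn `|x|).+1%:R by rewrite ltW// truncnS_gt.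
  by rewrite ler_norml => /andP[? ?]; apply/andP; split; apply: Fm.
rewrite eT in cvR; rewrite eI in cvL; exact: (cvg_unique _ cvR cvL).
Qed.
End projective_substitution.

(** * The Hardy constant as an integral over R^N *)

Section hardy_const_rV.
Context {R : realType}.
Local Notation leb := (@lebesgue_measure R).

Lemma sqr_enorm_sub_delta n a (v : 'rV[R]_n) :
  enorm ((delta_mx 0 0 : 'rV[R]_n.+1) - rV_cons (a, v)) = Num.sqrt (1 - 2 * a + (a ^+ 2 + enorm v ^+ 2)).
Proof.
rewrite enormE; congr Num.sqrt.
rewrite !dotrDl !dotrNl ![dotr _ (delta_mx 0 0 - _)]dotrC !dotrDl !dotrNl.
rewrite -[dotr (rV_cons _) (rV_cons _)]sqr_enorm enorm_rV_cons.
rewrite [dotr (rV_cons _) _]dotrC !dotr_delta rV_cons0 mxE !eqxx/=; ring.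
Qed.

Lemma enorm_rV_consE n a (v : 'rV[R]_n) : enorm (rV_cons (a, v)) = Num.sqrt (a ^+ 2 + enorm v ^+ 2).
Proof. by rewrite -enorm_rV_cons sqrtr_sqr ger0_norm// enorm_ge0. Qed.

Lemma powR_sqrt (x q : R) : 0 <= x -> Num.sqrt x `^ q = x `^ (q / 2).
Proof. by move=> x0; rewrite -powR12_sqrt// -powRrM mulrC. Qed.

Variables (s p : R).

(** Folding the negative half-line onto the positive one produces the two summands of [Phi] in
    dimension 1. *)
Lemma integral_radial_kernel_1 (F : R -> R) : measurable_fun [set: R] F ->
  (forall r, 0 <= F r) -> F 0 = 0 -> (forall r, 1 <= r -> F r = 0) ->
  (\int[lebesgueN 1]_y (F (enorm y) *
     (enorm ((delta_mx 0 0 : 'rV[R]_1) - y) `^ (1%:R + s * p))^-1)%:E =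
   \int[leb]_(r in `]0%R, 1%R[) ((F r)%:E * @Phi R 1 s p r))%E.
Proof.
move=> mF F0 F00 F1.
have mf : measurable_fun [set: 'rV[R]_1] (fun y => F (enorm y) *
     (enorm ((delta_mx 0 0 : 'rV[R]_1) - y) `^ (1%:R + s * p))^-1) by mfun.
rewrite ge0_integral_lebesgueNS; last 2 first.
- exact/measurable_EFinP.
- by move=> y; rewrite lee_fin mulr_ge0// invr_ge0 powR_ge0.
pose G a := F `|a| * (`|1 - a| `^ (1 + s * p))^-1.
have mG : measurable_fun [set: R] G by rewrite /G; mfun.
have G0 a : 0 <= G a by rewrite /G mulr_ge0// invr_ge0 powR_ge0.
transitivity (\int[leb]_a (G a)%:E)%E.
  apply: eq_integral => a _ /=; rewrite integral_dirac//=; last first.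
    apply/measurable_EFinP; apply: (measurableT_comp mf).
    apply: (measurableT_comp (@measurable_rV_cons R 0)); exact: measurable_fun_pair.
  rewrite diracT mul1e enorm_rV_consE sqr_enorm_sub_delta !enorm0 expr0n/= !addr0.
  by rewrite sqrtr_sqr (_ : 1 - 2 * a + a ^+ 2 = (1 - a) ^+ 2) ?sqrtr_sqr//; ring.
have -> : (\int[leb]_a (G a)%:E = \int[leb]_a ((0 < a)%R%:R * G a + (a < 0)%R%:R * G a)%:E)%E.
  apply: eq_integral => a _; congr EFin.
  case: ltgtP => a0; rewrite ?(mul0r, mul1r, addr0, add0r)//.
  by rewrite /G -a0 normr0 F00 mul0r.
rewrite ge0_integralD_real; last 4 first.
- by mfun.
- by mfun.
- by move=> a; rewrite mulr_ge0.
- by move=> a; rewrite mulr_ge0.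
rewrite [X in (_ + X)%E](ge0_integral_opp); last 2 first.
- by apply/measurable_EFinP; mfun.
- by move=> a; rewrite lee_fin mulr_ge0.
rewrite -ge0_integralD_real; last 4 first.
- by mfun.
- have mN : measurable_fun [set: R] (fun x : R => - x) by exact: measurableT_comp.
  by mfun.
- by move=> a; rewrite mulr_ge0.
- by move=> a; rewrite mulr_ge0.
rewrite [RHS]integral_mkcond; apply: eq_integral => r _.
rewrite patchE mem_setE in_itv/= oppr_lt0.
have [r0|r0] := ltP 0 r; last by rewrite !mul0r addr0.
have [r1|r1] := ltP r 1; last first.
  by rewrite /G normrN (gtr0_norm r0) F1// !mul0r !mulr0 addr0.
rewrite /Phi/= -EFinM; congr EFin.
rewrite /G normrN (gtr0_norm r0) opprK [`|1 - r|]gtr0_norm ?subr_gt0//.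
rewrite [`|1 + r|]gtr0_norm ?addr_gt0//; ring.
Qed.

(** Write y = (a, v). Polar coordinates in v with rho = |v|, then a = rho t and rho = r c(t), make r
    the norm of y and t the cotangent of its angle with e. The projective substitution turns the
    t-integral into that of [Phi]. *)
Lemma integral_radial_kernel_2 n (F : R -> R) : measurable_fun [set: R] F ->
  (forall r, 0 <= F r) -> F 0 = 0 -> (forall r, 1 <= r -> F r = 0) ->
  (\int[lebesgueN n.+2]_y (F (enorm y) *
     (enorm ((delta_mx 0 0 : 'rV[R]_n.+2) - y) `^ (n.+2%:R + s * p))^-1)%:E =
   \int[leb]_(r in `]0%R, 1%R[) ((F r * r ^+ n.+1)%:E * @Phi R n.+2 s p r))%E.
Proof.
move=> mF F0 F00 F1.
set q := (n.+2%:R + s * p) / 2.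
have me := @measurable_enorm R n.+1.
have mf : measurable_fun [set: 'rV[R]_n.+2] (fun y => F (enorm y) *
     (enorm ((delta_mx 0 0 : 'rV[R]_n.+2) - y) `^ (n.+2%:R + s * p))^-1) by mfun.
rewrite ge0_integral_lebesgueNS; last 2 first.
- exact/measurable_EFinP.
- by move=> y; rewrite lee_fin mulr_ge0// invr_ge0 powR_ge0.
pose G (a rho : R) := F (Num.sqrt (a ^+ 2 + rho ^+ 2)) * ((1 - 2 * a + (a ^+ 2 + rho ^+ 2)) `^ q)^-1.
have G0 a rho : 0 <= G a rho by rewrite mulr_ge0// invr_ge0 powR_ge0.
have msq d (T : measurableType d) (f : T -> R) : measurable_fun [set: T] f ->
    measurable_fun [set: T] (fun x => Num.sqrt (f x)).
  move=> h; apply: (measurableT_comp _ h).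
  by apply: continuous_measurable_fun; exact: sqrt_continuous.
have mG d (T : measurableType d) (f g : T -> R) : measurable_fun [set: T] f ->
    measurable_fun [set: T] g -> measurable_fun [set: T] (fun x => G (f x) (g x)).
  move=> hf hg; rewrite /G; apply: measurable_funM; last by mfun.
  by apply: (measurableT_comp mF); apply: msq; mfun.
transitivity (\int[leb]_a \int[lebesgueN n.+1]_v (G a (enorm v))%:E)%E.
  apply: eq_integral => a _; apply: eq_integral => v _; congr EFin.
  rewrite /G enorm_rV_consE sqr_enorm_sub_delta powR_sqrt//.
  rewrite (_ : 1 - 2 * a + (a ^+ 2 + enorm v ^+ 2) = (1 - a) ^+ 2 + enorm v ^+ 2); last ring.
  by rewrite addr_ge0// sqr_ge0.
rewrite (@tonelli_real _ _ _ _ _ leb (lebesgueN n.+1) (fun a v => G a (enorm v))); last 2 first.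
- by apply: mG; mfun.
- by [].
pose H (t rho : R) := rho * G (rho * t) rho.
have mH d (T : measurableType d) (f g : T -> R) : measurable_fun [set: T] f ->
    measurable_fun [set: T] g -> measurable_fun [set: T] (fun x => H (f x) (g x)).
  by move=> hf hg; rewrite /H; apply: measurable_funM => //; apply: mG => //; mfun.
have Hv0 t (v : 'rV[R]_n.+1) : 0 <= H t (enorm v) by rewrite mulr_ge0// enorm_ge0.
(* The substitution a = |v| t requires v != 0, so the inner integrals are compared off a null
   set. *)
transitivity (\int[lebesgueN n.+1]_v \int[leb]_t (H t (enorm v))%:E)%E.
  apply: ge0_ae_eq_integral => //.
  - apply: (@measurable_integral_real _ _ _ _ _ leb (fun (v : 'rV[R]_n.+1) a => G a (enorm v))) => //.
    by apply: mG; mfun.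
  - apply: (@measurable_integral_real _ _ _ _ _ leb (fun (v : 'rV[R]_n.+1) a => H a (enorm v))) => //.
    by apply: mH; mfun.
  - by move=> v _; apply: ge0_integral_real.
  - by move=> v _; apply: ge0_integral_real.
  exists [set 0]; split.
  - rewrite (_ : [set 0] = rV_ball 0); first exact: measurable_rV_ball.
    apply/seteqP; split => [x ->|x]; rewrite /rV_ball/= ?enorm0//.
    by rewrite le_eqVlt ltNge enorm_ge0 orbF enorm_eq0 => /eqP.
  - exact: lebesgueN_set0.
  - move=> v /=; apply: contra_notP => /eqP v0 _.
    have nv : 0 < enorm v by rewrite enorm_gt0.
    rewrite (@ge0_integral_affine R _ 0 (enorm v) nv); last 2 first.
    + by apply/measurable_EFinP; apply: mG; mfun.
    + by move=> t; rewrite lee_fin.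
    have mGv : measurable_fun [set: R] (fun t => G (0 + enorm v * t) (enorm v)).
      apply: mG; last exact: measurable_cst.
      by apply: measurable_funD => //; apply: measurable_funM.
    have G0v t : 0 <= G (0 + enorm v * t) (enorm v) by exact: G0.
    rewrite -(@ge0_integralZl_real _ _ _ leb (enorm v) _ (ltW nv) mGv G0v).
    by apply: eq_integral => t _; rewrite add0r.
rewrite (@tonelli_real _ _ _ _ _ (lebesgueN n.+1) leb (fun v t => H t (enorm v))); last 2 first.
- by apply: mH; mfun.
- by [].
pose A : R := n.+1%:R * @rV_unit_ball_vol R n.+1.
have A0 : 0 <= A by rewrite mulr_ge0// ltW// rV_unit_ball_vol_gt0.
pose c (t : R) := (1 + t ^+ 2) `^ (- 2^-1).
have q0 (t : R) : 0 < 1 + t ^+ 2 by rewrite ltr_pwDl// sqr_ge0.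
have c0 t : 0 < c t by exact: powR_gt0.
have c2 t : c t ^+ 2 = (1 + t ^+ 2)^-1.
  by rewrite -powR_mulrn ?powR_ge0// /c -powRrM mulNr mulVf// powR_inv1// ltW.
have mc : measurable_fun [set: R] c by rewrite /c; mfun.
pose K (r t : R) := c t ^+ n.+2 * ((1 - 2 * r * (t * c t) + r ^+ 2) `^ q)^-1.
have K0 r t : 0 <= K r t by rewrite mulr_ge0 ?exprn_ge0 ?(ltW (c0 t))// invr_ge0 powR_ge0.
have mK d (T : measurableType d) (f g : T -> R) : measurable_fun [set: T] f ->
    measurable_fun [set: T] g -> measurable_fun [set: T] (fun x => K (f x) (g x)).
  by move=> hf hg; rewrite /K; have mcg := measurableT_comp mc hg; mfun.
have pw (r : R) k : 0 <= (0 < r)%R%:R * r ^+ k.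
  by case: ltP => r0; rewrite ?mul0r// mul1r exprn_ge0// ltW.
transitivity (\int[leb]_t \int[leb]_r (A * ((0 < r)%R%:R * r ^+ n.+1 * F r * K r t))%:E)%E.
  apply: eq_integral => t _.
  transitivity (\int[lebesgueN n.+1]_v ((0 < enorm v)%R%:R * H t (enorm v))%:E)%E.
    apply: eq_integral => v _; congr EFin; case: ltP => h; rewrite ?mul1r//.
    have ev : enorm v = 0 by apply/eqP; rewrite eq_le h enorm_ge0.
    by rewrite ev /H !mul0r.
  rewrite (@ge0_integral_radial R n (fun rho => (0 < rho)%R%:R * H t rho)); last 3 first.
  - by apply: measurable_funM; [mfun|apply: mH; mfun].
  - by move=> r; case: ltP => r0; rewrite ?mul0r// mul1r mulr_ge0// ltW.
  - by rewrite ltxx mul0r.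
  (* With rho = c(t) r one has a^2 + rho^2 = rho^2 (1 + t^2) = r^2, so [F] sees r alone. *)
  rewrite (@ge0_integral_affine R _ 0 (c t) (c0 t)); last 2 first.
  - apply/measurable_EFinP; apply: measurable_funM; last by mfun.
    by apply: measurable_funM; [mfun|apply: measurable_funM; [mfun|apply: mH; mfun]].
  - move=> r; rewrite lee_fin; case: ltP => r0; rewrite ?mul0r// !mul1r mulr_ge0 ?exprn_ge0 ?(ltW r0)//.
    by rewrite mulr_ge0// ltW.
  rewrite -ge0_integralZl_real ?(ltW (c0 t))//; last 2 first.
  - by apply: measurable_funM; [apply: measurable_funM; [mfun|apply: measurable_funM; [mfun|apply: mH; mfun]]|mfun].
  - move=> r; case: ltP => r0; rewrite ?mul0r// !mul1r mulr_ge0 ?exprn_ge0 ?(ltW r0)//.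
    by rewrite mulr_ge0// ltW.
  rewrite -/A -ge0_integralZl_real//; last 2 first.
  - apply: measurable_funM; first mfun.
    by apply: measurable_funM; [apply: measurable_funM; [mfun|apply: measurable_funM; [mfun|apply: mH; mfun]]|mfun].
  - move=> r; rewrite mulr_ge0 ?(ltW (c0 t))//; case: ltP => r0; rewrite ?mul0r// !mul1r mulr_ge0 ?exprn_ge0 ?(ltW r0)//.
    by rewrite mulr_ge0// ltW.
  apply: eq_integral => r _; congr (_ * _)%:E; rewrite add0r pmulr_rgt0//.
  case: ltP => r0; rewrite ?(mul0r, mulr0)// !mul1r.
  rewrite /H /G /K.
  have -> : (c t * r * t) ^+ 2 + (c t * r) ^+ 2 = r ^+ 2.
    rewrite (_ : _ + _ = r ^+ 2 * (c t ^+ 2 * (1 + t ^+ 2))); last ring.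
    by rewrite c2 mulVf ?mulr1// gt_eqF.
  rewrite sqrtr_sqr gtr0_norm//.
  rewrite (_ : 1 - 2 * (c t * r * t) + r ^+ 2 = 1 - 2 * r * (t * c t) + r ^+ 2); last ring.
  rewrite exprMn !exprS; ring.
rewrite (@tonelli_real _ _ _ _ _ leb leb (fun t r => A * ((0 < r)%R%:R * r ^+ n.+1 * F r * K r t))); last 2 first.
- by apply: measurable_funM; [mfun|apply: measurable_funM; [mfun|apply: mK; mfun]].
- by move=> t r; rewrite mulr_ge0// mulr_ge0// mulr_ge0.
rewrite [RHS]integral_mkcond; apply: eq_integral => r _.
rewrite patchE mem_setE in_itv/=.
have [r0|r0] := ltP 0 r; last first.
  by under eq_integral do rewrite !mul0r mulr0; rewrite integral0.
have [r1|r1] := ltP r 1; last first.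
  by under eq_integral do rewrite F1// mulr0 mul0r mulr0; rewrite integral0.
rewrite /Phi/= /sphere_area -/(rV_ball 1) rV_unit_ball_volE -EFinM -/A.
under eq_integral do rewrite mul1r mulrA.
rewrite ge0_integralZl_real; last 3 first.
- by rewrite mulr_ge0// mulr_ge0// exprn_ge0// ltW.
- by apply: mK; mfun.
- by [].
pose g t := ((1 - 2 * r * t + r ^+ 2) `^ q)^-1.
have mg : measurable_fun [set: R] g by rewrite /g; mfun.
have g0 t : 0 <= g t by rewrite invr_ge0 powR_ge0.
have cg (t : R) : -1 < t < 1 -> {for t, continuous g}.
  move=> /andP[t1 t2].
  have h : 0 < 1 - 2 * r * t + r ^+ 2 by nra.
  apply: cvgV; first by rewrite gt_eqF// powR_gt0.
  apply: (@continuous_comp _ _ _ (fun t => 1 - 2 * r * t + r ^+ 2) (fun x => x `^ q)).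
    apply: cvgD; last exact: cvg_cst.
    by apply: cvgB; [exact: cvg_cst|apply: cvgM; [exact: cvg_cst|exact: cvg_id]].
  apply: differentiable_continuous; apply/derivable1_diffP.
  by case: (is_derive1_powR q h).
have := @ge0_integral_projective R ((n.+2%:R - 3) / 2) g mg g0 cg => <-.
rewrite [RHS]muleA -EFinM; congr (_ * _)%E; first by congr EFin; ring.
apply: eq_integral => t _; congr EFin; rewrite /K -/(c t); congr (_ * _).
by rewrite (_ : 2 * _ + 3 = n.+2%:R) ?powR_mulrn ?(ltW (c0 t))//; field.
Qed.

(** The power r^{sp - 1} is r^{sp - N} times the factor r^{N - 1} of polar coordinates, so the
    one-dimensional formula is the integral of a radial weight against the kernel with pole e. *)
Lemma hardy_const_integral n :
  @hardy_const R n.+1 s p = (2%:E * \int[lebesgueN n.+1]_y (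
    ((0 < enorm y)%R%:R * (enorm y < 1)%R%:R *
     (enorm y `^ (s * p - n.+1%:R) * `|1 - enorm y `^ ((n.+1%:R - s * p) / p)| `^ p)) *
     (enorm ((delta_mx 0 0 : 'rV[R]_n.+1) - y) `^ (n.+1%:R + s * p))^-1)%:E)%E.
Proof.
congr (_ * _)%E.
pose F (r : R) : R := (0 < r)%R%:R * (r < 1)%R%:R *
  (r `^ (s * p - n.+1%:R) * `|1 - r `^ ((n.+1%:R - s * p) / p)| `^ p).
have mF : measurable_fun [set: R] F by rewrite /F; mfun.
have F0 r : 0 <= F r by rewrite /F; nneg.
have F00 : F 0 = 0 by rewrite /F ltxx !mul0r.
have F1 r : 1 <= r -> F r = 0 by move=> r1; rewrite /F [r < 1]ltNge r1/= mulr0 mul0r.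
apply/esym; case: n @F mF F0 F00 F1 => [|n] F mF F0 F00 F1.
  rewrite (@integral_radial_kernel_1 F mF F0 F00 F1); apply: eq_integral => r.
  by rewrite inE/= in_itv/= => /andP[r0 r1]; rewrite /F r0 r1 !mul1r.
rewrite (@integral_radial_kernel_2 n F mF F0 F00 F1); apply: eq_integral => r.
rewrite inE/= in_itv/= => /andP[r0 r1]; rewrite /F r0 r1 !mul1r; congr (_%:E * _)%E.
rewrite mulrAC; congr (_ * _); rewrite -powR_mulrn ?(ltW r0)// -powRD.
  by congr (_ `^ _); rewrite -[n.+2%:R]natr1; ring.
by rewrite (gt_eqF r0) implybT.
Qed.
End hardy_const_rV.

(** * The Hardy inequality with remainder *)

Section jensen_gap.
Context {R : realType}.
Implicit Types (p t X Y tau : R).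

(** With Z = (X - t Y) / (1 - t), X is the mean (1 - t) Z + t Y; the gap is (1 - t)^{p - 1} times
    the defect (1 - t)|Z|^p + t|Y|^p - |X|^p of Jensen's inequality. *)
Definition jensen_gap p t X Y : R :=
  `|X - t * Y| `^ p - (1 - t) `^ (p - 1) * (`|X| `^ p - t * `|Y| `^ p).

Let half_powR p X : (`|X| `^ (p / 2)) ^+ 2 = `|X| `^ p.
Proof. by rewrite -powR_mulrn ?powR_ge0// -powRrM divfK. Qed.

(** Since p / 2 >= 1, convexity bounds D = |X|^{p/2} by the mean m of A = |Z|^{p/2} and B =
    |Y|^{p/2}. The defect is then m^2 - D^2 plus the variance (t / (1 - t)) (m - B)^2; the first
    term is at least (m - D)^2, and together they control (D - B)^2. *)
Lemma jensen_gap_ge p t X Y : 2 <= p -> 0 < t < 1 ->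
  (1 - t) `^ (p - 1) * (Num.min 1 (t / (1 - t)) / 2 *
     (`|X| `^ (p / 2) - `|Y| `^ (p / 2)) ^+ 2) <= jensen_gap p t X Y.
Proof.
move=> p2 /andP[t0 t1].
have t1' : 0 < 1 - t by lra.
pose Z := (X - t * Y) / (1 - t).
have XE : X = (1 - t) * Z + t * Y by rewrite /Z mulrC divfK ?gt_eqF// subrK.
rewrite /jensen_gap.
have -> : X - t * Y = (1 - t) * Z by rewrite {1}XE addrK.
rewrite normrM (gtr0_norm t1') powRM ?(ltW t1')//.
have -> : (1 - t) `^ p = (1 - t) `^ (p - 1) * (1 - t).
  by rewrite -{3}(powRr1 (ltW t1')) -powRD ?subrK// (gt_eqF t1') implybT.
rewrite -[_ * (1 - t) * _]mulrA -mulrBr ler_pM2l ?powR_gt0//.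
rewrite -!(half_powR p).
have D_le : `|X| `^ (p / 2) <= (1 - t) * `|Z| `^ (p / 2) + t * `|Y| `^ (p / 2).
  have q1 : 1 <= p / 2 by lra.
  have := @convex_powR R (p / 2) q1 (Itv01 (ltW t0) (ltW t1)) `|Y| `|Z|.
  rewrite !inE/= !in_itv/= !andbT !normr_ge0 => /(_ isT isT).
  rewrite convRE ?[X in _ <= X]convRE/= /unstable.onem => h.
  rewrite [leRHS]addrC; apply: le_trans h.
  apply: ge0_ler_powR; rewrite ?nnegrE//; first lra.
    by rewrite addr_ge0// mulr_ge0// ltW.
  rewrite {1}XE (le_trans (ler_normD _ _))// !normrM (gtr0_norm t1') (gtr0_norm t0).
  rewrite [leLHS]addrC; exact: lexx.
set A := `|Z| `^ _ in D_le *; set B := `|Y| `^ _ in D_le *; set D := `|X| `^ _ in D_le *.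
have A0 : 0 <= A by exact: powR_ge0.
have B0 : 0 <= B by exact: powR_ge0.
have D0 : 0 <= D by exact: powR_ge0.
set k := t / (1 - t).
have kE : k * (1 - t) = t by rewrite /k divfK// gt_eqF.
have c1 : Num.min 1 k <= 1 by rewrite ge_min lexx.
have ck : Num.min 1 k <= k by rewrite ge_min lexx orbT.
have c0 : 0 <= Num.min 1 k by rewrite le_min ler01 divr_ge0// ltW.
set c := Num.min 1 k in c1 ck c0 *.
set m := (1 - t) * A + t * B in D_le.
have E : (1 - t) * A ^+ 2 - (D ^+ 2 - t * B ^+ 2) = m ^+ 2 - D ^+ 2 + k * (m - B) ^+ 2.
  rewrite /m.
  have -> : (1 - t) * A + t * B - B = (1 - t) * (A - B) by ring.
  rewrite exprMn [X in _ + k * (X * _)]expr2 !mulrA kE; ring.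
rewrite E.
have h1 : c * (m - D) ^+ 2 <= m ^+ 2 - D ^+ 2.
  have : (m - D) ^+ 2 <= m ^+ 2 - D ^+ 2 by nra.
  by apply: le_trans; rewrite ler_piMl ?sqr_ge0.
have h2 : c * (m - B) ^+ 2 <= k * (m - B) ^+ 2 by rewrite ler_wpM2r ?sqr_ge0.
apply: le_trans (lerD h1 h2); rewrite -mulrDr -mulrA ler_wpM2l//.
(* D - B is the difference of m - B and m - D, so half its square is at most the sum of their
   squares. *)
have : 0 <= ((m - D) + (m - B)) ^+ 2 by exact: sqr_ge0.
nra.
Qed.

Lemma jensen_gap_ge0 p t X Y : 2 <= p -> 0 < t < 1 -> 0 <= jensen_gap p t X Y.
Proof.
move=> p2 t01; apply: le_trans (jensen_gap_ge X Y p2 t01).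
have /andP[t0 t1] := t01.
rewrite mulr_ge0 ?powR_ge0// mulr_ge0 ?sqr_ge0// divr_ge0//.
by rewrite le_min ler01 divr_ge0 ?subr_ge0// ltW.
Qed.

(** Unlike [jensen_gap_ge], this does not degenerate as t tends to 1. The first term of the gap is
    at least 2^{-p}|X|^p; the subtracted one is at most 8^{-(p - 1)}|X|^p, which is at most half of
    that because 3 (p - 1) >= p + 1. *)
Lemma jensen_gap_ge_near p t X Y : 2 <= p -> 7 / 8 <= t < 1 -> `|Y| <= `|X| / 2 ->
  2 `^ (- (p + 1)) * `|X| `^ p <= jensen_gap p t X Y.
Proof.
move=> p2 /andP[t78 t1] YX; rewrite /jensen_gap.
have p0 : 0 <= p by lra.
have h1 : 2 `^ (- p) * `|X| `^ p <= `|X - t * Y| `^ p.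
  apply: (@le_trans _ _ ((`|X| / 2) `^ p)).
    by rewrite powRM// mulrC -powR_inv1// -powRrM mulN1r.
  apply: ge0_ler_powR; rewrite ?nnegrE//.
  have t0 : 0 <= t by lra.
  have : `|t * Y| <= `|X| / 2 by rewrite normrM (ger0_norm t0) (le_trans _ YX)// ler_piMl// ltW.
  have := lerB_normD X (- (t * Y)); rewrite normrN; lra.
have h2 : (1 - t) `^ (p - 1) * (`|X| `^ p - t * `|Y| `^ p) <= 2 `^ (- (p + 1)) * `|X| `^ p.
  apply: ler_pM; rewrite ?powR_ge0//.
  - rewrite subr_ge0; apply: (@le_trans _ _ (`|Y| `^ p)).
      by rewrite ler_piMl ?powR_ge0// ltW.
    apply: ge0_ler_powR; rewrite ?nnegrE//; have := normr_ge0 X; lra.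
  - apply: (@le_trans _ _ ((8^-1) `^ (p - 1))).
      apply: ge0_ler_powR; rewrite ?nnegrE; lra.
    have -> : (8^-1 : R) = 2 `^ (- 3%:R).
      by rewrite powR_invn// -!exprVn; field.
    rewrite -powRrM; apply: ler_powR; lra.
  - by rewrite gerBl mulr_ge0 ?powR_ge0//; lra.
have : 2 `^ (- p) = 2 * 2 `^ (- (p + 1)) :> R.
  rewrite -{2}(@powRr1 _ 2)// -powRD; first by congr (_ `^ _); ring.
  by rewrite pnatr_eq0 implybT.
move=> e; rewrite e in h1; lra.
Qed.

Lemma powR_le_add_sqr_half p X Y tau : 0 < tau ->
  `|X| `^ p <= `|Y| `^ p + tau / 2 * (`|X| `^ (p / 2) - `|Y| `^ (p / 2)) ^+ 2 +
     tau^-1 * (`|X| `^ p + `|Y| `^ p).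
Proof.
move=> tau0; rewrite -!(half_powR p).
set D := `|X| `^ _; set B := `|Y| `^ _.
have D0 : 0 <= D by exact: powR_ge0.
have B0 : 0 <= B by exact: powR_ge0.
(* AM-GM: 2 (D - B)(D + B) <= tau (D - B)^2 + (D + B)^2 / tau *)
have h : 0 <= tau^-1 / 2 * (tau * (D - B) - (D + B)) ^+ 2.
  by rewrite mulr_ge0 ?sqr_ge0// divr_ge0// invr_ge0 ltW.
have e : tau^-1 / 2 * (tau * (D - B) - (D + B)) ^+ 2 =
  tau / 2 * (D - B) ^+ 2 - (D ^+ 2 - B ^+ 2) + tau^-1 * ((D + B) ^+ 2 / 2).
  by field; rewrite gt_eqF.
have h3 : tau^-1 * ((D + B) ^+ 2 / 2) <= tau^-1 * (D ^+ 2 + B ^+ 2).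
  rewrite ler_wpM2l ?invr_ge0 ?(ltW tau0)//.
  have := sqr_ge0 (D - B); nra.
lra.
Qed.
End jensen_gap.

Lemma le_integral2_real {R : realType} d1 d2 (T1 : measurableType d1)
    (T2 : measurableType d2) (m1 : {sigma_finite_measure set T1 -> \bar R})
    (m2 : {sigma_finite_measure set T2 -> \bar R}) (f g : T1 -> T2 -> R) :
  measurable_fun [set: T1 * T2] (fun z => f z.1 z.2) ->
  measurable_fun [set: T1 * T2] (fun z => g z.1 z.2) ->
  (forall x y, 0 <= f x y) -> (forall x y, f x y <= g x y) ->
  (\int[m1]_x \int[m2]_y (f x y)%:E <= \int[m1]_x \int[m2]_y (g x y)%:E)%E.
Proof.
move=> mf mg f0 fg.
have g0 x y : 0 <= g x y by exact: le_trans (fg x y).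
apply: ge0_le_integral => //.
- by move=> x _; exact: ge0_integral_real.
- exact: measurable_integral_real.
- exact: measurable_integral_real.
move=> x _; apply: ge0_le_integral_real => //.
- exact: measurable_section2 mf.
- exact: measurable_section2 mg.
Qed.

Section integral_powR.
Context {R : realType}.
Local Notation leb := (@lebesgue_measure R).

(** The integrand may blow up at 0, so the antiderivative is used on [1 / (k + 1), 1], where it
    gives the bound 1 / g for every k. *)
Lemma integral_powR01_lty (g : R) : 0 < g ->
  (\int[leb]_r ((0 < r)%R%:R * (r <= 1)%R%:R * r `^ (g - 1) : R)%:E < +oo)%E.
Proof.
move=> g0; pose f (r : R) := r `^ (g - 1).
have mf : measurable_fun [set: R] f by rewrite /f; mfun.
pose D k : set R := `[k.+1%:R^-1, 1]%classic.
have eD : \bigcup_k D k = `]0, 1]%classic.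
  apply/seteqP; split => r; rewrite /D /= in_itv/=.
    by move=> [k _]/=; rewrite in_itv/= => /andP[h ->]; rewrite (lt_le_trans _ h).
  move=> /andP[r0 r1]; exists (Num.truncn r^-1) => //=; rewrite in_itv/= r1 andbT.
  by rewrite -[leRHS]invrK lef_pV2 ?posrE ?invr_gt0// ltW// truncnS_gt.
have cv : (\int[leb]_(r in D k) (f r)%:E @[k --> \oo] --> \int[leb]_(r in \bigcup_k D k) (f r)%:E)%E.
  apply: ge0_nondecreasing_set_cvg_integral => //.
  - move=> i j ij; apply/subsetPset => t /=; rewrite /D/= !in_itv/= => /andP[h1 ->].
    by rewrite (le_trans _ h1)// lef_pV2 ?posrE// ler_nat.
  - by move=> i; exact: measurable_itv.
  - by move=> i; apply/measurable_EFinP; exact: measurable_funTS.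
  - by move=> i t _; rewrite lee_fin powR_ge0.
rewrite (_ : (\int[leb]_r _)%E = (\int[leb]_(r in \bigcup_k D k) (f r)%:E)%E); last first.
  rewrite eD [RHS]integral_mkcond; apply: eq_integral => r _; rewrite patchE mem_setE in_itv/=.
  by case: (0 < r); case: (r <= 1); rewrite ?(mul0r, mul1r).
apply: (@le_lt_trans _ _ (g^-1)%:E); last by rewrite ltry.
rewrite -(cvg_lim _ cv)//; apply: lime_le; first by apply/cvg_ex; eexists; exact: cv.
apply: nearW => k.
have k1 : k.+1%:R^-1 <= 1 :> R by rewrite invf_le1// ler1n.
(* At k = 0 the interval is a single point, outside the scope of the fundamental theorem of
   calculus. *)
have [k1e|k1n] := eqVneq (k.+1%:R^-1 : R) 1.
  by rewrite /D k1e set_itv1 integral_set1 lee_fin invr_ge0 ltW.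
pose F (r : R) := g^-1 * r `^ g.
have dF (r : R) : 0 < r -> is_derive r 1 F (r `^ (g - 1)).
  move=> r0; have h := is_deriveZ g^-1 (is_derive1_powR g r0).
  suff -> : r `^ (g - 1) = g^-1 * (g * r `^ (g - 1)) by exact: h.
  by rewrite mulKf// gt_eqF.
have cF (r : R) : 0 < r -> {for r, continuous F}.
  move=> r0; apply: differentiable_continuous; apply/derivable1_diffP; by case: (dF r r0).
have kp : 0 < k.+1%:R^-1 :> R by rewrite invr_gt0.
rewrite /D (@continuous_FTC2 R f F).
- rewrite -EFinB lee_fin /F powR1 mulr1 gerBl.
  by rewrite mulr_ge0 ?powR_ge0// invr_ge0 ltW.
- by rewrite lt_neqAle k1n.
- apply: continuous_in_subspaceT => r; rewrite inE/= in_itv/= => /andP[r1 _].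
  have r0 : 0 < r by exact: lt_le_trans r1.
  apply: differentiable_continuous; apply/derivable1_diffP.
  by case: (is_derive1_powR (g - 1) r0).
- split.
  + move=> r; rewrite in_itv/= => /andP[r1 _].
    by case: (dF r (lt_trans kp r1)).
  + by apply: cvg_at_right_filter; exact: cF.
  + by apply: cvg_at_left_filter; exact: cF.
- move=> r; rewrite in_itv/= => /andP[r1 _]; rewrite derive1E.
  by case: (dF r (lt_trans kp r1)).
Qed.

Variable n : nat.
Local Notation N := n.+1.
Local Notation mu := (@lebesgueN R N).

Lemma integral_enorm_powR_lty (b : R) : b < N%:R ->
  (\int[mu]_x ((0 < enorm x)%R%:R * (enorm x <= 1)%R%:R * enorm x `^ (- b) : R)%:E < +oo)%E.
Proof.
move=> bN.
pose h (r : R) : R := (0 < r)%R%:R * (r <= 1)%R%:R * r `^ (- b).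
have mh : measurable_fun [set: R] h by rewrite /h; mfun.
rewrite (@ge0_integral_radial R n h mh); last 2 first.
- by move=> r; rewrite /h; nneg.
- by rewrite /h ltxx !mul0r.
rewrite lte_mul_pinfty//.
  by rewrite lee_fin mulr_ge0// ltW// rV_unit_ball_vol_gt0.
have gN : 0 < N%:R - b by rewrite subr_gt0.
apply: le_lt_trans (integral_powR01_lty gN).
rewrite le_eqVlt; apply/orP; left; apply/eqP; apply: eq_integral => r _; congr EFin.
rewrite /h; have [r0|r0] := ltP 0 r; last by rewrite !mul0r.
rewrite !mul1r -!mulrA; congr (_ * _).
rewrite -powR_mulrn ?(ltW r0)// -powRD; last by rewrite (gt_eqF r0) implybT.
by congr (_ `^ _); rewrite -[N%:R]natr1; ring.
Qed.
End integral_powR.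

Lemma hardy_rem_algebra {F : fieldType} (D T U V a b t : F) : a != 0 ->
  D + T * (t * (b / a)) * V = a^-1 * (a * D - T * (U * a - t * (V * b))) + T * U.
Proof. by move=> a0; field. Qed.

Lemma hardy_split_algebra {F : comNzRingType} (i g k w a r v b : F) :
  i * g + a * w = i * r + b * v ->
  i * g * k + w * (a * k) = i * r * k + v * (b * k).
Proof. by move=> h; transitivity ((i * g + a * w) * k); [ring|rewrite h; ring]. Qed.

Lemma hardy_split_algebra0 {F : comNzRingType} (i j l m g w a c r v b : F) :
  i * j = 0 -> l = 0 -> m = 0 ->
  i * j * g + l * a * c * w = i * j * r + m * b * v :> F.
Proof. by move=> -> -> ->; ring. Qed.

Lemma ereal_cancel_algebra {R : realType} (a h d x r : \bar R) :
  (0 <= a -> a < +oo -> 0 <= h -> h < +oo -> 0 <= d ->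
   x + a * h = r + (a + d) * h -> x = r + d * h)%E.
Proof.
move=> a0 aoo h0 hoo d0.
have af : a \is a fin_num by rewrite ge0_fin_numE.
have hf : h \is a fin_num by rewrite ge0_fin_numE.
have ahf : (a * h)%E \is a fin_num by exact: fin_numM.
rewrite ge0_muleDl// [(a * h + d * h)%E]addeC addeA => /(congr1 (fun z => z - a * h)%E).
by rewrite !addeK.
Qed.

Lemma hardy_split_algebra1 {F : comNzRingType} (i : bool) (g w a r v b : F) :
  (i -> g + a * w = r + b * v) -> i%:R * g + i%:R * a * w = i%:R * r + i%:R * b * v.
Proof. by case: i => [h|_]; [rewrite !mul1r h|rewrite !mul0r]. Qed.

Definition cone_ind {R : realType} n (th : R) (x y : 'rV[R]_n) : R :=
  (0 < enorm x)%R%:R * (enorm x < th * enorm y)%R%:R.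

(** * The remainder on narrowed cones *)

Section riesz_kernel.
Context {R : realType} (n : nat) (s p : R).
Local Notation N := n.+1.
Local Notation mu := (@lebesgueN R N).
Local Notation e := (delta_mx 0 0 : 'rV[R]_N).
Local Notation al := ((N%:R - s * p) / p).
Hypotheses (p2 : 2 <= p) (s0 : 0 < s) (sN : s * p < N%:R).

Let p0 : 0 < p. Proof. exact: lt_le_trans p2. Qed.
Let sp0 : 0 < s * p. Proof. by rewrite mulr_gt0. Qed.
Let al0 : 0 < al. Proof. by rewrite divr_gt0// subr_gt0. Qed.
Let alp : al * p = N%:R - s * p. Proof. by rewrite divfK// gt_eqF. Qed.

Definition riesz_kernel (x y : 'rV[R]_N) : R := (enorm (x - y) `^ (N%:R + s * p))^-1.
Local Notation k := riesz_kernel.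

Lemma riesz_kernel_ge0 x y : 0 <= k x y.
Proof. by rewrite invr_ge0 powR_ge0. Qed.

Lemma measurable_riesz_kernel :
  measurable_fun [set: 'rV[R]_N * 'rV[R]_N] (fun z => k z.1 z.2).
Proof. by rewrite /riesz_kernel; mfun. Qed.

Lemma riesz_kernelC x y : k x y = k y x.
Proof. by rewrite /riesz_kernel enormB. Qed.

Lemma riesz_kernelZ c x y : 0 < c -> k (c *: x) (c *: y) = c `^ (- (N%:R + s * p)) * k x y.
Proof.
move=> c0; rewrite /riesz_kernel -scalerBr enormZ gtr0_norm// powRM ?enorm_ge0 ?(ltW c0)//.
by rewrite invfM powRN.
Qed.

Lemma riesz_kernel_isometry T x y : rV_isometry T -> k (T x) (T y) = k x y.
Proof. by move=> hT; rewrite /riesz_kernel -(rV_isometryB hT); case: hT => _ _ _ ->. Qed.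

(** Half the Hardy constant, cut at radius th: for th < 1 the domain stays away from the pole e of
    the kernel. *)
Definition hardy_const_upto (th : R) : \bar R :=
  (\int[mu]_y (((0 < enorm y)%R%:R * (enorm y < th)%R%:R *
     (enorm y `^ (s * p - N%:R) * `|1 - enorm y `^ al| `^ p)) * k e y)%:E)%E.

Lemma hardy_const_upto1 : @hardy_const R N s p = (2%:E * hardy_const_upto 1)%E.
Proof. exact: hardy_const_integral. Qed.

(** With t = (|x| / |y|)^al, [phiA] is the weight ((1 - t) / t)^{p - 1} of |u y|^p in [hardy_remE]
    as a function of r = |x| / |y|, and [phiB] below is the weight (1 - t)^{p - 1} of |u x|^p as a
    function of r = |y| / |x|; both are cut to the cone. *)
Let phiA (th r : R) : R := (0 < r)%R%:R * (r < th)%R%:R * ((1 - r `^ al) / r `^ al) `^ (p - 1).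
Let A_ th : \bar R := (\int[mu]_y (phiA th (enorm y) * k e y)%R%:E)%E.

Let mphiA th : measurable_fun [set: R] (phiA th).
Proof. by rewrite /phiA; mfun. Qed.

Let phiA_ge0 th r : 0 <= phiA th r.
Proof. by rewrite /phiA; nneg. Qed.

Let phiA0 th : phiA th 0 = 0.
Proof. by rewrite /phiA ltxx !mul0r. Qed.

Let powR_al_lt1 (r : R) : 0 < r -> r < 1 -> 0 < r `^ al < 1.
Proof.
move=> r0 r1; rewrite powR_gt0//= -[ltRHS](congr1 (fun f => f al) (@powR1 R)).
by apply: gt0_ltr_powR => //; rewrite nnegrE// ltW.
Qed.

Let phiAE th r : th < 1 -> 0 < r -> r < th ->
  phiA th r = (1 - r `^ al) `^ (p - 1) * r `^ (s * p - N%:R) * r `^ al.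
Proof.
move=> th1 r0 rth; rewrite /phiA r0 rth !mul1r.
have /andP[ra0 ra1] := powR_al_lt1 r0 (lt_trans rth th1).
rewrite powRM ?subr_ge0 ?invr_ge0 ?(ltW ra0) ?(ltW ra1)// -mulrA; congr (_ * _).
rewrite -powR_inv1 ?(ltW ra0)// -!powRrM -powRD; last by rewrite (gt_eqF r0) implybT.
congr (_ `^ _); rewrite (_ : s * p - N%:R = - (al * p)); last by rewrite alp opprB.
ring.
Qed.

(** On |y| < th < 1 the kernel is at most (1 - th)^{-(N + sp)}; what remains is at most |y|^{-al (p
    - 1)}, integrable at the origin because al (p - 1) < N. *)
Let A_lty th : th < 1 -> (A_ th < +oo)%E.
Proof.
move=> th1; have [th0|th0] := leP th 0.
  rewrite /A_; under eq_integral => y _.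
    have -> : phiA th (enorm y) = 0.
      rewrite /phiA [_ < th]ltNge (le_trans th0 (enorm_ge0 _))//= mulr0 mul0r//.
    by rewrite mul0r; over.
  by rewrite integral0.
have b1 : al * (p - 1) < N%:R by rewrite mulrBr mulr1 alp; move: sp0 al0 => ? ?; lra.
pose c := ((1 - th) `^ (N%:R + s * p))^-1.
have c0 : 0 <= c by rewrite invr_ge0 powR_ge0.
have me := @measurable_enorm R N.
have mk := measurable_section2 e measurable_riesz_kernel.
apply: (@le_lt_trans _ _ (\int[mu]_x (c * ((0 < enorm x)%R%:R * (enorm x <= 1)%R%:R *
    enorm x `^ (- (al * (p - 1)))))%:E)%E).
  apply: ge0_le_integral_real.
  - have mA := mphiA th; by mfun.
  - by mfun.
  - by move=> y; rewrite mulr_ge0// riesz_kernel_ge0.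
  - move=> y; rewrite /phiA; case: ltP => y0; last by rewrite !mul0r mulr0.
    case: ltP => yth; last by rewrite mulr0 !mul0r mulr_ge0// mulr_ge0 ?powR_ge0// mulr_ge0.
    have y1 : enorm y < 1 by exact: lt_trans th1.
    rewrite (ltW y1) !mul1r mulrC.
    have /andP[ra0 ra1] := powR_al_lt1 y0 y1.
    apply: ler_pM; rewrite ?riesz_kernel_ge0 ?powR_ge0//.
      rewrite /k /riesz_kernel lef_pV2 ?posrE ?powR_gt0 ?subr_gt0//.
        apply: ge0_ler_powR; rewrite ?nnegrE ?subr_ge0 ?(ltW th1) ?enorm_ge0//.
          by rewrite addr_ge0// ltW.
        apply: le_trans (ler_coord_enorm _ 0); rewrite !mxE !eqxx/=.
        apply: le_trans (ler_norm _); rewrite lerD2l lerN2.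
        by apply: le_trans (ltW yth); apply: le_trans (ler_coord_enorm _ 0); exact: ler_norm.
      rewrite lt_def enorm_ge0 andbT enorm_eq0 subr_eq0; apply/eqP => ey.
      by move: y1; rewrite -ey enorm_delta ltxx.
    have -> : enorm y `^ (- (al * (p - 1))) = ((enorm y `^ al)^-1) `^ (p - 1).
      rewrite -[(enorm y `^ al)^-1]powR_inv1 ?(ltW ra0)// -(powRrM (enorm y) al (-1)).
      rewrite -(powRrM (enorm y) (al * -1) (p - 1)).
      by congr (_ `^ _); ring.
    apply: ge0_ler_powR; rewrite ?nnegrE; first by move: p2 => ?; lra.
    - by rewrite divr_ge0 ?subr_ge0 ?ltW.
    - by rewrite invr_ge0 ltW.
    - by rewrite ler_piMl ?invr_ge0 ?(ltW ra0)// gerBl ltW.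
rewrite ge0_integralZl_real//; last 2 first.
- by mfun.
- by move=> y; nneg.
by rewrite lte_mul_pinfty// integral_enorm_powR_lty.
Qed.

Let phiB (th r : R) : R := (1 < th * r)%R%:R * (1 - r^-1 `^ al) `^ (p - 1).

(** Inversion turns [phiB] into (1 - r^al)^{p - 1} r^{sp - N} on r < th. Splitting 1 = r^al + (1 -
    r^al) gives [phiA] and the integrand of [hardy_const_upto]. *)
Let B_eq th : 0 < th < 1 ->
  (\int[mu]_y (phiB th (enorm y) * k e y)%R%:E = A_ th + hardy_const_upto th)%E.
Proof.
move=> /andP[th0 th1].
have me := @measurable_enorm R N.
have mk := measurable_section2 e measurable_riesz_kernel.
have mA := mphiA th.
rewrite (@homogeneous_kernel_inversion R n k (s * p)).
- rewrite /A_ /hardy_const_upto -ge0_integralD_real; last 4 first.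
  + by mfun.
  + by mfun.
  + by move=> y; rewrite mulr_ge0// riesz_kernel_ge0.
  + by move=> y; rewrite mulr_ge0 ?riesz_kernel_ge0//; nneg.
  apply: eq_integral => y _; congr EFin; rewrite -mulrDl; congr (_ * _).
  rewrite /phiB invrK; have [y0|y0] := ltP 0 (enorm y); last first.
    have -> : enorm y = 0 by apply/eqP; rewrite eq_le y0 enorm_ge0.
    by rewrite invr0 mulr0 ltr10 phiA0 !mul0r addr0.
  rewrite ltr_pdivlMr// mul1r; case: ltP => yth; last first.
    by rewrite /phiA [_ < th]ltNge yth/= !(mulr0, mul0r) addr0.
  rewrite phiAE//.
  have y1 : enorm y < 1 by exact: lt_trans th1.
  have /andP[ra0 ra1] := powR_al_lt1 y0 y1.
  rewrite !mul1r ger0_norm ?subr_ge0 ?(ltW ra1)//.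
  have -> : (1 - enorm y `^ al) `^ p = (1 - enorm y `^ al) `^ (p - 1) * (1 - enorm y `^ al).
    by rewrite -{3}(@powRr1 _ (1 - enorm y `^ al)) ?subr_ge0 ?(ltW ra1)// -powRD ?subrK//
      subr_eq0 (gt_eqF ra1) implybT.
  by ring.
- exact: sp0.
- exact: riesz_kernel_ge0.
- exact: measurable_riesz_kernel.
- exact: riesz_kernelC.
- by move=> c x y; exact: riesz_kernelZ.
- by move=> T x y; exact: riesz_kernel_isometry.
- by rewrite /phiB; mfun.
- by move=> r; rewrite /phiB; nneg.
- by rewrite /phiB mulr0 ltr10 mul0r.
Qed.

Variable u : 'rV[R]_N -> R.
Hypothesis mu_ : measurable_fun [set: 'rV[R]_N] u.

Definition hardy_rem (x y : 'rV[R]_N) : R :=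
  enorm x `^ (- (al * p)) *
  jensen_gap p ((enorm x / enorm y) `^ al) (u x * enorm x `^ al) (u y * enorm y `^ al).

(** With a = |x|^al and b = |y|^al one has t = a / b, hence X - t Y = a (u x - u y) and t (b / a)^p
    = t^{1 - p}. The terms are arranged to be nonnegative on both sides, so each can be integrated
    before any difference is known to make sense. *)
Lemma hardy_remE x y : 0 < enorm x -> enorm x < enorm y ->
  let t := (enorm x / enorm y) `^ al in
  `|u x - u y| `^ p + ((1 - t) / t) `^ (p - 1) * `|u y| `^ p =
  hardy_rem x y + (1 - t) `^ (p - 1) * `|u x| `^ p.
Proof.
move=> x0 xy t; have y0 : 0 < enorm y by exact: lt_trans xy.
rewrite /hardy_rem /jensen_gap -/t.
set a := enorm x `^ al; set b := enorm y `^ al.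
have a0 : 0 < a by exact: powR_gt0.
have b0 : 0 < b by exact: powR_gt0.
have tE : t = a / b.
  rewrite /t powRM ?invr_ge0 ?(ltW x0) ?(ltW y0)//; congr (_ * _).
  by rewrite -powR_inv1 ?(ltW y0)// -powRrM mulN1r powRN.
have t0 : 0 < t by rewrite tE divr_gt0.
have t1 : t < 1.
  rewrite tE ltr_pdivrMr// mul1r; apply: gt0_ltr_powR => //; by rewrite nnegrE ltW.
have -> : u x * a - t * (u y * b) = a * (u x - u y).
  by rewrite tE; field; rewrite gt_eqF.
rewrite !normrM (gtr0_norm a0) (gtr0_norm b0).
rewrite !powRM ?(ltW a0) ?(ltW b0)// ?invr_ge0 ?subr_ge0 ?(ltW t0) ?(ltW t1)//.
rewrite powRN powRrM -/a.
have ap0 : 0 < a `^ p by exact: powR_gt0.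
have tp : t * (b `^ p / a `^ p) = t^-1 `^ (p - 1).
  have -> : b `^ p / a `^ p = t^-1 `^ p.
    rewrite tE invf_div powRM ?invr_ge0 ?(ltW a0) ?(ltW b0)//; congr (_ * _).
    by rewrite -[a^-1]powR_inv1 ?(ltW a0)// -powRrM mulN1r powRN.
  have -> : t^-1 `^ p = t^-1 * t^-1 `^ (p - 1).
    by rewrite mulr_powRB1 ?invr_ge0 ?ltW.
  by rewrite mulrA mulfV ?mul1r// gt_eqF.
by rewrite -tp; apply: hardy_rem_algebra; rewrite gt_eqF.
Qed.

Lemma measurable_hardy_rem :
  measurable_fun [set: 'rV[R]_N * 'rV[R]_N] (fun z => hardy_rem z.1 z.2).
Proof. by rewrite /hardy_rem /jensen_gap; mfun. Qed.

Lemma hardy_rem_ge0 x y : 0 < enorm x -> enorm x < enorm y -> 0 <= hardy_rem x y.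
Proof.
move=> x0 xy; have y0 : 0 < enorm y by exact: lt_trans xy.
rewrite mulr_ge0 ?powR_ge0// jensen_gap_ge0//.
by apply: powR_al_lt1; rewrite ?divr_gt0// ltr_pdivrMr// mul1r.
Qed.

Definition hardy_rem_integral (th : R) : \bar R :=
  (\int[mu]_x \int[mu]_y (cone_ind th x y * hardy_rem x y * k x y)%:E)%E.

Definition hardy_energy : \bar R :=
  (\int[mu]_x (`|u x| `^ p * enorm x `^ (- (s * p)))%:E)%E.

Lemma hardy_energyE : @hardy_term R N s p u = hardy_energy.
Proof. by apply: eq_integral => x _; rewrite powRN. Qed.

Let ind_rem_ge0 th x y : th <= 1 -> 0 <= cone_ind th x y * hardy_rem x y * k x y.
Proof.
move=> th1; rewrite mulr_ge0 ?riesz_kernel_ge0// /cone_ind.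
have [x0|] := ltP 0 (enorm x); last by rewrite !mul0r.
have [xy|] := ltP (enorm x) (th * enorm y); last by rewrite mulr0 mul0r.
rewrite !mul1r hardy_rem_ge0//; apply: (lt_le_trans xy).
by rewrite ler_piMl// enorm_ge0.
Qed.

Let ind_swap (th : R) (x y : 'rV[R]_N) : th <= 1 -> cone_ind th x y + cone_ind th y x <= 1.
Proof.
move=> th1; rewrite /cone_ind.
have [xy|xy] := ltP (enorm x) (th * enorm y); last first.
  rewrite mulr0 add0r; case: (0 < enorm y); case: (enorm y < _); rewrite ?(mulr0, mul0r, mulr1)//.
suff -> : (enorm y < th * enorm x) = false.
  by rewrite mulr0 addr0 mulr1; case: (0 < _).
apply/negbTE; rewrite -leNgt; apply: (@le_trans _ _ (enorm x)).
  by rewrite ler_piMl// enorm_ge0.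
by apply: le_trans (ltW xy) _; rewrite ler_piMl// enorm_ge0.
Qed.

Lemma hardy_rem_integral_ge0 th : th <= 1 -> (0 <= hardy_rem_integral th)%E.
Proof.
move=> th1; apply: integral_ge0 => x _; apply: integral_ge0 => y _.
by rewrite lee_fin ind_rem_ge0.
Qed.

Lemma hardy_energy_ge0 : (0 <= hardy_energy)%E.
Proof. by apply: integral_ge0 => x _; rewrite lee_fin mulr_ge0 ?powR_ge0. Qed.

Lemma hardy_const_upto_ge0 th : (0 <= hardy_const_upto th)%E.
Proof.
apply: integral_ge0 => y _; rewrite lee_fin.
by rewrite !mulr_ge0 ?powR_ge0 ?riesz_kernel_ge0.
Qed.

Let hardy_rem_split (th : R) x y : 0 < th -> th < 1 ->
  cone_ind th x y * `|u x - u y| `^ p * k x y +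
  `|u y| `^ p * (phiA th (enorm x / enorm y) * k x y) =
  cone_ind th x y * hardy_rem x y * k x y +
  `|u x| `^ p * (phiB th (enorm y / enorm x) * k x y).
Proof.
move=> th0 th1; apply: hardy_split_algebra; rewrite /cone_ind /phiA /phiB.
have [x0|x0] := ltP 0 (enorm x); last first.
  have x0' : enorm x = 0 by apply/eqP; rewrite eq_le x0 enorm_ge0.
  have e1 : (0 < enorm x / enorm y) = false by rewrite x0' mul0r ltxx.
  have e2 : (1 < th * (enorm y / enorm x)) = false by rewrite x0' invr0 !mulr0 ltr10.
  rewrite e1 e2.
  apply: hardy_split_algebra0.
  - rewrite mul0r.
    by [].
  - by [].
  by [].
have [y0|y0] := ltP 0 (enorm y); last first.
  have y0' : enorm y = 0 by apply/eqP; rewrite eq_le y0 enorm_ge0.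
  have e1 : (0 < enorm x / enorm y) = false by rewrite y0' invr0 mulr0 ltxx.
  have e2 : (1 < th * (enorm y / enorm x)) = false by rewrite y0' mul0r mulr0 ltr10.
  have e3 : (enorm x < th * enorm y) = false by rewrite y0' mulr0 ltNge ltW.
  rewrite e1 e2 e3; apply: hardy_split_algebra0.
  - by rewrite mulr0.
  - by [].
  by [].
rewrite divr_gt0//= ltr_pdivrMr// mulrA ltr_pdivlMr// !mul1r.
apply: hardy_split_algebra1 => xy; rewrite invf_div.
have xy' : enorm x < enorm y by apply: (lt_le_trans xy); rewrite ler_piMl// ltW.
exact: hardy_remE x0 xy'.
Qed.

(* On the cone |x| < th |y| the divergent parts of the two weights are the same [A_ th],
   which is finite for th < 1 and can be subtracted. *)
Lemma hardy_rem_integral_le th : 0 < th < 1 -> (hardy_energy < +oo)%E ->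
  (2%:E * hardy_rem_integral th + 2%:E * hardy_const_upto th * hardy_energy
     <= @gagliardo R N s p u)%E.
Proof.
move=> /andP[th0 th1] Hoo.
have me := @measurable_enorm R N.
have mk := measurable_riesz_kernel.
have mke := measurable_section2 e mk.
have mr := measurable_hardy_rem.
have mA := mphiA th.
have mB : measurable_fun [set: R] (phiB th) by rewrite /phiB; mfun.
have B0 r : 0 <= phiB th r by rewrite /phiB; nneg.
have k0 := riesz_kernel_ge0.
have mu1 := measurableT_comp mu_ (@measurable_fst _ _ [the measurableType _ of 'rV[R]_N] [the measurableType _ of 'rV[R]_N]).
have mu2 := measurableT_comp mu_ (@measurable_snd _ _ [the measurableType _ of 'rV[R]_N] [the measurableType _ of 'rV[R]_N]).
have H0 : (0 <= hardy_energy)%E by apply: ge0_integral_real => x; nneg.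
have HE : hardy_energy = (fine hardy_energy)%:E by rewrite fineK// ge0_fin_numE.
have A0 : (0 <= A_ th)%E by apply: ge0_integral_real => x; rewrite mulr_ge0.
have AE : A_ th = (fine (A_ th))%:E by rewrite fineK// ge0_fin_numE// A_lty.
have D0 : (0 <= hardy_const_upto th)%E by apply: ge0_integral_real => x; rewrite mulr_ge0//; nneg.
pose f1 x y := cone_ind th x y * `|u x - u y| `^ p * k x y.
pose f2 x y := `|u y| `^ p * (phiA th (enorm x / enorm y) * k x y).
pose f3 x y := cone_ind th x y * hardy_rem x y * k x y.
pose f4 x y := `|u x| `^ p * (phiB th (enorm y / enorm x) * k x y).
have f10 x y : 0 <= f1 x y by exact: mulr_ge0 (mulr_ge0 (mulr_ge0 (ler0n _ _) (ler0n _ _)) (powR_ge0 _ _)) (k0 _ _).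
have f20 x y : 0 <= f2 x y by exact: mulr_ge0 (powR_ge0 _ _) (mulr_ge0 (phiA_ge0 _ _) (k0 _ _)).
have f30 x y : 0 <= f3 x y by exact: ind_rem_ge0 (ltW th1).
have f40 x y : 0 <= f4 x y by exact: mulr_ge0 (powR_ge0 _ _) (mulr_ge0 (B0 _) (k0 _ _)).
have mf1 : measurable_fun [set: 'rV[R]_N * 'rV[R]_N] (fun z => f1 z.1 z.2).
  by rewrite /f1 /cone_ind /riesz_kernel; mfun.
have mf2 : measurable_fun [set: 'rV[R]_N * 'rV[R]_N] (fun z => f2 z.1 z.2).
  by rewrite /f2 /phiA /riesz_kernel; mfun.
have mf3 : measurable_fun [set: 'rV[R]_N * 'rV[R]_N] (fun z => f3 z.1 z.2).
  rewrite /f3 /cone_ind; apply: measurable_funM; last exact: mk.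
  by apply: measurable_funM; [mfun|exact: mr].
have mf4 : measurable_fun [set: 'rV[R]_N * 'rV[R]_N] (fun z => f4 z.1 z.2).
  by rewrite /f4 /phiB /riesz_kernel; mfun.
have ff x y : f1 x y + f2 x y = f3 x y + f4 x y by exact: hardy_rem_split.
have I2 : (\int[mu]_x \int[mu]_y (f2 x y)%:E = A_ th * hardy_energy)%E.
  rewrite (tonelli_real mu mu mf2 f20) /hardy_energy -ge0_integralZl//; last 2 first.
  - by apply/measurable_EFinP; mfun.
  - by move=> x _; nneg.
  apply: eq_integral => y _; rewrite ge0_integralZl_real ?powR_ge0//; last 2 first.
  - by have mky := measurable_section1 y mk; rewrite /phiA; mfun.
  - by move=> x; exact: mulr_ge0 (phiA_ge0 _ _) (k0 _ _).
  under eq_integral => x _.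
    rewrite riesz_kernelC; over.
  have := @homogeneous_kernel_integral R n k (s * p) sp0 k0 mk riesz_kernelZ
    (fun T x y => @riesz_kernel_isometry T x y) (phiA th) y mA (phiA_ge0 th) (phiA0 th).
  by move=> ->; rewrite -/(A_ th) EFinM muleA muleC.
have I4 : (\int[mu]_x \int[mu]_y (f4 x y)%:E = (A_ th + hardy_const_upto th) * hardy_energy)%E.
  rewrite /hardy_energy -ge0_integralZl//; last 3 first.
  - by apply/measurable_EFinP; mfun.
  - by move=> x _; rewrite lee_fin mulr_ge0 ?powR_ge0.
  - exact: adde_ge0.
  apply: eq_integral => x _; rewrite ge0_integralZl_real ?powR_ge0//; last 2 first.
  - by have mkx := measurable_section2 x mk; mfun.
  - by move=> y; exact: mulr_ge0 (B0 _) (k0 _ _).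
  have B00 : phiB th 0 = 0 by rewrite /phiB mulr0 ltr10 mul0r.
  have := @homogeneous_kernel_integral R n k (s * p) sp0 k0 mk riesz_kernelZ
    (fun T x y => @riesz_kernel_isometry T x y) (phiB th) x mB B0 B00.
  by move=> ->; rewrite B_eq ?th0// muleA -EFinM muleC.
have dD (f g : 'rV[R]_N -> 'rV[R]_N -> R) :
    measurable_fun [set: 'rV[R]_N * 'rV[R]_N] (fun z => f z.1 z.2) ->
    measurable_fun [set: 'rV[R]_N * 'rV[R]_N] (fun z => g z.1 z.2) ->
    (forall x y, 0 <= f x y) -> (forall x y, 0 <= g x y) ->
    (\int[mu]_x \int[mu]_y (f x y + g x y)%:E =
     \int[mu]_x \int[mu]_y (f x y)%:E + \int[mu]_x \int[mu]_y (g x y)%:E)%E.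
  move=> mf mg f0 g0; rewrite -ge0_integralD//; last 4 first.
  - by move=> x _; exact: ge0_integral_real.
  - exact: measurable_integral_real.
  - by move=> x _; exact: ge0_integral_real.
  - exact: measurable_integral_real.
  apply: eq_integral => x _; rewrite ge0_integralD_real//.
  - exact: measurable_section2 mf.
  - exact: measurable_section2 mg.
have E1 : (\int[mu]_x \int[mu]_y (f1 x y)%:E =
    hardy_rem_integral th + hardy_const_upto th * hardy_energy)%E.
  pose I f := (\int[mu]_x \int[mu]_y (f x y : R)%:E)%E.
  have Eff : (I (fun x y => f1 x y + f2 x y)%R = I (fun x y => f3 x y + f4 x y)%R).
    by apply: eq_integral => x _; apply: eq_integral => y _; rewrite ff.
  have h : (I f1 + I f2 = I f3 + I f4)%E.
    exact: etrans (esym (dD f1 f2 mf1 mf2 f10 f20)) (etrans Eff (dD f3 f4 mf3 mf4 f30 f40)).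
  exact: (ereal_cancel_algebra A0 (A_lty th1) H0 Hoo D0
    (etrans (congr1 (adde (I f1)) (esym I2)) (etrans h (congr1 (adde (I f3)) I4)))).
have mG : measurable_fun [set: 'rV[R]_N * 'rV[R]_N]
    (fun z => `|u z.1 - u z.2| `^ p / enorm (z.1 - z.2) `^ (N%:R + s * p)) by mfun.
have mf1' : measurable_fun [set: 'rV[R]_N * 'rV[R]_N] (fun z => f1 z.2 z.1).
  by rewrite /f1 /cone_ind /riesz_kernel; mfun.
rewrite -muleA -ge0_muleDr//; last 2 first.
- exact: hardy_rem_integral_ge0 (ltW th1).
- exact: mule_ge0.
rewrite -E1 mule_natl mule2n.
(* Exchanging x and y gives the same integral over the opposite cone. The two cones are disjoint, so
   twice this integral is at most the full seminorm. *)
have E2 : (\int[mu]_x \int[mu]_y (f1 x y)%:E = \int[mu]_x \int[mu]_y (f1 y x)%:E)%E.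
  exact: (tonelli_real mu mu mf1 f10).
rewrite {1}E2 -(dD (fun x y => f1 y x) f1 mf1' mf1 (fun x y => f10 y x) f10).
apply: (@le_integral2_real _ _ _ _ _ mu mu (fun x y => f1 y x + f1 x y) _ _ mG) => [|x y|x y].
- exact: measurable_funD mf1' mf1.
- exact: addr_ge0 (f10 _ _) (f10 _ _).
rewrite /f1 [k y x]riesz_kernelC distrC -!(mulrA (cone_ind th _ _)) -mulrDl.
apply: ler_piMl; first exact: mulr_ge0 (powR_ge0 _ _) (k0 _ _).
exact: ind_swap (ltW th1).
Qed.
End riesz_kernel.

Section integral_limits.
Context {R : realType} d (T : measurableType d) (m : {measure set T -> \bar R}).

Lemma cvg_integral_nondecreasing (g : nat -> T -> \bar R) (f : T -> \bar R) :
  (forall k, measurable_fun [set: T] (g k)) -> (forall k x, 0 <= g k x)%E ->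
  (forall x i j, (i <= j)%N -> (g i x <= g j x)%E) ->
  (forall x, g k x @[k --> \oo] --> f x) ->
  (\int[m]_x g k x @[k --> \oo] --> \int[m]_x f x)%E.
Proof.
move=> mg g0 gh gf.
have -> : (\int[m]_x f x = \int[m]_x (fun x => limn (g^~ x)) x)%E.
  by apply: eq_integral => x _; apply/esym/cvg_lim => //; exact: gf.
by apply: cvg_monotone_convergence => // x _ i j; exact: gh.
Qed.

Lemma integral_eq0_ae (f : T -> R) : measurable_fun [set: T] f -> (forall x, 0 <= f x) ->
  (\int[m]_x (f x)%:E = 0)%E -> {ae m, forall x, f x = 0}.
Proof.
move=> mf f0 h.
have /(ae_eq_integral_abs m measurableT) : measurable_fun [set: T] (fun x => (f x)%:E) by exact/measurable_EFinP.
move=> [+ _] => /(_ _)[].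
  by rewrite -[RHS]h; apply: eq_integral => x _; rewrite gee0_abs// lee_fin.
move=> A [mA A0 fA]; exists A; split => // x /= fx; apply: fA => /= ffx.
by apply: fx; apply: EFin_inj; exact: ffx.
Qed.
End integral_limits.

(** * Passage to the full cone *)

Section hardy_limit.
Context {R : realType} (n : nat) (s p : R).
Local Notation N := n.+1.
Local Notation mu := (@lebesgueN R N).
Local Notation e := (delta_mx 0 0 : 'rV[R]_N).
Local Notation al := ((N%:R - s * p) / p).
Hypotheses (p2 : 2 <= p) (s0 : 0 < s) (s1 : s < 1) (sN : s * p < N%:R).
Local Notation k := (riesz_kernel s p).

(** The shift by 2 keeps [th 0] positive. *)
Let th (i : nat) : R := 1 - i.+2%:R^-1.

Let th01 i : 0 < th i < 1.
Proof.
rewrite /th gtrBl invr_gt0 ltr0n andbT subr_gt0 invf_lt1 ?ltr0n//.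
by rewrite ltr1n.
Qed.

Let th_homo i j : (i <= j)%N -> th i <= th j.
Proof. by move=> ij; rewrite /th lerD2l lerN2 lef_pV2 ?posrE ?ltr0n// ler_nat. Qed.

Let near_th (c : R) : c < 1 -> \forall i \near \oo, c < th i.
Proof.
move=> c1; have d0 : 0 < 1 - c by rewrite subr_gt0.
have := near_infty_natSinv_lt (PosNum d0) => /=; apply: filterS => i h.
rewrite /th ltrBrDr addrC -ltrBrDr; apply: le_lt_trans h.
by rewrite lef_pV2 ?posrE ?ltr0n// ler_nat.
Qed.

Let near_cone (x y : 'rV[R]_N) :
  \forall i \near \oo, cone_ind (th i) x y = cone_ind 1 x y.
Proof.
rewrite /cone_ind mul1r; have [xy|yx] := ltP (enorm x) (enorm y).
  have y0 : 0 < enorm y by apply: le_lt_trans xy; exact: enorm_ge0.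
  have : enorm x / enorm y < 1 by rewrite ltr_pdivrMr// mul1r.
  move=> /near_th; apply: filterS => i; rewrite ltr_pdivrMr// => ->.
  by [].
apply: nearW => i; rewrite [_ < th i * _]ltNge (le_trans _ yx)// ler_piMl ?enorm_ge0//.
by have /andP[_ /ltW] := th01 i.
Qed.

Let cone_homo (x y : 'rV[R]_N) i j : (i <= j)%N -> cone_ind (th i) x y <= cone_ind (th j) x y :> R.
Proof.
move=> ij; rewrite /cone_ind ler_wpM2l// ler_nat.
case: ltP => //= xi; rewrite lt0b (lt_le_trans xi)//.
by rewrite ler_wpM2r ?enorm_ge0// th_homo.
Qed.

Variable u : 'rV[R]_N -> R.
Hypothesis mu_ : measurable_fun [set: 'rV[R]_N] u.
Local Notation H := (hardy_energy s p u).

Lemma cone_rem_ge0 (t : R) (x y : 'rV[R]_N) : t <= 1 -> 0 <= cone_ind t x y * hardy_rem s p u x y.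
Proof.
move=> t1; rewrite /cone_ind.
have [x0|] := ltP 0 (enorm x); last by rewrite !mul0r.
have [xy|] := ltP (enorm x) (t * enorm y); last by rewrite mulr0 mul0r.
rewrite !mul1r (@hardy_rem_ge0 R n s p p2 sN u x y x0)//; apply: (lt_le_trans xy).
by rewrite ler_piMl// enorm_ge0.
Qed.

Let f (i : nat) (x y : 'rV[R]_N) := cone_ind (th i) x y * hardy_rem s p u x y * k x y.

Let f0 i x y : 0 <= f i x y.
Proof.
by apply: mulr_ge0 (riesz_kernel_ge0 _ _ _ _); apply: cone_rem_ge0; have /andP[_ /ltW] := th01 i.
Qed.

Let mf i : measurable_fun [set: 'rV[R]_N * 'rV[R]_N] (fun z => f i z.1 z.2).
Proof.
rewrite /f; apply: measurable_funM; last exact: measurable_riesz_kernel.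
have me := @measurable_enorm R N.
by apply: measurable_funM; [rewrite /cone_ind; mfun|exact: measurable_hardy_rem].
Qed.

Let f_homo x y i j : (i <= j)%N -> f i x y <= f j x y.
Proof.
move=> ij; rewrite /f ler_wpM2r ?riesz_kernel_ge0//.
have [r0|r0] := leP 0 (hardy_rem s p u x y); first by rewrite ler_wpM2r// cone_homo.
(* The remainder is nonnegative on every cone, so where it is negative the indicator must vanish. *)
suff E l : cone_ind (th l) x y * hardy_rem s p u x y = 0 by rewrite !E.
apply/eqP; rewrite eq_le cone_rem_ge0 ?andbT; last by have /andP[_ /ltW] := th01 l.
by rewrite mulr_ge0_le0 ?(ltW r0)// /cone_ind mulr_ge0.
Qed.

Let cvg_rem : (hardy_rem_integral s p u (th i) @[i --> \oo] --> hardy_rem_integral s p u 1)%E.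
Proof.
apply: cvg_integral_nondecreasing => [i|i x|x i j ij|x].
- by have := @measurable_integral_real _ _ _ _ _ mu (f i) (mf i) (f0 i).
- by apply: integral_ge0 => y _; rewrite lee_fin; exact: f0.
- apply: (@ge0_le_integral_real _ _ _ mu (f i x) (f j x)).
  + exact: measurable_section2 (mf i).
  + exact: measurable_section2 (mf j).
  + exact: f0.
  + by move=> y; exact: f_homo.
- apply: cvg_integral_nondecreasing => [i|i y|y i j ij|y].
  + by apply/measurable_EFinP; exact: measurable_section2 (mf i).
  + by rewrite lee_fin; exact: f0.
  + by rewrite lee_fin; exact: f_homo.
  + by apply: cvg_near_cst; have := near_cone x y; apply: filterS => i ->.
Qed.

Let g (i : nat) (y : 'rV[R]_N) := (0 < enorm y)%R%:R * (enorm y < th i)%R%:R *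
  (enorm y `^ (s * p - N%:R) * `|1 - enorm y `^ al| `^ p) * k e y.

Let cvg_const : (hardy_const_upto n s p (th i) @[i --> \oo] --> hardy_const_upto n s p 1)%E.
Proof.
apply: cvg_integral_nondecreasing => [i|i x|x i j ij|x].
- apply/measurable_EFinP; have me := @measurable_enorm R N.
  have mke := measurable_section2 e (@measurable_riesz_kernel R n s p).
  by mfun.
- by rewrite lee_fin !mulr_ge0 ?powR_ge0 ?riesz_kernel_ge0.
- rewrite lee_fin ler_wpM2r ?riesz_kernel_ge0// ler_wpM2r ?mulr_ge0 ?powR_ge0//.
  rewrite ler_wpM2l// ler_nat; case: ltP => //= xi.
  by rewrite lt0b (lt_le_trans xi)// th_homo.
apply: cvg_near_cst; have [x1|x1] := ltP (enorm x) 1.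
  by have := near_th x1; apply: filterS => i ->.
apply: nearW => i; rewrite [_ < th i]ltNge (le_trans _ x1)//.
by have /andP[_ /ltW] := th01 i.
Qed.

(** Monotone convergence in [hardy_rem_integral_le] as th increases to 1, its right side being
    independent of th. *)
Lemma hardy_remainder : (H < +oo)%E ->
  (2%:E * hardy_rem_integral s p u 1 + @hardy_const R N s p * H <= @gagliardo R N s p u)%E.
Proof.
move=> Hoo; rewrite hardy_const_upto1.
have Hf : H \is a fin_num by rewrite ge0_fin_numE// hardy_energy_ge0.
have h1 : (2%:E * hardy_rem_integral s p u (th i) @[i --> \oo] --> 2%:E * hardy_rem_integral s p u 1)%E.
  by apply: cvgeZl => //; exact: cvg_rem.
have h2 : (2%:E * hardy_const_upto n s p (th i) * H @[i --> \oo] -->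
    2%:E * hardy_const_upto n s p 1 * H)%E.
  by apply: cvgeZr => //; apply: cvgeZl => //; exact: cvg_const.
apply: (cvge_le _ (cvgeD _ h1 h2)).
  by apply: nearW => i; exact: hardy_rem_integral_le.
apply: ge0_adde_def; rewrite inE.
- by rewrite mule_ge0// hardy_rem_integral_ge0.
- by rewrite !mule_ge0// ?hardy_energy_ge0// hardy_const_upto_ge0.
Qed.
End hardy_limit.

(** * Finiteness of the Hardy term *)

(** For an integer m >= al this gives 1 - r^al <= m (1 - r), the order of vanishing at r = 1 that
    tames the kernel in the Hardy constant. *)
Lemma subr1_expr_le {R : realDomainType} (r : R) m : 0 <= r <= 1 -> 1 - r ^+ m <= m%:R * (1 - r).
Proof.
move=> /andP[r0 r1]; elim: m => [|m IH]; first by rewrite expr0 subrr mul0r.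
have -> : 1 - r ^+ m.+1 = (1 - r) + r * (1 - r ^+ m) by rewrite exprS; ring.
rewrite -natr1 [X in _ <= X](_ : _ = (1 - r) + m%:R * (1 - r)); last by ring.
rewrite lerD2l; apply: le_trans IH; apply: ler_piMl => //.
by rewrite subr_ge0 exprn_ile1.
Qed.

Section enorm_triangle.
Context {R : realType} {n : nat}.
Implicit Types x y : 'rV[R]_n.

(** Cauchy-Schwarz, by expanding the square of |y| x - |x| y. *)
Lemma dotr_le x y : dotr x y <= enorm x * enorm y.
Proof.
have [->|x0] := eqVneq x 0.
  by rewrite -(scale0r y) dotrZl mul0r mulr_ge0 ?enorm_ge0.
have [->|y0] := eqVneq y 0.
  by rewrite dotrC -(scale0r x) dotrZl mul0r mulr_ge0 ?enorm_ge0.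
have a0 : 0 < enorm x by rewrite enorm_gt0.
have b0 : 0 < enorm y by rewrite enorm_gt0.
set a := enorm x in a0 *; set b := enorm y in b0 *.
have := dotr_ge0 (b *: x - a *: y).
have -> : dotr (b *: x - a *: y) (b *: x - a *: y) = 2 * (a * b) * (a * b - dotr x y).
  rewrite dotrDl dotrNl !dotrZl ![dotr _ (_ - _)]dotrC !dotrDl !dotrNl !dotrZl.
  rewrite [dotr y x]dotrC -!sqr_enorm -/a -/b; ring.
by rewrite pmulr_rge0 ?subr_ge0// !mulr_gt0.
Qed.

Lemma ler_enormD x y : enorm (x + y) <= enorm x + enorm y.
Proof.
rewrite -ler_sqr ?nnegrE ?addr_ge0 ?enorm_ge0// sqr_enorm.
rewrite dotrDl ![dotr _ (_ + _)]dotrC !dotrDl [dotr y x]dotrC -!sqr_enorm sqrrD.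
have := dotr_le x y; set a := dotr x y; set b := enorm x; set c := enorm y => h.
rewrite [leLHS](_ : _ = b ^+ 2 + 2 * a + c ^+ 2); last by ring.
by rewrite lerD2r lerD2l -[leRHS]mulr_natl ler_pM2l.
Qed.

Lemma ler_enormB x y : enorm (x - y) <= enorm x + enorm y.
Proof. by apply: le_trans (ler_enormD _ _) _; rewrite enormN. Qed.
End enorm_triangle.

Definition ball_powR {R : realType} n (b : R) (y : 'rV[R]_n) : R :=
  (0 < enorm y)%R%:R * (enorm y <= 1)%R%:R * enorm y `^ (- b).

Lemma ball_powR_ge0 {R : realType} n (b : R) (y : 'rV[R]_n) : 0 <= ball_powR b y.
Proof. by rewrite mulr_ge0 ?powR_ge0// mulr_ge0. Qed.

Lemma measurable_ball_powR {R : realType} n (b : R) :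
  measurable_fun [set: 'rV[R]_n] (ball_powR b).
Proof. by have me := @measurable_enorm R n; rewrite /ball_powR; mfun. Qed.

Lemma integral_ball_powR_lty {R : realType} n (b : R) : b < n.+1%:R ->
  (\int[lebesgueN n.+1]_y (ball_powR b y)%:E < +oo)%E.
Proof. exact: integral_enorm_powR_lty. Qed.

Lemma powRV {R : realType} (x b : R) : 0 <= x -> x^-1 `^ b = (x `^ b)^-1.
Proof. by move=> x0; rewrite -powR_inv1// -powRrM mulN1r powRN. Qed.

(** * Finiteness and positivity of the Hardy constant *)

Section hardy_constant.
Context {R : realType} (n : nat) (s p : R).
Local Notation N := n.+1.
Local Notation mu := (@lebesgueN R N).
Local Notation e := (delta_mx 0 0 : 'rV[R]_N).
Local Notation al := ((N%:R - s * p) / p).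
Hypotheses (p2 : 2 <= p) (s0 : 0 < s) (s1 : s < 1) (sN : s * p < N%:R).
Local Notation k := (riesz_kernel s p).

Let p0 : 0 < p. Proof. exact: lt_le_trans p2. Qed.
Let sp0 : 0 < s * p. Proof. by rewrite mulr_gt0. Qed.
Let al0 : 0 < al. Proof. by rewrite divr_gt0// subr_gt0. Qed.

Let powR_al (r : R) : 0 < r -> r < 1 -> 0 < r `^ al < 1.
Proof.
move=> r0 r1; rewrite powR_gt0//= -[ltRHS](congr1 (fun f => f al) (@powR1 R)).
by apply: gt0_ltr_powR => //; rewrite nnegrE// ltW.
Qed.

Let F (y : 'rV[R]_N) := (0 < enorm y)%R%:R * (enorm y < 1)%R%:R *
  (enorm y `^ (s * p - N%:R) * `|1 - enorm y `^ al| `^ p) * k e y.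

Let mF : measurable_fun [set: 'rV[R]_N] F.
Proof.
have me := @measurable_enorm R N.
have mke := measurable_section2 e (@measurable_riesz_kernel R n s p).
by rewrite /F; mfun.
Qed.

Let F0 y : 0 <= F y.
Proof. by rewrite /F !mulr_ge0 ?powR_ge0 ?riesz_kernel_ge0. Qed.

Let dist_ge (y : 'rV[R]_N) : 1 - enorm y <= enorm (e - y).
Proof.
apply: le_trans (ler_coord_enorm _ 0); rewrite !mxE !eqxx/=.
apply: le_trans (ler_norm _); rewrite lerD2l lerN2.
by apply: le_trans (ler_coord_enorm _ 0); exact: ler_norm.
Qed.

(** There are two singular points. At the origin the weight is of order |y|^{sp - N}. At e, the
    factor |1 - |y|^al|^p is at most a constant times |e - y|^p, which leaves |e - y|^{-(N + sp -
    p)}, integrable because s < 1. The constant term covers the points at distance more than 1 from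
    e. *)
Let F_le : exists c : R, 0 <= c /\ forall y, F y <= c * (ball_powR (N%:R - s * p) y +
  ball_powR (N%:R + s * p - p) (e - y) + ball_powR 0 y).
Proof.
have [m am] : exists m : nat, al <= m%:R.
  by exists (Num.truncn al).+1; rewrite ltW// truncnS_gt.
pose b := N%:R + s * p.
have b0 : 0 < b by rewrite addr_gt0// ltr0n.
pose c1 : R := 2 `^ b.
pose c2 : R := 2 `^ (N%:R - s * p) * m%:R `^ p.
have c10 : 0 <= c1 by exact: powR_ge0.
have c20 : 0 <= c2 by rewrite mulr_ge0 ?powR_ge0.
pose c3 := c2 * 2 `^ p.
have c30 : 0 <= c3 by rewrite mulr_ge0 ?powR_ge0.
exists (c1 + c2 + c3); split; first by rewrite !addr_ge0.
move=> y; set P1 := ball_powR _ y; set P2 := ball_powR _ (e - y); set P3 := ball_powR 0 y.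
have P10 : 0 <= P1 by exact: ball_powR_ge0.
have P20 : 0 <= P2 by exact: ball_powR_ge0.
have P30 : 0 <= P3 by exact: ball_powR_ge0.
suff : F y <= c1 * P1 + c2 * P2 + c3 * P3.
  move/le_trans; apply.
  have -> : (c1 + c2 + c3) * (P1 + P2 + P3) = c1 * P1 + c2 * P2 + c3 * P3 +
    ((c2 + c3) * P1 + (c1 + c3) * P2 + (c1 + c2) * P3) by ring.
  by rewrite lerDl !addr_ge0// mulr_ge0// addr_ge0.
have S0 : 0 <= c1 * P1 + c2 * P2 + c3 * P3.
  exact: addr_ge0 (addr_ge0 (mulr_ge0 c10 P10) (mulr_ge0 c20 P20)) (mulr_ge0 c30 P30).
rewrite /F; have [y0|_] := ltP 0 (enorm y); last first.
  by rewrite !mul0r; exact: S0.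
have [y1|_] := ltP (enorm y) 1; last by rewrite mulr0 !mul0r; exact: S0.
rewrite !mul1r.
have /andP[ya0 ya1] := powR_al y0 y1.
have d0 : 0 < enorm (e - y) by apply: lt_le_trans (dist_ge y); rewrite subr_gt0.
have nE : `|1 - enorm y `^ al| = 1 - enorm y `^ al by rewrite ger0_norm// subr_ge0 ltW.
have P3E : P3 = 1 by rewrite /P3 /ball_powR y0 (ltW y1) oppr0 powRr0 !mul1r.
have [yh|yh] := leP (enorm y) (2^-1).
  apply: (@le_trans _ _ (c1 * P1)); last first.
    by rewrite -addrA lerDl; exact: addr_ge0 (mulr_ge0 c20 P20) (mulr_ge0 c30 P30).
  rewrite /P1 /ball_powR y0 (ltW y1) opprB mulrC !mul1r.
  apply: ler_pM; rewrite ?riesz_kernel_ge0 ?mulr_ge0 ?powR_ge0//.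
    rewrite /riesz_kernel -/b.
    have -> : c1 = ((2^-1) `^ b)^-1 by rewrite powRV// invrK.
    rewrite lef_pV2 ?posrE ?powR_gt0// ge0_ler_powR ?nnegrE ?invr_ge0 ?enorm_ge0 ?(ltW b0)//.
    by apply: le_trans (dist_ge y); move: yh => ?; lra.
  rewrite -[leRHS]mulr1 ler_wpM2l ?powR_ge0// nE.
  rewrite -[leRHS](congr1 (fun f => f p) (@powR1 R)).
  by rewrite ge0_ler_powR ?nnegrE ?subr_ge0 ?(ltW p0) ?(ltW ya1)// gerBl ltW.
apply: (@le_trans _ _ (c2 * P2 + c3 * P3)); last first.
  by rewrite -addrA lerDr; exact: mulr_ge0 c10 P10.
have h1 : enorm y `^ (s * p - N%:R) <= 2 `^ (N%:R - s * p).
  rewrite -opprB powRN -powRV ?enorm_ge0// ge0_ler_powR ?nnegrE ?invr_ge0 ?enorm_ge0 ?subr_ge0 ?(ltW sN)//.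
  by rewrite -[leRHS]invrK lef_pV2 ?posrE ?invr_gt0// ltW.
have h2 : `|1 - enorm y `^ al| `^ p <= m%:R `^ p * enorm (e - y) `^ p.
  rewrite -powRM ?enorm_ge0// ge0_ler_powR ?nnegrE ?mulr_ge0 ?enorm_ge0 ?(ltW p0)//.
  rewrite nE; apply: (@le_trans _ _ (m%:R * (1 - enorm y))); last by rewrite ler_wpM2l.
  apply: le_trans (subr1_expr_le m _); last by rewrite enorm_ge0 ltW.
  rewrite lerD2l lerN2 -powR_mulrn ?enorm_ge0// ger_powR ?y0//.
  exact: ltW.
have h3 : F y <= c2 * (enorm (e - y) `^ p * k e y).
  rewrite /F y0 y1 !mul1r mulrA ler_wpM2r ?riesz_kernel_ge0//.
  by rewrite /c2 -[leRHS]mulrA; apply: ler_pM; rewrite ?powR_ge0.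
have -> : enorm y `^ (s * p - N%:R) * `|1 - enorm y `^ al| `^ p * k e y = F y.
  by rewrite /F y0 y1 !mul1r.
apply: le_trans h3 _; rewrite -[c3]/(c2 * _) -mulrA -mulrDr ler_wpM2l//.
have -> : enorm (e - y) `^ p * k e y = enorm (e - y) `^ (- (b - p)).
  rewrite /riesz_kernel -/b -powRN -powRD; last by rewrite (gt_eqF d0) implybT.
  by rewrite opprB.
have [d1|d1] := leP (enorm (e - y)) 1.
  by rewrite /P2 /ball_powR d0 d1 !mul1r lerDl mulr_ge0// powR_ge0.
apply: (@le_trans _ _ (2 `^ p)); last by rewrite P3E mulr1 lerDr.
apply: (@le_trans _ _ (enorm (e - y) `^ p)).
  by rewrite ler_powR ?(ltW d1)// opprB gerBl ltW.
rewrite ge0_ler_powR ?nnegrE ?enorm_ge0 ?(ltW p0)//.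
apply: le_trans (ler_enormB _ _) _.
by rewrite enorm_delta -[leRHS]/(1 + 1) lerD2l ltW.
Qed.

Lemma hardy_const_lty : (@hardy_const R N s p < +oo)%E.
Proof.
rewrite hardy_const_upto1 lte_mul_pinfty//.
have [c [c0 Fc]] := F_le.
have me := @measurable_enorm R N.
have mp2 : measurable_fun [set: 'rV[R]_N] (fun y => ball_powR (N%:R + s * p - p) (e - y)).
  by rewrite /ball_powR; mfun.
apply: (@le_lt_trans _ _ (\int[mu]_y (c * (ball_powR (N%:R - s * p) y +
  ball_powR (N%:R + s * p - p) (e - y) + ball_powR 0 y))%:E)%E).
  apply: ge0_le_integral_real => //.
  apply: measurable_funM => //; apply: measurable_funD; [|exact: measurable_ball_powR].
  by apply: measurable_funD; [exact: measurable_ball_powR|].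
rewrite ge0_integralZl_real//; last 2 first.
- by apply: measurable_funD; [apply: measurable_funD; [exact: measurable_ball_powR|]|exact: measurable_ball_powR].
- by move=> y; rewrite !addr_ge0 ?ball_powR_ge0.
apply: lte_mul_pinfty => //.
rewrite ge0_integralD_real//; last 4 first.
- by apply: measurable_funD; [exact: measurable_ball_powR|].
- exact: measurable_ball_powR.
- by move=> y; rewrite addr_ge0 ?ball_powR_ge0.
- by move=> y; exact: ball_powR_ge0.
rewrite ge0_integralD_real//; last 3 first.
- exact: measurable_ball_powR.
- by move=> y; exact: ball_powR_ge0.
- by move=> y; exact: ball_powR_ge0.
apply: lte_add_pinfty; first apply: lte_add_pinfty.
- by apply: integral_ball_powR_lty; rewrite gtrBl.
- have mP : measurable_fun [set: 'rV[R]_N] (fun y => (ball_powR (N%:R + s * p - p) y)%:E).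
    by apply/measurable_EFinP; exact: measurable_ball_powR.
  have P0 (y : 'rV[R]_N) : (0 <= (ball_powR (N%:R + s * p - p) y)%:E)%E by rewrite lee_fin; exact: ball_powR_ge0.
  have <- : (\int[mu]_y (ball_powR (N%:R + s * p - p) y)%:E =
             \int[mu]_y (ball_powR (N%:R + s * p - p) (e - y))%:E)%E.
    rewrite (ge0_integral_rV_shift e mP P0); apply: ge0_integral_rV_opp => //.
    by apply/measurable_EFinP; rewrite /ball_powR; mfun.
  apply: integral_ball_powR_lty.
  by rewrite ltrBlDr ltrD2l gtr_pMl.
- by apply: integral_ball_powR_lty; rewrite ltr0n.
Qed.

(** The integrand is positive on a punctured ball. Positivity lets the finiteness of the Hardy term
    be read off from that of its product with the constant. *)
Lemma hardy_const_gt0 : (0 < @hardy_const R N s p)%E.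
Proof.
rewrite hardy_const_upto1 mule_gt0// lt_def hardy_const_upto_ge0 andbT.
apply/eqP => h.
have [A [mA A0 FA]] := integral_eq0_ae mF F0 h.
have := @rV_ball_gt0 R N (2^-1); rewrite invr_gt0 ltr0n => /(_ isT).
apply/negP; rewrite -leNgt -[leRHS](@measure0 _ _ _ mu).
have mZ : measurable [set (0 : 'rV[R]_N)].
  rewrite (_ : [set 0] = rV_ball 0); first exact: measurable_rV_ball.
  apply/seteqP; split => [x ->|x]; rewrite /rV_ball/= ?enorm0//.
  by rewrite le_eqVlt ltNge enorm_ge0 orbF enorm_eq0 => /eqP.
apply: (@le_trans _ _ (mu (A `|` [set 0]))); last first.
  have : (mu (A `|` [set 0%R]) <= mu A + mu [set 0%R])%E by exact: measureU2.
  by rewrite A0 lebesgueN_set0 adde0 measure0.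
apply: le_measure; rewrite ?inE.
- exact: measurable_rV_ball.
- exact: measurableU.
move=> y; rewrite /rV_ball /= => yh.
have [->|y0] := eqVneq y 0; [by right|left].
have y0' : 0 < enorm y by rewrite enorm_gt0.
have y1 : enorm y < 1 by apply: (le_lt_trans yh); rewrite invf_lt1// ltr1n.
apply: FA => /= Fy; suff : 0 < F y by rewrite Fy ltxx.
have /andP[ya0 ya1] := powR_al y0' y1.
rewrite /F y0' y1 !mul1r !mulr_gt0 ?powR_gt0 ?normr_gt0 ?subr_eq0 ?(gt_eqF ya1)//.
rewrite invr_gt0 powR_gt0//.
by apply: lt_le_trans (dist_ge y); rewrite subr_gt0.
Qed.
End hardy_constant.

Lemma enorm_le_coord {R : realType} n (x : 'rV[R]_n) (a : R) :
  (forall i, `|x 0 i| <= a) -> enorm x <= n%:R * a.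
Proof.
move=> xa; have [n0|n0] := posnP n.
  by move: x xa; rewrite n0 => x _; rewrite mul0r [x](_ : _ = 0) ?enorm0//; apply/rowP => -[].
have a0 : 0 <= a by apply: le_trans (xa (Ordinal n0)).
rewrite -ler_sqr ?nnegrE ?enorm_ge0 ?mulr_ge0// sqr_enorm.
apply: (@le_trans _ _ (\sum_(i < n) a ^+ 2)).
  by apply: ler_sum => i _; rewrite -expr2 -real_normK ?num_real// ler_sqr ?nnegrE.
rewrite sumr_const card_ord -[leLHS]mulr_natl exprMn ler_wpM2r ?sqr_ge0//.
by rewrite expr2 ler_peMl// ler1n.
Qed.

(** * Borel sets and test functions *)

Section rV_topology.
Context {R : realType} (n : nat).

Let cube (q : 'rV[rat]_n) (r : R) : set 'rV[R]_n :=
  [set x | forall i, `|ratr (q 0 i) - x 0 i| < r].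

(** An open set is the union of the rational cubes it contains: they are countably many, each
    measurable through its coordinates. *)
Lemma open_measurable_rV (U : set 'rV[R]_n) : open U -> measurable U.
Proof.
move=> oU.
pose F (z : 'rV[rat]_n * nat) : set 'rV[R]_n :=
  if pselect (cube z.1 z.2.+1%:R^-1 `<=` U) then cube z.1 z.2.+1%:R^-1 else set0.
have -> : U = \bigcup_z F z.
  apply/seteqP; split => [x Ux|x [z _]]; last by rewrite /F; case: pselect => // h /h.
  have /nbhs_ballP[e/= e0 eU] : nbhs x U by exact: open_nbhs_nbhs.
  (* Makes the half-width r = 1 / (k + 1) smaller than e / 2, so that a cube whose center is within
     r of x stays within e of x. *)
  pose k := Num.truncn (2 / e).
  pose r : R := k.+1%:R^-1.
  have r0 : 0 < r by rewrite invr_gt0.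
  have re : 2 * r < e.
    by rewrite -ltr_pdivlMr ?invr_gt0// invrK mulrC -ltr_pdivrMr// truncnS_gt.
  have Q i : exists q : rat, `|ratr q - x 0 i| < r.
    have [q] : exists q, ratr q \in `]x 0 i - r, x 0 i + r[.
      by apply: rat_in_itvoo; rewrite ltrD2l gtrN.
    by rewrite in_itv/= -ltr_distl => qx; exists q.
  have [q qx] := choice Q.
  have qU : cube (\row_i q i) r `<=` U.
    move=> y yq; apply: eU; split => // i j; rewrite ord1 /ball/=.
    rewrite (_ : x 0 j - y 0 j = - (ratr (q j) - x 0 j) + (ratr (q j) - y 0 j)); last by ring.
    apply: (le_lt_trans (ler_normD _ _)); apply: lt_trans re.
    rewrite normrN mulr_natl mulr2n ltrD//; have := yq j; by rewrite mxE.
  exists (\row_i q i, k) => //; rewrite /F/= -/r; case: pselect => // _ i.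
  by rewrite mxE.
apply: countable_bigcupT_measurable => [|z]; first exact: countableP.
rewrite /F; case: pselect => [h|h]; last exact: measurable0.
rewrite [X in measurable X](_ : _ = \bigcap_(i in [set: 'I_n])
   ((fun x : 'rV[R]_n => `|ratr (z.1 0 i) - x 0 i|) @^-1` `]-oo, z.2.+1%:R^-1[)); last first.
  apply/seteqP; split => [x xz i _|x xz i]; first by rewrite /= in_itv/=; exact: xz.
  by have := xz i I; rewrite /= in_itv.
apply: fin_bigcap_measurable => // i _; rewrite -[X in measurable X]setTI.
have : measurable_fun [set: 'rV[R]_n] (fun x : 'rV[R]_n => `|ratr (z.1 0 i) - x 0 i| : R).
  have mc := @measurable_rV_coord R n i.
  by apply: measurableT_comp => //; exact: measurable_funB.
by apply => //; exact: measurable_itv.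
Qed.

Lemma continuous_measurable_rV (f : 'rV[R]_n -> R) : continuous f -> measurable_fun [set: 'rV[R]_n] f.
Proof.
move=> /continuousP cf; apply: (measurability _ (RGenOpens.measurableE R)).
move=> _ [_ [a [b ->] <-]]; rewrite setTI; apply: open_measurable_rV.
exact/cf/interval_open.
Qed.
End rV_topology.

Section test_functions.
Context {R : realType} (n : nat).

Lemma Cc_infty_continuous (f : 'rV[R]_n -> R) : Cc_infty f -> continuous f.
Proof. by move=> [/(_ [::])[]]. Qed.

Lemma Cc_infty_bounded (f : 'rV[R]_n -> R) : Cc_infty f ->
  exists c r : R, [/\ 0 < c, 0 < r & forall x, `|f x| <= c * (enorm x <= r)%R%:R].
Proof.
move=> fC; have cf := Cc_infty_continuous fC; have [_ K] := fC.
have /compact_bounded[M [_ MK]] := K.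
have /compact_bounded[L [_ LK]] : compact (f @` closure [set x | f x != 0]).
  by apply: continuous_compact K; apply: continuous_subspaceT.
pose M1 := Num.max M 0 + 1; pose L1 := Num.max L 0 + 1.
have M1M : M < M1 by rewrite ltr_pwDr// le_max lexx.
have L1L : L < L1 by rewrite ltr_pwDr// le_max lexx.
have M10 : 0 < M1 by rewrite ltr_wpDl// le_max lexx orbT.
have L10 : 0 < L1 by rewrite ltr_wpDl// le_max lexx orbT.
exists L1, (n%:R * M1 + 1); split => //; first by rewrite ltr_wpDl// mulr_ge0// ltW.
move=> x; have [->|fx] := eqVneq (f x) 0; first by rewrite normr0 mulr_ge0// ltW.
have xK : closure [set x | f x != 0] x by exact: subset_closure.
suff -> : enorm x <= n%:R * M1 + 1.
  by rewrite mulr1; apply: (LK _ L1L); exists x.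
apply: (@le_trans _ _ (n%:R * M1)); last by rewrite lerDl.
apply: enorm_le_coord => i; apply: le_trans (MK _ M1M _ xK).
rewrite [leRHS]mx_normrE; exact: (le_bigmax _ (fun ij : 'I_1 * 'I_n => `|x ij.1 ij.2|) (0, i)).
Qed.
End test_functions.

Section bathtub.
Context {R : realType} (n : nat) (b : R).
Local Notation N := n.+1.
Local Notation mu := (@lebesgueN R N).
Hypotheses (b0 : 0 < b) (bN : b < N%:R).

(* Replacing the weight outside the ball of radius r by its value r^-b on the
   sphere gives the bound; the contribution of the ball is computed by scaling. *)
Lemma bathtub : exists2 K : R, 0 <= K & forall (i : 'rV[R]_N -> R) (r : R),
  measurable_fun [set: 'rV[R]_N] i -> (forall x, 0 <= i x <= 1) -> 0 < r ->
  (\int[mu]_x (i x * enorm x `^ (- b))%:E <=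
   (r `^ (- b))%:E * \int[mu]_x (i x)%:E + (K * r `^ (N%:R - b))%:E)%E.
Proof.
have me := @measurable_enorm R N.
pose K := (\int[mu]_y (ball_powR b y)%:E)%E.
have K0 : (0 <= K)%E by apply: ge0_integral_real => y; exact: ball_powR_ge0.
have KE : K = (fine K)%:E by rewrite fineK// ge0_fin_numE// integral_ball_powR_lty.
exists (fine K); first exact: fine_ge0.
move=> i r mi i01 r0.
have i0 x : 0 <= i x by have /andP[] := i01 x.
have mB : measurable_fun [set: 'rV[R]_N] (fun x => ball_powR b (r^-1 *: x)).
  by apply: measurableT_comp; [exact: measurable_ball_powR|mfun].
apply: (@le_trans _ _ (\int[mu]_x (r `^ (- b) * i x + r `^ (- b) * ball_powR b (r^-1 *: x))%:E)%E).
  apply: ge0_le_integral_real.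
  - by mfun.
  - by apply: measurable_funD; apply: measurable_funM.
  - by move=> x; rewrite mulr_ge0 ?powR_ge0.
  - move=> x; rewrite /ball_powR enormZ gtr0_norm ?invr_gt0//.
    have /andP[ix0 ix1] := i01 x.
    have [x0|x0] := eqVneq (enorm x) 0.
      rewrite x0 powR0 ?oppr_eq0 ?gt_eqF// mulr0 mulr0 ltxx !mul0r mulr0 addr0.
      by rewrite mulr_ge0 ?powR_ge0.
    have x0' : 0 < enorm x by rewrite lt_def x0 enorm_ge0.
    rewrite mulr_gt0 ?invr_gt0// mul1r ler_pdivrMl// mulr1.
    have [xr|xr] := leP (enorm x) r.
      rewrite mul1r powRM ?invr_ge0 ?(ltW r0) ?enorm_ge0// mulrA.
      have -> : r `^ (- b) * r^-1 `^ (- b) = 1.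
        rewrite -powRM ?invr_ge0 ?(ltW r0)// mulfV ?gt_eqF// powR1 //.
      rewrite mul1r -[leLHS]add0r; apply: lerD; first by rewrite mulr_ge0 ?powR_ge0.
      by rewrite ler_piMl ?powR_ge0.
    rewrite mul0r mulr0 addr0 mulrC ler_wpM2r// !powRN lef_pV2 ?posrE ?powR_gt0//.
    by rewrite ge0_ler_powR ?nnegrE ?(ltW b0) ?(ltW r0) ?(ltW xr)// ?enorm_ge0 ?ltW.
rewrite ge0_integralD_real//; last 4 first.
- exact: measurable_funM.
- exact: measurable_funM.
- by move=> x; rewrite mulr_ge0 ?powR_ge0.
- by move=> x; rewrite mulr_ge0 ?powR_ge0 ?ball_powR_ge0.
rewrite !ge0_integralZl_real ?powR_ge0//; last by move=> x; exact: ball_powR_ge0.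
apply: leeD => //.
rewrite (@ge0_integral_rV_scale R N (fun x => (ball_powR b (r^-1 *: x))%:E) r r0); last 2 first.
- exact/measurable_EFinP.
- by move=> x; rewrite lee_fin ball_powR_ge0.
under eq_integral do rewrite scalerA mulVf ?gt_eqF// scale1r.
rewrite -/K KE -!EFinM lee_fin mulrA [leRHS]mulrC ler_wpM2r ?fine_ge0//.
rewrite -powR_mulrn ?(ltW r0)// -powRD; last by rewrite (gt_eqF r0) implybT.
by rewrite addrC.
Qed.
End bathtub.

Lemma max0_subr_dist {R : realDomainType} (a c e : R) : 0 <= a -> 0 <= c -> c <= e ->
  `|a - Num.max 0 (a - c)| <= e.
Proof. by move=> a0 c0 ce; rewrite ler_norml /Num.max; case: ltP => h; apply/andP; split; lra. Qed.

Lemma dist_clip_le {R : realType} (a b c d : R) :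
  `|Num.max 0 (Num.min a c - d) - Num.max 0 (Num.min b c - d)| <= `|a - b|.
Proof.
wlog ba : a b / b <= a.
  move=> h; have [ba|/ltW ab] := leP b a; first exact: h.
  by rewrite distrC [leRHS]distrC; exact: h.
rewrite (ger0_norm (_ : 0 <= a - b)) ?subr_ge0// ler_norml.
rewrite /Num.max /Num.min; have [ac|ac] := ltP a c; have [bc|bc] := ltP b c;
  repeat match goal with |- context [if 0 < ?x then _ else _] =>
    have [?|?] := ltP 0 x end; apply/andP; split; lra.
Qed.

Lemma natr_bool01 {R : numDomainType} (b : bool) : 0 <= (b%:R : R) <= 1.
Proof. by case: b; rewrite ?lexx ?ler01. Qed.

(** * The Hardy inequality by truncation *)

Section hardy_inequality.
Context {R : realType} (n : nat) (s p : R).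
Local Notation N := n.+1.
Local Notation mu := (@lebesgueN R N).
Hypotheses (p2 : 2 <= p) (s0 : 0 < s) (s1 : s < 1) (sN : s * p < N%:R).
Implicit Types f : 'rV[R]_N -> R.

Let p0 : 0 < p. Proof. exact: lt_le_trans p2. Qed.
Let sp0 : 0 < s * p. Proof. by rewrite mulr_gt0. Qed.

(** Since i^p <= i, the energy is at most c^p times the integral of i |x|^{-sp}, which [bathtub]
    bounds at radius 1. *)
Lemma hardy_energy_bounded f (i : 'rV[R]_N -> R) (c : R) : measurable_fun [set: 'rV[R]_N] f ->
  measurable_fun [set: 'rV[R]_N] i -> (forall x, 0 <= i x <= 1) -> 0 <= c ->
  (forall x, `|f x| <= c * i x) -> (\int[mu]_x (i x)%:E < +oo)%E ->
  (hardy_energy s p f < +oo)%E.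
Proof.
move=> mf mi i01 c0 fi ioo; have [K K0 bt] := bathtub sp0 sN.
have me := @measurable_enorm R N.
have i0 x : 0 <= i x by have /andP[] := i01 x.
apply: (@le_lt_trans _ _ (\int[mu]_x (c `^ p * (i x * enorm x `^ (- (s * p))))%:E)%E).
  apply: ge0_le_integral_real.
  - by mfun.
  - by mfun.
  - by move=> x; rewrite mulr_ge0 ?powR_ge0.
  - move=> x; rewrite mulrA ler_wpM2r ?powR_ge0//.
    apply: (@le_trans _ _ ((c * i x) `^ p)).
      by rewrite ge0_ler_powR ?nnegrE ?mulr_ge0 ?(ltW p0).
    rewrite powRM// ler_wpM2l ?powR_ge0//; have /andP[_ ix1] := i01 x.
    have [->|ix] := eqVneq (i x) 0; first by rewrite powR0// gt_eqF.
    rewrite -[leRHS]powRr1// ger_powR//; first by rewrite lt_def ix i0.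
    by move: p2 => ?; lra.
rewrite ge0_integralZl_real ?powR_ge0//; last 2 first.
- by mfun.
- by move=> x; rewrite mulr_ge0 ?powR_ge0.
apply: lte_mul_pinfty; rewrite ?lee_fin ?powR_ge0//.
apply: (le_lt_trans (bt i 1 mi i01 ltr01)).
rewrite !powR1 mul1e; apply: lte_add_pinfty => //; exact: ltry.
Qed.

(** Capping |f| at k + 1 makes it bounded; lowering by 1 / (k + 1) confines it to the set where |f|
    > 1 / (k + 1), of finite measure when a power of |f| is integrable. As a 1-Lipschitz image of f
    it does not increase the seminorm. *)
Let trunc f (k : nat) (x : 'rV[R]_N) : R :=
  Num.max 0 (Num.min `|f x| k.+1%:R - k.+1%:R^-1).

Let trunc_ge0 f k x : 0 <= trunc f k x.
Proof. by rewrite /trunc le_max lexx. Qed.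

Let trunc_lip f k x y : `|trunc f k x - trunc f k y| <= `|f x - f y|.
Proof.
exact: le_trans (dist_clip_le _ _ _ _) (ler_dist_dist (f x) (f y)).
Qed.

Let measurable_trunc f k : measurable_fun [set: 'rV[R]_N] f -> measurable_fun [set: 'rV[R]_N] (trunc f k).
Proof.
move=> mf; apply: measurable_maxr => //; apply: measurable_funB => //.
by apply: measurable_minr => //; apply: measurableT_comp.
Qed.

(** [hardy_remainder] presupposes a finite Hardy term, which each truncation has; the resulting
    bound is uniform in k and passes to the limit by monotone convergence. *)
Lemma hardy_inequality f (q : R) : 0 < q -> measurable_fun [set: 'rV[R]_N] f ->
  (\int[mu]_x (`|f x| `^ q)%:E < +oo)%E -> (@gagliardo R N s p f < +oo)%E ->
  (hardy_energy s p f < +oo)%E.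
Proof.
move=> q0 mf fq gf.
have me := @measurable_enorm R N.
have mt k := measurable_trunc k mf.
have C0 := hardy_const_gt0 p2 sN.
have Cf : @hardy_const R N s p \is a fin_num.
  by rewrite ge0_fin_numE ?ltW// hardy_const_lty.
have Hk k : (@hardy_const R N s p * hardy_energy s p (trunc f k) <= @gagliardo R N s p f)%E.
  pose i x : R := (k.+1%:R^-1 < `|f x|)%R%:R.
  have mi : measurable_fun [set: 'rV[R]_N] i by rewrite /i; mfun.
  have k0 : 0 < k.+1%:R^-1 :> R by rewrite invr_gt0.
  have Hoo : (hardy_energy s p (trunc f k) < +oo)%E.
    apply: (@hardy_energy_bounded (trunc f k) i k.+1%:R) => //.
    - by move=> x; rewrite /i; case: (_ < _); rewrite ?lexx ?ler01.
    - move=> x; rewrite ger0_norm// /trunc ge_max mulr_ge0//= /i; case: ltP => h.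
        rewrite mulr1 lerBlDr ge_min lerDl (ltW k0) orbT//.
      by rewrite mulr0 subr_le0 ge_min h.
    - apply: (@le_lt_trans _ _ (\int[mu]_x (k.+1%:R `^ q * `|f x| `^ q)%:E)%E).
        apply: ge0_le_integral_real => //.
        + by mfun.
        + move=> x; rewrite /i -powRM//; case: ltP => h; last by rewrite powR_ge0.
          rewrite -[leLHS](congr1 (fun g : R -> R => g q) (@powR1 R)).
          rewrite ge0_ler_powR ?nnegrE ?mulr_ge0 ?(ltW q0)//.
          by rewrite -ler_pdivrMl// mulr1 ltW.
      rewrite ge0_integralZl_real ?powR_ge0//; last by mfun.
      by apply: lte_mul_pinfty; rewrite ?lee_fin ?powR_ge0.
  have h := hardy_remainder p2 s0 sN (mt k) Hoo.
  apply: le_trans (le_trans h _).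
    by apply: leeDr; apply: mule_ge0; [|exact: (hardy_rem_integral_ge0 p2 sN (trunc f k) (lexx 1))].
  have mg (g : 'rV[R]_N -> R) : measurable_fun [set: 'rV[R]_N] g ->
      measurable_fun [set: 'rV[R]_N * 'rV[R]_N]
      (fun z => `|g z.1 - g z.2| `^ p / enorm (z.1 - z.2) `^ (N%:R + s * p)).
    move=> mg.
    have mg1 := measurableT_comp mg (@measurable_fst _ _ [the measurableType _ of 'rV[R]_N] [the measurableType _ of 'rV[R]_N]).
    have mg2 := measurableT_comp mg (@measurable_snd _ _ [the measurableType _ of 'rV[R]_N] [the measurableType _ of 'rV[R]_N]).
    by mfun.
  apply: (@le_integral2_real _ _ _ _ _ mu mu
    (fun x y => `|trunc f k x - trunc f k y| `^ p / enorm (x - y) `^ (N%:R + s * p))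
    (fun x y => `|f x - f y| `^ p / enorm (x - y) `^ (N%:R + s * p))
    (mg _ (mt k)) (mg _ mf)) => x y.
    by rewrite mulr_ge0 ?invr_ge0 ?powR_ge0.
  rewrite ler_wpM2r ?invr_ge0 ?powR_ge0// ge0_ler_powR ?nnegrE ?(ltW p0)//.
have cv : (hardy_energy s p (trunc f k) @[k --> \oo] --> hardy_energy s p f)%E.
  apply: cvg_integral_nondecreasing => [k|k x|x i j ij|x].
  - by apply/measurable_EFinP; have mtk := mt k; mfun.
  - by rewrite lee_fin mulr_ge0 ?powR_ge0.
  - rewrite lee_fin ler_wpM2r ?powR_ge0// ge0_ler_powR ?nnegrE ?(ltW p0)//.
    rewrite !ger0_norm// /trunc ge_max le_max lexx/= le_max; apply/orP; right.
    have h1 : i.+1%:R <= j.+1%:R :> R by rewrite ler_nat.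
    have h2 : j.+1%:R^-1 <= i.+1%:R^-1 :> R by rewrite lef_pV2 ?posrE.
    apply: lerB => //; rewrite le_min ge_min lexx/= ge_min h1 orbT//.
  - apply: cvg_EFin; first exact: nearW.
    apply: cvgMr_tmp.
    have cv : trunc f k x @[k --> \oo] --> `|f x|.
      apply/cvgrPdist_le => e e0; near=> k.
      have h1 : k.+1%:R^-1 <= e by apply/ltW; near: k; exact: (near_infty_natSinv_lt (PosNum e0)).
      have h2 : `|f x| <= k.+1%:R.
        near: k; exists (Num.truncn `|f x|) => // j /= jk.
        by apply: le_trans (ltW (truncnS_gt _)) _; rewrite ler_nat.
      rewrite /trunc; have -> : Num.min `|f x| k.+1%:R = `|f x| by apply/min_idPl.
      have k0 : 0 < k.+1%:R^-1 :> R by rewrite invr_gt0.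
      by apply: max0_subr_dist => //; exact: ltW.
    under eq_fun do rewrite (ger0_norm (trunc_ge0 _ _ _)).
    have [fx0|fx0] := eqVneq (f x) 0.
      apply: cvg_near_cst; apply: nearW => k; congr (_ `^ _).
      by rewrite /trunc fx0 normr0 min_l// sub0r max_l// oppr_le0.
    have fx : 0 < `|f x| by rewrite normr_gt0.
    have cp : {for `|f x|, continuous (fun a : R => a `^ p)}.
      apply: differentiable_continuous; apply/derivable1_diffP.
      by case: (is_derive1_powR p fx).
    exact: (cvg_comp _ _ cv cp).
have h : (@hardy_const R N s p * hardy_energy s p f <= @gagliardo R N s p f)%E.
  by apply: (cvge_le _ (cvgeZl Cf cv)); exact: nearW.
rewrite ltey; apply/eqP => Hoo; move: h; rewrite Hoo gt0_muley// leNgt.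
by rewrite gf.
Unshelve. all: by end_near. Qed.
End hardy_inequality.

Lemma integral_boolE {R : realType} d (T : measurableType d) (m : {measure set T -> \bar R})
  (P : T -> bool) : measurable [set x | P x] ->
  (\int[m]_x ((P x)%:R : R)%:E = m [set x | P x])%E.
Proof.
move=> mP; rewrite -[in RHS](setIT [set x | P x]) -integral_indic//.
apply: eq_integral => x _; rewrite indicE; congr (_%:R)%:E.
by have [px|/negP px] := boolP (P x); [rewrite mem_set|rewrite memNset].
Qed.

Lemma powR_normD_le {R : realType} (a b q : R) : 0 <= q ->
  `|a + b| `^ q <= 2 `^ q * (`|a| `^ q + `|b| `^ q).
Proof.
move=> q0; rewrite mulrDr -!powRM//.
have [ab|ab] := leP `|a| `|b|.
  rewrite -[leLHS]add0r; apply: lerD; first exact: powR_ge0.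
  rewrite ge0_ler_powR ?nnegrE ?mulr_ge0//; apply: le_trans (ler_normD _ _) _.
  by rewrite mulr_natl mulr2n lerD2r.
rewrite -[leLHS]addr0; apply: lerD; last exact: powR_ge0.
rewrite ge0_ler_powR ?nnegrE ?mulr_ge0//; apply: le_trans (ler_normD _ _) _.
by rewrite mulr_natl mulr2n lerD2l ltW.
Qed.

(** * Finiteness for functions of the Sobolev space *)

Section dotW_finite.
Context {R : realType} (n : nat) (s p : R).
Local Notation N := n.+1.
Local Notation mu := (@lebesgueN R N).
Local Notation P := (@sobolev_exp R N s p).
Hypotheses (p2 : 2 <= p) (s0 : 0 < s) (s1 : s < 1) (sN : s * p < N%:R).

Let p0 : 0 < p. Proof. exact: lt_le_trans p2. Qed.

Lemma sobolev_exp_gt0 : 0 < P.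
Proof. by rewrite divr_gt0 ?mulr_gt0 ?ltr0n ?subr_gt0. Qed.

(** Write u = (u - phi k) + phi k with k so large that the difference has finite seminorm and finite
    L^P norm: [hardy_inequality] handles the difference, while the test function is bounded with
    bounded support. *)
Lemma dotW_finite (u : 'rV[R]_N -> R) : dotW s p u ->
  (hardy_energy s p u < +oo)%E /\ (\int[mu]_x (`|u x| `^ P)%:E < +oo)%E.
Proof.
move=> [mu_ [phi [phiC /fine_cvgP[cg _] /fine_cvgP[cL _]]]].
have [k [gk Lk]] : exists k, @gagliardo R N s p (u \- phi k) \is a fin_num /\
    Lnorm mu P%:E (EFin \o (u \- phi k)) \is a fin_num.
  near \oo => k; exists k; split; near: k; [exact: cg|exact: cL].
have P0 := sobolev_exp_gt0.
have mphi : measurable_fun [set: 'rV[R]_N] (phi k).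
  exact: continuous_measurable_rV (Cc_infty_continuous (phiC k)).
have mf : measurable_fun [set: 'rV[R]_N] (u \- phi k) by exact: measurable_funB.
set f := u \- phi k in gk Lk mf.
have fP : (\int[mu]_x (`|f x| `^ P)%:E < +oo)%E.
  have := fin_num_poweR P Lk; rewrite poweR_Lnorm ?gt_eqF//.
  have -> : (\int[mu]_x (`|(EFin \o f) x| `^ P) = \int[mu]_x (`|f x| `^ P)%:E)%E by [].
  by rewrite ge0_fin_numE// ge0_integral_real// => x; exact: powR_ge0.
have Hf : (hardy_energy s p f < +oo)%E.
  apply: (hardy_inequality p2 s0 s1 sN P0 mf fP).
  by rewrite -ge0_fin_numE//; apply: integral_ge0 => x _; apply: integral_ge0 => y _;
    rewrite lee_fin mulr_ge0 ?invr_ge0 ?powR_ge0.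
have [c [r [c0 r0 phi_le]]] := Cc_infty_bounded (phiC k).
pose i (x : 'rV[R]_N) : R := (enorm x <= r)%R%:R.
have me := @measurable_enorm R N.
have mi : measurable_fun [set: 'rV[R]_N] i by rewrite /i; mfun.
have i01 x : 0 <= i x <= 1 by exact: natr_bool01.
have i0 x : 0 <= i x by have /andP[] := i01 x.
have ioo : (\int[mu]_x (i x)%:E < +oo)%E.
  rewrite /i integral_boolE; first exact: rV_ball_lty.
  exact: measurable_rV_ball.
have Hphi : (hardy_energy s p (phi k) < +oo)%E.
  exact: (hardy_energy_bounded p2 s0 sN mphi mi i01 (ltW c0) phi_le ioo).
have phiP : (\int[mu]_x (`|phi k x| `^ P)%:E < +oo)%E.
  apply: (@le_lt_trans _ _ (\int[mu]_x (c `^ P * i x)%:E)%E).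
    apply: ge0_le_integral_real.
    - by mfun.
    - by mfun.
    - by move=> x; exact: powR_ge0.
    - move=> x; have := phi_le x; rewrite -/(i x) /i; case: (_ <= r) => h.
        by rewrite mulr1 ge0_ler_powR ?nnegrE ?(ltW P0) ?(ltW c0)//; rewrite mulr1 in h.
      move: h; rewrite !mulr0 normr_le0 => /eqP ->.
      by rewrite normr0 powR0// gt_eqF.
  rewrite ge0_integralZl_real ?powR_ge0//.
  by apply: lte_mul_pinfty; rewrite ?lee_fin ?powR_ge0.
have ufE x : u x = f x + phi k x by rewrite /f/= subrK.
split.
  apply: (@le_lt_trans _ _ (\int[mu]_x (2 `^ p * (`|f x| `^ p * enorm x `^ (- (s * p)) +
      `|phi k x| `^ p * enorm x `^ (- (s * p))))%:E)%E).
    apply: ge0_le_integral_real.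
    - by mfun.
    - by mfun.
    - by move=> x; rewrite mulr_ge0 ?powR_ge0.
    - move=> x; rewrite -mulrDl mulrA ler_wpM2r ?powR_ge0// ufE.
      exact: powR_normD_le (ltW p0).
  rewrite ge0_integralZl_real ?powR_ge0//; last 2 first.
  - by mfun.
  - by move=> x; rewrite addr_ge0 ?mulr_ge0 ?powR_ge0.
  apply: lte_mul_pinfty; rewrite ?lee_fin ?powR_ge0//.
  rewrite ge0_integralD_real; last 4 first.
  - by mfun.
  - by mfun.
  - by move=> x; rewrite mulr_ge0 ?powR_ge0.
  - by move=> x; rewrite mulr_ge0 ?powR_ge0.
  exact: lte_add_pinfty Hf Hphi.
apply: (@le_lt_trans _ _ (\int[mu]_x (2 `^ P * (`|f x| `^ P + `|phi k x| `^ P))%:E)%E).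
  apply: ge0_le_integral_real.
  - by mfun.
  - by mfun.
  - by move=> x; rewrite powR_ge0.
  - by move=> x; rewrite ufE; exact: powR_normD_le (ltW P0).
rewrite ge0_integralZl_real ?powR_ge0//; last by mfun.
apply: lte_mul_pinfty; [exact: powR_ge0|by []|].
rewrite ge0_integralD_real; last 4 first.
- by mfun.
- by mfun.
- by move=> x; rewrite powR_ge0.
- by move=> x; rewrite powR_ge0.
exact: lte_add_pinfty fP phiP.
Unshelve. all: by end_near. Qed.
End dotW_finite.

(** * Averaging over dilation shells *)

Section double_integrals.
Context {R : realType} d1 d2 (T1 : measurableType d1) (T2 : measurableType d2)
  (m1 : {sigma_finite_measure set T1 -> \bar R})
  (m2 : {sigma_finite_measure set T2 -> \bar R}).
Implicit Types f g : T1 -> T2 -> R.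

Lemma integral2D_real f g :
  measurable_fun [set: T1 * T2] (fun z => f z.1 z.2) ->
  measurable_fun [set: T1 * T2] (fun z => g z.1 z.2) ->
  (forall x y, 0 <= f x y) -> (forall x y, 0 <= g x y) ->
  (\int[m1]_x \int[m2]_y (f x y + g x y)%:E =
   \int[m1]_x \int[m2]_y (f x y)%:E + \int[m1]_x \int[m2]_y (g x y)%:E)%E.
Proof.
move=> mf mg f0 g0; rewrite -ge0_integralD//; last 4 first.
- by move=> x _; exact: ge0_integral_real.
- exact: measurable_integral_real.
- by move=> x _; exact: ge0_integral_real.
- exact: measurable_integral_real.
apply: eq_integral => x _; rewrite ge0_integralD_real//.
- exact: measurable_section2 mf.
- exact: measurable_section2 mg.
Qed.

Lemma integral2Z_real (c : R) f : 0 <= c ->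
  measurable_fun [set: T1 * T2] (fun z => f z.1 z.2) -> (forall x y, 0 <= f x y) ->
  (\int[m1]_x \int[m2]_y (c * f x y)%:E = c%:E * \int[m1]_x \int[m2]_y (f x y)%:E)%E.
Proof.
move=> c0 mf f0; rewrite -ge0_integralZl//; last 2 first.
- exact: measurable_integral_real.
- by move=> x _; exact: ge0_integral_real.
apply: eq_integral => x _; rewrite ge0_integralZl_real//.
exact: measurable_section2 mf.
Qed.
End double_integrals.

Lemma lebesgueN_ballE {R : realType} n (r : R) : 0 < r ->
  lebesgueN n.+1 (rV_ball r) = (r ^+ n.+1 * @rV_unit_ball_vol R n.+1)%:E.
Proof.
move=> r0; rewrite EFinM -rV_unit_ball_volE.
rewrite -!integral_rV_ball.
have me := @measurable_enorm R n.+1.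
rewrite (ge0_integral_rV_scale r0).
- congr (_ * _)%E; apply: eq_integral => x _; rewrite enormZ gtr0_norm//.
  by rewrite -ler_pdivlMl// mulVf// gt_eqF.
- by apply/measurable_EFinP; mfun.
- by move=> x; rewrite lee_fin.
Qed.

Section shells.
Context {R : realType} (n : nat) (q : R).
Local Notation N := n.+1.
Local Notation mu := (@lebesgueN R N).
Local Notation e := (delta_mx 0 0 : 'rV[R]_N).
Hypothesis q1 : 1 < q.

(* The density of nu x nu, where d nu = |x|^-N dx is dilation-invariant. *)
Definition dilation_kernel (x y : 'rV[R]_N) : R := enorm x `^ (- N%:R) * enorm y `^ (- N%:R).
(** For r = |y| / |x|, the bound q < r keeps t = (|x| / |y|)^al away from 1, where the constant of
    [jensen_gap_ge] degenerates; the bound r <= q^2 keeps t away from 0 and the kernel comparable to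
    a power of |x|. *)
Definition shell_ind (r : R) : R := (q < r)%R%:R * (r <= q ^+ 2)%R%:R.
Local Notation k2 := dilation_kernel.
Local Notation F := shell_ind.

Definition shell_mass : \bar R := (\int[mu]_y (F (enorm y) * k2 e y)%:E)%E.

Let q0 : 0 < q. Proof. exact: lt_trans q1. Qed.

Lemma shell_ind_ge0 r : 0 <= F r.
Proof. by rewrite mulr_ge0. Qed.

Lemma shell_ind0 : F 0 = 0.
Proof. by rewrite /F [q < 0]ltNge (ltW q0) mul0r. Qed.

Lemma measurable_shell_ind : measurable_fun [set: R] F.
Proof. by rewrite /F; mfun. Qed.

Lemma dilation_kernel_ge0 x y : 0 <= k2 x y.
Proof. by rewrite mulr_ge0 ?powR_ge0. Qed.

Lemma measurable_dilation_kernel :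
  measurable_fun [set: 'rV[R]_N * 'rV[R]_N] (fun z => k2 z.1 z.2).
Proof. by have me := @measurable_enorm R N; rewrite /k2; mfun. Qed.

Let k2C x y : k2 x y = k2 y x. Proof. by rewrite /k2 mulrC. Qed.

Let k2Z (c : R) x y : 0 < c -> k2 (c *: x) (c *: y) = c `^ (- (N%:R + N%:R)) * k2 x y.
Proof.
move=> c0; rewrite /k2 !enormZ !gtr0_norm// !powRM ?enorm_ge0 ?(ltW c0)//.
rewrite opprD powRD; last by rewrite (gt_eqF c0) implybT.
by ring.
Qed.

Let k2O T x y : rV_isometry T -> k2 (T x) (T y) = k2 x y.
Proof. by move=> [_ _ _ Te]; rewrite /k2 !Te. Qed.

Let N0 : 0 < N%:R :> R. Proof. by rewrite ltr0n. Qed.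

(** The kernel has degree -(N + N), so g = N and the inversion introduces no weight: the outward
    shell and its inverse have the same mass. *)
Let shell_mass_inv : (\int[mu]_y (F (enorm y)^-1 * k2 e y)%:E = shell_mass)%E.
Proof.
rewrite /shell_mass (@homogeneous_kernel_inversion R n k2 N%:R N0 dilation_kernel_ge0
  measurable_dilation_kernel k2C k2Z k2O F measurable_shell_ind shell_ind_ge0 shell_ind0).
apply: eq_integral => y _; congr EFin; rewrite subrr powRr0 mulr1//.
Qed.

Let mF2 : measurable_fun [set: 'rV[R]_N * 'rV[R]_N] (fun z => F (enorm z.2 / enorm z.1)).
Proof. by have me := @measurable_enorm R N; rewrite /shell_ind; mfun. Qed.

Let mFk : measurable_fun [set: 'rV[R]_N * 'rV[R]_N]
  (fun z => F (enorm z.2 / enorm z.1) * k2 z.1 z.2).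
Proof. by apply: measurable_funM => //; exact: measurable_dilation_kernel. Qed.

Lemma shell_integral_l (i : 'rV[R]_N -> R) : measurable_fun [set: 'rV[R]_N] i ->
  (forall x, 0 <= i x) ->
  (\int[mu]_x \int[mu]_y (i x * (F (enorm y / enorm x) * k2 x y))%:E =
   shell_mass * \int[mu]_x (i x * enorm x `^ (- N%:R))%:E)%E.
Proof.
move=> mi i0; have me := @measurable_enorm R N.
rewrite -ge0_integralZl//; last 3 first.
- by apply/measurable_EFinP; mfun.
- by move=> x _; rewrite lee_fin mulr_ge0 ?powR_ge0.
- by apply: ge0_integral_real => y; rewrite mulr_ge0 ?shell_ind_ge0 ?dilation_kernel_ge0.
have mk := measurable_dilation_kernel.
apply: eq_integral => x _; rewrite ge0_integralZl_real//; last 2 first.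
- exact: (measurable_section2 (f := fun x y => F (enorm y / enorm x) * k2 x y) x mFk).
- by move=> y; rewrite mulr_ge0 ?shell_ind_ge0 ?dilation_kernel_ge0.
rewrite (@homogeneous_kernel_integral R n k2 N%:R N0 dilation_kernel_ge0
  measurable_dilation_kernel k2Z k2O F x measurable_shell_ind shell_ind_ge0 shell_ind0).
by rewrite -/shell_mass EFinM muleA [LHS]muleC.
Qed.

(** For fixed y, the points x form the inward shell; by [shell_mass_inv] the constant is the same as
    in [shell_integral_l]. This equality is what makes the cancellation in [annulus_le] exact. *)
Lemma shell_integral_r (i : 'rV[R]_N -> R) : measurable_fun [set: 'rV[R]_N] i ->
  (forall x, 0 <= i x) ->
  (\int[mu]_x \int[mu]_y (i y * (F (enorm y / enorm x) * k2 x y))%:E =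
   shell_mass * \int[mu]_x (i x * enorm x `^ (- N%:R))%:E)%E.
Proof.
move=> mi i0; have me := @measurable_enorm R N.
have mk := measurable_dilation_kernel.
have mi2 := measurableT_comp mi (@measurable_snd _ _ [the measurableType _ of 'rV[R]_N] [the measurableType _ of 'rV[R]_N]).
have mH : measurable_fun [set: 'rV[R]_N * 'rV[R]_N]
    (fun z => i z.2 * (F (enorm z.2 / enorm z.1) * k2 z.1 z.2)).
  by apply: measurable_funM => //; exact: measurable_funM.
rewrite (@tonelli_real _ _ _ _ _ mu mu (fun x y => i y * (F (enorm y / enorm x) * k2 x y)) mH); last first.
  by move=> x y; rewrite !mulr_ge0 ?powR_ge0.
rewrite -ge0_integralZl//; last 3 first.
- by apply/measurable_EFinP; mfun.
- by move=> x _; rewrite lee_fin mulr_ge0 ?powR_ge0.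
- by apply: ge0_integral_real => y; rewrite mulr_ge0 ?shell_ind_ge0 ?dilation_kernel_ge0.
apply: eq_integral => y _; rewrite ge0_integralZl_real//; last 2 first.
- exact: (measurable_section1 (f := fun x y => F (enorm y / enorm x) * k2 x y) y mFk).
- by move=> x; rewrite mulr_ge0 ?shell_ind_ge0 ?dilation_kernel_ge0.
have mFV : measurable_fun [set: R] (fun r : R => F r^-1) by rewrite /F; mfun.
have F0V : F 0^-1 = 0 by rewrite invr0 shell_ind0.
have := @homogeneous_kernel_integral R n k2 N%:R N0 dilation_kernel_ge0
  measurable_dilation_kernel k2Z k2O (fun r => F r^-1) y mFV (fun r => shell_ind_ge0 _) F0V.
rewrite shell_mass_inv => h.
have E x : F (enorm y / enorm x) * k2 x y = F (enorm x / enorm y)^-1 * k2 y x.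
  by rewrite invf_div k2C.
under eq_integral do rewrite E.
by rewrite h EFinM muleA [LHS]muleC.
Qed.

Let enorm_e : enorm e = 1 :> R. Proof. exact: enorm_delta. Qed.

Let k2e y : k2 e y = enorm y `^ (- N%:R).
Proof. by rewrite /k2 enorm_e powR1 mul1r. Qed.

Let A : set 'rV[R]_N := rV_ball (q ^+ 2) `\` rV_ball q.

Let mA : measurable A.
Proof. by apply: measurableD; exact: measurable_rV_ball. Qed.

Let ind_A y : F (enorm y) = (y \in A)%:R.
Proof.
rewrite /F -natrM mulnb; congr (_%:R); congr nat_of_bool.
have [yA|yA] := pselect (A y).
  rewrite mem_set//; move: yA => [h1 /negP]; rewrite /rV_ball/= -ltNge => ->.
  by rewrite h1.
rewrite memNset//; apply/negbTE/negP => /andP[h1 h2]; apply: yA; split => //.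
by apply/negP; rewrite /rV_ball/= -ltNge.
Qed.

Let intA (c : R) : 0 <= c -> (\int[mu]_y (c * F (enorm y))%:E = c%:E * mu A)%E.
Proof.
move=> c0; rewrite ge0_integralZl_real//; last 2 first.
- by have me := @measurable_enorm R N; have mF := measurable_shell_ind; mfun.
- by move=> y; exact: shell_ind_ge0.
congr (_ * _)%E; rewrite -[in RHS](setIT A) -integral_indic//.
by apply: eq_integral => y _; rewrite ind_A indicE.
Qed.

Let mA_lty : (mu A < +oo)%E.
Proof.
apply: le_lt_trans (@rV_ball_lty R N (q ^+ 2)); apply: le_measure; rewrite ?inE//.
  exact: measurable_rV_ball.
by move=> y [].
Qed.

Let mA_gt0 : (0 < mu A)%E.
Proof.
rewrite lt_def measure_ge0 andbT; apply/eqP => A0.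
have h : (mu (rV_ball (q ^+ 2)) <= mu (rV_ball q))%E.
  apply: (@le_trans _ _ (mu (A `|` rV_ball q))).
    apply: le_measure; rewrite ?inE; [exact: measurable_rV_ball| |].
      by apply: measurableU => //; exact: measurable_rV_ball.
    by move=> y h; have [h'|h'] := pselect (rV_ball q y); [right|left].
  have : (mu (A `|` rV_ball q) <= mu A + mu (rV_ball q))%E.
    by apply: measureU2 => //; exact: measurable_rV_ball.
  by rewrite A0 add0r.
move: h; rewrite (lebesgueN_ballE _ q0) (lebesgueN_ballE _ (exprn_gt0 2 q0)).
apply/negP; rewrite -ltNge lte_fin ltr_pM2r ?rV_unit_ball_vol_gt0//.
rewrite -exprM ltr_eXn2l ?mul2n -?addnn//.
by rewrite -[X in (X < _)%N]addn0 ltn_add2l.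
Qed.

Lemma shell_mass_gt0 : (0 < shell_mass)%E.
Proof.
apply: (@lt_le_trans _ _ (\int[mu]_y ((q ^+ 2) `^ (- N%:R) * F (enorm y))%:E)%E).
  rewrite intA; last exact: powR_ge0.
  by apply: mule_gt0; [rewrite lte_fin powR_gt0// exprn_gt0|exact: mA_gt0].
have me := @measurable_enorm R N; have mF := measurable_shell_ind.
apply: ge0_le_integral_real.
- by mfun.
- by rewrite /dilation_kernel; mfun.
- by move=> y; exact: mulr_ge0 (powR_ge0 _ _) (shell_ind_ge0 _).
- move=> y; rewrite mulrC k2e /F; have [y1|] := ltP q (enorm y); last by rewrite !mul0r.
  have [y2|] := leP (enorm y) (q ^+ 2); last by rewrite mulr0 !mul0r.
  have y0 : 0 < enorm y by exact: lt_trans y1.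
  rewrite !mul1r !powRN lef_pV2 ?posrE ?powR_gt0// ?exprn_gt0//.
  by rewrite ge0_ler_powR ?nnegrE ?enorm_ge0 ?exprn_ge0 ?(ltW q0).
Qed.

Lemma shell_mass_lty : (shell_mass < +oo)%E.
Proof.
apply: (@le_lt_trans _ _ (\int[mu]_y (1 * F (enorm y))%:E)%E); last first.
  by rewrite intA ?ler01// mul1e; exact: mA_lty.
have me := @measurable_enorm R N; have mF := measurable_shell_ind.
apply: ge0_le_integral_real.
- by rewrite /dilation_kernel; mfun.
- by mfun.
- by move=> y; rewrite mulr_ge0 ?shell_ind_ge0 ?dilation_kernel_ge0.
- move=> y; rewrite mulrC k2e /F; have [y1|] := ltP q (enorm y); last by rewrite !mul0r !mulr0.
  rewrite ler_wpM2r ?mulr_ge0// powRN invf_le1.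
    rewrite -[leLHS](congr1 (fun f : R -> R => f N%:R) (@powR1 R)).
    by rewrite ge0_ler_powR ?nnegrE ?enorm_ge0// (le_trans (ltW q1))// ltW.
  by rewrite powR_gt0// (lt_trans q0).
Qed.
End shells.

(** The shape of the pointwise estimate on shells: i and j are indicators, g is the shell weight, a
    and b are p-th powers, d is a squared oscillation and z is the remainder. *)
Lemma annulus_algebra {F : realFieldType} (i j g a b d c tau z : F) :
  0 < tau -> 0 < c -> 0 <= i <= 1 -> 0 <= g -> 0 <= a -> 0 <= b -> 0 <= d ->
  i * g <= j * g -> a <= b + tau / 2 * d + tau^-1 * (a + b) -> g * (c / 2 * d) <= z ->
  i * a * g <= j * b * g + (tau / c * z + tau^-1 * (a * g + b * g)).
Proof.
move=> tau0 c0 /andP[i0 i1] g0 a0 b0 d0 ij h gz.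
have ti0 : 0 <= tau^-1 by rewrite invr_ge0 ltW.
have tc0 : 0 <= tau / c by rewrite divr_ge0// ltW.
have r0 : 0 <= tau / 2 * d + tau^-1 * (a + b).
  by rewrite addr_ge0// ?mulr_ge0 ?addr_ge0// ?(ltW tau0)// invr_ge0.
apply: (@le_trans _ _ (i * g * b + g * (tau / 2 * d + tau^-1 * (a + b)))).
  have -> : i * a * g = i * g * a by rewrite mulrAC.
  apply: (@le_trans _ _ (i * g * (b + (tau / 2 * d + tau^-1 * (a + b))))).
    by rewrite ler_wpM2l ?mulr_ge0// addrA.
  by rewrite mulrDr lerD2l -mulrA; apply: ler_piMl => //; exact: mulr_ge0.
apply: lerD; first by rewrite [leRHS]mulrAC ler_wpM2r.
have -> : tau^-1 * (a * g + b * g) = g * (tau^-1 * (a + b)) by ring.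
rewrite mulrDr lerD2r.
have -> : g * (tau / 2 * d) = tau / c * (g * (c / 2 * d)) by field; rewrite gt_eqF.
by rewrite ler_wpM2l.
Qed.

Lemma annulus_chain {R : realType} (f1 g f2 h g3 g45 f3 f45 f4 f5 e b j0 j1 w : \bar R) (c d : R) :
  (f1 <= g -> g = f2 + h -> h = g3 + g45 -> g3 = c%:E * f3 -> g45 = d%:E * f45 ->
   f45 = f4 + f5 -> f3 = e -> f1 = b * j0 -> f2 = b * j1 -> f4 = b * w -> f5 = b * w ->
   b * j0 <= b * j1 + (c%:E * e + d%:E * (b * w + b * w)))%E.
Proof. by move=> + gE hE g3E g45E f45E f3E f1E f2E f4E f5E;
  rewrite gE hE g3E g45E f45E f3E f1E f2E f4E f5E. Qed.

Lemma annulus_rescale {F : realFieldType} (tau c b e h i j : F) : 0 < tau -> 0 < c -> 0 < b ->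
  b * (i + j) <= b * j + (tau / c * e + tau^-1 * (b * h + b * h)) ->
  b * i <= b * (tau * (c^-1 / b * e) + tau^-1 * (2 * h)).
Proof.
move=> t0 c0 b0; rewrite mulrDr [b * i + _]addrC lerD2l => /le_trans; apply.
rewrite le_eqVlt; apply/orP; left; apply/eqP; field.
by rewrite !gt_eqF.
Qed.

(** * The Hardy energy of an annulus *)

Section annulus.
Context {R : realType} (n : nat) (s p q : R).
Local Notation N := n.+1.
Local Notation mu := (@lebesgueN R N).
Local Notation al := ((N%:R - s * p) / p).
Hypotheses (p2 : 2 <= p) (s0 : 0 < s) (sN : s * p < N%:R) (q1 : 1 < q).
Local Notation k := (riesz_kernel s p).
Local Notation k2 := dilation_kernel.
Local Notation F := (shell_ind q).
Variable u : 'rV[R]_N -> R.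
Hypothesis mu_ : measurable_fun [set: 'rV[R]_N] u.

Let p0 : 0 < p. Proof. exact: lt_le_trans p2. Qed.
Let sp0 : 0 < s * p. Proof. by rewrite mulr_gt0. Qed.
Let al0 : 0 < al. Proof. by rewrite divr_gt0// subr_gt0. Qed.
Let alp : al * p = N%:R - s * p. Proof. by rewrite divfK// gt_eqF. Qed.
Let q0 : 0 < q. Proof. exact: lt_trans q1. Qed.

Let X (x : 'rV[R]_N) := u x * enorm x `^ al.
Let w (x : 'rV[R]_N) := `|u x| `^ p * enorm x `^ (- (s * p)).
Let D x y := (`|X x| `^ (p / 2) - `|X y| `^ (p / 2)) ^+ 2.

(** On the shell |x - y| <= (1 + q^2)|x|, which bounds the kernel below. The other factors are the
    bounds in [jensen_gap_ge] for q^{-2 al} <= t <= q^{-al}, using that t / (1 - t) >= t. *)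
Definition annulus_const : R :=
  ((1 + q ^+ 2) `^ (N%:R + s * p))^-1 * ((1 - q^-1 `^ al) `^ (p - 1) * (q ^+ 2)^-1 `^ al).
Local Notation c := annulus_const.

Let t1 : 0 < q^-1 `^ al < 1.
Proof.
rewrite powR_gt0 ?invr_gt0//= powRV ?(ltW q0)// invf_lt1 ?powR_gt0//.
rewrite -[ltLHS](congr1 (fun f : R -> R => f al) (@powR1 R)).
by apply: gt0_ltr_powR => //; rewrite nnegrE ltW.
Qed.

Lemma annulus_const_gt0 : 0 < c.
Proof.
have /andP[h1 h2] := t1; have q20 : 0 < q ^+ 2 by exact: exprn_gt0.
rewrite mulr_gt0 ?invr_gt0 ?powR_gt0 ?addr_gt0//.
by rewrite mulr_gt0 ?powR_gt0 ?subr_gt0 ?invr_gt0.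
Qed.

Let shell_rem x y : F (enorm y / enorm x) * k2 x y * (c / 2 * D x y) <=
  cone_ind 1 x y * hardy_rem s p u x y * k x y.
Proof.
have RHS0 : 0 <= cone_ind 1 x y * hardy_rem s p u x y * k x y.
  by rewrite mulr_ge0 ?riesz_kernel_ge0// cone_rem_ge0.
have [x0|x0] := ltP 0 (enorm x); last first.
  have -> : enorm x = 0 by apply/eqP; rewrite eq_le x0 enorm_ge0.
  by rewrite invr0 mulr0 shell_ind0 // !mul0r.
rewrite /F; have [xy1|] := ltP q (enorm y / enorm x); last by rewrite !mul0r.
have [xy2|] := leP (enorm y / enorm x) (q ^+ 2); last by rewrite mulr0 !mul0r.
rewrite !mul1r.
rewrite ltr_pdivlMr// in xy1; rewrite ler_pdivrMr// in xy2.
have xy : enorm x < enorm y by apply: lt_trans xy1; rewrite ltr_pMl.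
have y0 : 0 < enorm y by exact: lt_trans xy.
rewrite /cone_ind mul1r x0 xy !mul1r /hardy_rem.
set t := (enorm x / enorm y) `^ al.
have q20 : 0 < q ^+ 2 by exact: exprn_gt0.
have t_le : t <= q^-1 `^ al.
  rewrite ge0_ler_powR ?(ltW al0) ?nnegrE ?divr_ge0 ?invr_ge0 ?(ltW x0) ?(ltW y0) ?(ltW q0)//.
  by rewrite ler_pdivrMr// -ler_pdivrMl ?invr_gt0// invrK ltW.
have t_ge : (q ^+ 2)^-1 `^ al <= t.
  rewrite ge0_ler_powR ?(ltW al0) ?nnegrE ?divr_ge0 ?invr_ge0 ?(ltW x0) ?(ltW y0) ?(ltW q20)//.
  by rewrite ler_pdivlMr// ler_pdivrMl.
have /andP[h1 h2] := t1.
have t0 : 0 < t by apply: lt_le_trans t_ge; rewrite powR_gt0// invr_gt0.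
have tl1 : t < 1 by exact: le_lt_trans h2.
have gap := @jensen_gap_ge R p t (X x) (X y) p2.
rewrite t0 tl1 in gap; have {}gap := gap isT; rewrite -/(D x y) in gap.
have D0 : 0 <= D x y by exact: sqr_ge0.
set a2 := (q ^+ 2)^-1 `^ al in t_ge; set b2 := q^-1 `^ al in t_le h1 h2.
have a20 : 0 <= a2 by exact: powR_ge0.
have gap' : (1 - b2) `^ (p - 1) * a2 / 2 * D x y <= jensen_gap p t (X x) (X y).
  apply: le_trans gap; rewrite -!mulrA; apply: ler_pM.
  - exact: powR_ge0.
  - by rewrite mulr_ge0// mulr_ge0// invr_ge0.
  - rewrite ge0_ler_powR ?nnegrE ?subr_ge0 ?(ltW h2) ?(ltW tl1)//.
      by move: p2 => ?; lra.
    by rewrite lerD2l lerN2.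
  - apply: ler_wpM2r; first by rewrite mulr_ge0// invr_ge0.
    apply: le_trans t_ge _; rewrite le_min (ltW tl1)/=.
    by rewrite ler_pdivlMr ?subr_gt0// ler_piMr ?(ltW t0)// gerBl ltW.
have gap0 : 0 <= (1 - b2) `^ (p - 1) * a2 / 2 * D x y.
  by rewrite mulr_ge0// mulr_ge0 ?invr_ge0// mulr_ge0 ?powR_ge0.
pose K := ((1 + q ^+ 2) `^ (N%:R + s * p))^-1.
have NSp : 0 <= N%:R + s * p by rewrite addr_ge0// ltW.
have k_ge : K * enorm x `^ (- (N%:R + s * p)) <= k x y.
  have xy0 : 0 < enorm (x - y).
    rewrite enorm_gt0 subr_eq0; apply/eqP => h; by move: xy; rewrite h ltxx.
  rewrite /k /riesz_kernel powRN -invfM -powRM ?enorm_ge0// ?addr_ge0 ?(ltW q20)//.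
  rewrite lef_pV2 ?posrE ?powR_gt0// ?mulr_gt0 ?addr_gt0//.
  rewrite ge0_ler_powR ?NSp// ?nnegrE ?mulr_ge0 ?addr_ge0 ?enorm_ge0 ?(ltW q20)//.
  apply: le_trans (ler_enormB _ _) _.
  by rewrite mulrDl mul1r lerD2l.
(* The exponents add up to -al p - (N + sp) = -2 N, and |y| > |x|: the remainder weighted by its
   kernel scales like the dilation-invariant density. *)
have k2_le : k2 x y <= enorm x `^ (- (al * p)) * enorm x `^ (- (N%:R + s * p)).
  rewrite -powRD; last by rewrite (gt_eqF x0) implybT.
  rewrite alp (_ : _ + _ = - N%:R + - N%:R); last by ring.
  rewrite powRD; last by rewrite (gt_eqF x0) implybT.
  rewrite /k2 ler_wpM2l ?powR_ge0// !powRN lef_pV2 ?posrE ?powR_gt0//.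
  by rewrite ge0_ler_powR ?nnegrE ?enorm_ge0 ?(ltW xy).
apply: (@le_trans _ _ (enorm x `^ (- (al * p)) * enorm x `^ (- (N%:R + s * p)) * (c / 2 * D x y))).
  by rewrite ler_wpM2r// mulr_ge0// mulr_ge0 ?invr_ge0// ltW// annulus_const_gt0.
rewrite -/(X x) -/(X y) -[leRHS]mulrA -[leLHS]mulrA ler_wpM2l ?powR_ge0//.
have -> : enorm x `^ (- (N%:R + s * p)) * (c / 2 * D x y) =
    (1 - b2) `^ (p - 1) * a2 / 2 * D x y * (K * enorm x `^ (- (N%:R + s * p))).
  by rewrite /c -/a2 -/b2 -/K; move: (enorm x `^ _) ((1 - b2) `^ _) => *; ring.
apply: ler_pM => //.
by rewrite mulr_ge0 ?powR_ge0// invr_ge0 powR_ge0.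
Qed.

Let wE x : `|X x| `^ p * enorm x `^ (- N%:R) = w x.
Proof.
have [x0|x0] := eqVneq (enorm x) 0.
  by rewrite /w x0 !powR0 ?oppr_eq0 ?pnatr_eq0 ?(gt_eqF sp0)// !mulr0.
rewrite /X /w normrM (ger0_norm (powR_ge0 _ _)) powRM ?powR_ge0//.
rewrite -mulrA -(powRrM (enorm x) al p) alp -powRD; last by rewrite x0 implybT.
by congr (_ * _ `^ _); ring.
Qed.

Let Xp x := `|X x| `^ p.
Let G (x y : 'rV[R]_N) := F (enorm y / enorm x) * k2 x y.
Let i0 (r : R) (x : 'rV[R]_N) : R := (r <= enorm x)%R%:R.

Let w0 x : 0 <= w x. Proof. by rewrite mulr_ge0 ?powR_ge0. Qed.

Let Xp0 x : 0 <= Xp x. Proof. exact: powR_ge0. Qed.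

Let G0 x y : 0 <= G x y. Proof. by rewrite mulr_ge0 ?shell_ind_ge0 ?dilation_kernel_ge0. Qed.

Let mG : measurable_fun [set: 'rV[R]_N * 'rV[R]_N] (fun z => G z.1 z.2).
Proof.
have me := @measurable_enorm R N; rewrite /G; apply: measurable_funM.
  by rewrite /shell_ind; mfun.
exact: measurable_dilation_kernel.
Qed.

Let mXp : measurable_fun [set: 'rV[R]_N] Xp.
Proof. by have me := @measurable_enorm R N; rewrite /Xp /X; mfun. Qed.

Let mw : measurable_fun [set: 'rV[R]_N] w.
Proof. by have me := @measurable_enorm R N; rewrite /w; mfun. Qed.

Let mi0 r : measurable_fun [set: 'rV[R]_N] (i0 r).
Proof. by have me := @measurable_enorm R N; rewrite /i0; mfun. Qed.

(** On the shell |y| > q |x|, so |x| >= r forces |y| >= q r. The value at x is exchanged for the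
    value at y at the cost of the oscillation, which [shell_rem] bounds by the remainder. *)
Let pointwise (r tau : R) x y : 0 < tau ->
  i0 r x * Xp x * G x y <= i0 (q * r) y * Xp y * G x y +
    (tau / c * (cone_ind 1 x y * hardy_rem s p u x y * k x y) +
     tau^-1 * (Xp x * G x y + Xp y * G x y)).
Proof.
move=> tau0.
have RHS0 : 0 <= cone_ind 1 x y * hardy_rem s p u x y * k x y.
  by rewrite mulr_ge0 ?riesz_kernel_ge0// cone_rem_ge0.
have c0 := annulus_const_gt0.
have T0 : 0 <= tau / c * (cone_ind 1 x y * hardy_rem s p u x y * k x y) +
     tau^-1 * (Xp x * G x y + Xp y * G x y).
  apply: addr_ge0; first by rewrite mulr_ge0// divr_ge0// ltW.
  by rewrite mulr_ge0 ?invr_ge0 ?(ltW tau0)// addr_ge0// mulr_ge0.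
have ii : i0 r x * G x y <= i0 (q * r) y * G x y.
  rewrite /i0; have [rx|] := leP r (enorm x); last by rewrite mul0r mulr_ge0.
  rewrite /G /F; have [xy|] := ltP q (enorm y / enorm x); last by rewrite !mul0r !mulr0.
  suff -> : q * r <= enorm y by [].
  have x0 : 0 < enorm x.
    rewrite lt_def enorm_ge0 andbT; apply/eqP => x0; move: xy.
    by rewrite x0 invr0 mulr0 ltNge (ltW q0).
  rewrite ltr_pdivlMr// in xy; apply: le_trans (ltW xy); by rewrite ler_wpM2l// ltW.
have h := powR_le_add_sqr_half p (X x) (X y) tau0; rewrite -/(D x y) -/(Xp x) -/(Xp y) in h.
have i01 : 0 <= i0 r x <= 1 by exact: natr_bool01.
have /andP[ix0 ix1] := i01.
have sr := shell_rem x y; rewrite -/(G x y) in sr.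
exact: (annulus_algebra tau0 c0 i01 (G0 x y) (Xp0 x) (Xp0 y) (sqr_ge0 _) ii h sr).
Qed.

(** Integrating [pointwise], the energy beyond radius r on the left and that beyond q r on the right
    carry the same factor [shell_mass]. Both are finite, and their difference is the energy of the
    annulus. *)
Lemma annulus_le (r tau : R) : 0 <= r -> 0 < tau -> (hardy_energy s p u < +oo)%E ->
  (hardy_rem_integral s p u 1 < +oo)%E ->
  (\int[mu]_x (((r <= enorm x)%R%:R - (q * r <= enorm x)%R%:R) * w x)%:E <=
   (tau * (c^-1 * (fine (@shell_mass R n q))^-1 * fine (hardy_rem_integral s p u 1)) +
    tau^-1 * (2 * fine (hardy_energy s p u)))%:E)%E.
Proof.
move=> r0 tau0 Hoo Eoo.
have c0 := annulus_const_gt0.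
have b0 : (0 < @shell_mass R n q)%E by exact: shell_mass_gt0.
have boo : (@shell_mass R n q < +oo)%E by exact: shell_mass_lty.
have Hf : hardy_energy s p u = (fine (hardy_energy s p u))%:E.
  by rewrite fineK// ge0_fin_numE// hardy_energy_ge0.
have Ef : hardy_rem_integral s p u 1 = (fine (hardy_rem_integral s p u 1))%:E.
  by rewrite fineK// ge0_fin_numE// hardy_rem_integral_ge0.
have bf : @shell_mass R n q = (fine (@shell_mass R n q))%:E.
  by rewrite fineK// ge0_fin_numE// ltW.
have fb0 : 0 < fine (@shell_mass R n q) by rewrite fine_gt0// b0 boo.
pose J (i : 'rV[R]_N -> R) := (\int[mu]_x (i x * w x)%:E)%E.
have Ji (i : 'rV[R]_N -> R) : measurable_fun [set: 'rV[R]_N] i -> (forall x, 0 <= i x <= 1) ->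
    (J i <= hardy_energy s p u)%E.
  move=> mi i01; apply: ge0_le_integral_real => //.
  - exact: measurable_funM.
  - by move=> x; have /andP[h _] := i01 x; rewrite mulr_ge0.
  - by move=> x; have /andP[_ h] := i01 x; rewrite ler_piMl.
have JE (i : 'rV[R]_N -> R) : measurable_fun [set: 'rV[R]_N] i -> (forall x, 0 <= i x <= 1) ->
    J i = (fine (J i))%:E.
  move=> mi i01; rewrite fineK// ge0_fin_numE.
    by apply: le_lt_trans Hoo; exact: Ji.
  by apply: ge0_integral_real => x; have /andP[h _] := i01 x; rewrite mulr_ge0.
pose i2 x := i0 r x - i0 (q * r) x.
have i2_01 x : 0 <= i2 x <= 1.
  rewrite /i2 /i0; have [h|h] := leP (q * r) (enorm x).
    have -> : r <= enorm x by apply: le_trans h; rewrite ler_peMl// ltW.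
    by rewrite subrr lexx ler01.
  by rewrite subr0; exact: natr_bool01.
have mi2 : measurable_fun [set: 'rV[R]_N] i2 by exact: measurable_funB.
have i01 t x : 0 <= i0 t x <= 1 by exact: natr_bool01.
have i00 t x : 0 <= i0 t x by have /andP[] := i01 t x.
have Jadd : J (i0 r) = (J i2 + J (i0 (q * r)))%E.
  rewrite /J -ge0_integralD_real.
  - by apply: eq_integral => x _; rewrite -mulrDl /i2 subrK.
  - exact: measurable_funM.
  - exact: measurable_funM.
  - by move=> x; have /andP[h _] := i2_01 x; rewrite mulr_ge0.
  - by move=> x; rewrite mulr_ge0.
have mf1 t : measurable_fun [set: 'rV[R]_N] (fun x => i0 t x * Xp x) by exact: measurable_funM.
have mXp1 := measurableT_comp mXp (@measurable_fst _ _ [the measurableType _ of 'rV[R]_N] [the measurableType _ of 'rV[R]_N]).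
have mXp2 := measurableT_comp mXp (@measurable_snd _ _ [the measurableType _ of 'rV[R]_N] [the measurableType _ of 'rV[R]_N]).
have mi1 t := measurableT_comp (mi0 t) (@measurable_fst _ _ [the measurableType _ of 'rV[R]_N] [the measurableType _ of 'rV[R]_N]).
have mi2' t := measurableT_comp (mi0 t) (@measurable_snd _ _ [the measurableType _ of 'rV[R]_N] [the measurableType _ of 'rV[R]_N]).
have intE (i : 'rV[R]_N -> R) : (\int[mu]_x (i x * Xp x * enorm x `^ (- N%:R))%:E = J i)%E.
  by apply: eq_integral => x _; rewrite -mulrA wE.
have int1 : (\int[mu]_x (Xp x * enorm x `^ (- N%:R))%:E = hardy_energy s p u)%E.
  by apply: eq_integral => x _; rewrite wE.
pose f1 x y := i0 r x * Xp x * G x y.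
pose f2 x y := i0 (q * r) y * Xp y * G x y.
pose f3 x y := cone_ind 1 x y * hardy_rem s p u x y * k x y.
pose f4 x y := Xp x * G x y.
pose f5 x y := Xp y * G x y.
have f20 x y : 0 <= f2 x y by exact: mulr_ge0 (mulr_ge0 (i00 _ _) (Xp0 _)) (G0 _ _).
have f10 x y : 0 <= f1 x y by exact: mulr_ge0 (mulr_ge0 (i00 _ _) (Xp0 _)) (G0 _ _).
have f30 x y : 0 <= f3 x y by exact: mulr_ge0 (cone_rem_ge0 p2 sN u _ _ (lexx 1)) (riesz_kernel_ge0 _ _ _ _).
have f40 x y : 0 <= f4 x y by exact: mulr_ge0 (Xp0 _) (G0 _ _).
have f50 x y : 0 <= f5 x y by exact: mulr_ge0 (Xp0 _) (G0 _ _).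
have mf1' : measurable_fun [set: 'rV[R]_N * 'rV[R]_N] (fun z => f1 z.1 z.2).
  exact: (measurable_funM (measurable_funM (mi1 r) mXp1) mG).
have mf2 : measurable_fun [set: 'rV[R]_N * 'rV[R]_N] (fun z => f2 z.1 z.2).
  exact: (measurable_funM (measurable_funM (mi2' (q * r)) mXp2) mG).
have mf3 : measurable_fun [set: 'rV[R]_N * 'rV[R]_N] (fun z => f3 z.1 z.2).
  apply: measurable_funM; last exact: measurable_riesz_kernel.
  apply: measurable_funM; last exact: measurable_hardy_rem.
  by have me := @measurable_enorm R N; rewrite /cone_ind; mfun.
have mf4 : measurable_fun [set: 'rV[R]_N * 'rV[R]_N] (fun z => f4 z.1 z.2) by exact: (measurable_funM mXp1 mG).
have mf5 : measurable_fun [set: 'rV[R]_N * 'rV[R]_N] (fun z => f5 z.1 z.2) by exact: (measurable_funM mXp2 mG).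
have iXp0 t x : 0 <= i0 t x * Xp x by exact: mulr_ge0.
have I1 : (\int[mu]_x \int[mu]_y (f1 x y)%:E = shell_mass n q * J (i0 r))%E.
  by rewrite -intE; exact: (shell_integral_l q1 (mf1 r) (iXp0 r)).
have I2 : (\int[mu]_x \int[mu]_y (f2 x y)%:E = shell_mass n q * J (i0 (q * r)))%E.
  by rewrite -intE; exact: (shell_integral_r q1 (mf1 (q * r)) (iXp0 (q * r))).
have I4 : (\int[mu]_x \int[mu]_y (f4 x y)%:E = shell_mass n q * hardy_energy s p u)%E.
  by rewrite -int1; exact: (shell_integral_l q1 mXp Xp0).
have I5 : (\int[mu]_x \int[mu]_y (f5 x y)%:E = shell_mass n q * hardy_energy s p u)%E.
  by rewrite -int1; exact: (shell_integral_r q1 mXp Xp0).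
have tc0 : 0 <= tau / c by rewrite divr_ge0// ltW.
have ti0 : 0 <= tau^-1 by rewrite invr_ge0 ltW.
have f450 x y : 0 <= f4 x y + f5 x y by exact: addr_ge0 (f40 _ _) (f50 _ _).
have mf45 : measurable_fun [set: 'rV[R]_N * 'rV[R]_N] (fun z => f4 z.1 z.2 + f5 z.1 z.2) by exact: measurable_funD mf4 mf5.
pose II (f : 'rV[R]_N -> 'rV[R]_N -> R) := (\int[mu]_x \int[mu]_y (f x y)%:E)%E.
pose f45 x y := f4 x y + f5 x y.
pose g3 x y := tau / c * f3 x y.
pose g45 x y := tau^-1 * f45 x y.
pose h x y := g3 x y + g45 x y.
pose g x y := f2 x y + h x y.
have mg3 : measurable_fun [set: 'rV[R]_N * 'rV[R]_N] (fun z => g3 z.1 z.2).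
  exact: measurable_funM (measurable_cst _) mf3.
have mg45 : measurable_fun [set: 'rV[R]_N * 'rV[R]_N] (fun z => g45 z.1 z.2).
  exact: measurable_funM (measurable_cst _) mf45.
have mh : measurable_fun [set: 'rV[R]_N * 'rV[R]_N] (fun z => h z.1 z.2).
  exact: measurable_funD mg3 mg45.
have mg : measurable_fun [set: 'rV[R]_N * 'rV[R]_N] (fun z => g z.1 z.2).
  exact: measurable_funD mf2 mh.
have g30 x y : 0 <= g3 x y by exact: mulr_ge0 tc0 (f30 _ _).
have g450 x y : 0 <= g45 x y by exact: mulr_ge0 ti0 (f450 _ _).
have h0 x y : 0 <= h x y by exact: addr_ge0 (g30 _ _) (g450 _ _).
have f1g x y : f1 x y <= g x y by exact: pointwise.
have main : (II f1 <= II g)%E.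
  exact: (@le_integral2_real R _ _ _ _ mu mu f1 g mf1' mg f10 f1g).
have Eg : II g = (II f2 + II h)%E.
  exact: (@integral2D_real R _ _ _ _ mu mu f2 h mf2 mh f20 h0).
have Eh : II h = (II g3 + II g45)%E.
  exact: (@integral2D_real R _ _ _ _ mu mu g3 g45 mg3 mg45 g30 g450).
have Eg3 : II g3 = ((tau / c)%:E * II f3)%E.
  exact: (@integral2Z_real R _ _ _ _ mu mu (tau / c) f3 tc0 mf3 f30).
have Eg45 : II g45 = ((tau^-1)%:E * II f45)%E.
  exact: (@integral2Z_real R _ _ _ _ mu mu tau^-1 f45 ti0 mf45 f450).
have Ef45 : II f45 = (II f4 + II f5)%E.
  exact: (@integral2D_real R _ _ _ _ mu mu f4 f5 mf4 mf5 f40 f50).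
have E3 : II f3 = hardy_rem_integral s p u 1 by [].
have {}main := annulus_chain main Eg Eh Eg3 Eg45 Ef45 E3 I1 I2 I4 I5.
rewrite Jadd (JE _ mi2 i2_01) (JE _ (mi0 _) (i01 _)) Ef Hf bf -!EFinM -!EFinD lee_fin in main.
rewrite -/(J i2) (JE _ mi2 i2_01) lee_fin -(ler_pM2l fb0).
exact: annulus_rescale tau0 c0 fb0 main.
Qed.
End annulus.

(** * Level sets *)

Lemma sqr_le_of_scaled_sum {F : realFieldType} (a x y : F) : 0 <= a -> 0 <= x -> 0 <= y ->
  (forall tau, 0 < tau -> a <= tau * x + tau^-1 * y) -> a ^+ 2 <= 4 * (x * y).
Proof.
move=> a0 x0 y0 h; have [->|an0] := eqVneq a 0.
  by rewrite expr0n/= !mulr_ge0.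
have a1 : 0 < a by rewrite lt_def an0.
have [y1|yn0] := eqVneq y 0.
  (* If y = 0, the choice tau = a / (2 (x + 1)) would give a <= a / 2. *)
  have x1 : 0 < 2 * (x + 1) by rewrite mulr_gt0// ltr_wpDl.
  have := h _ (divr_gt0 a1 x1); rewrite y1 mulr0 addr0 mulrAC ler_pdivlMr//.
  rewrite ler_pM2l// => h2; exfalso; lra.
have y1 : 0 < y by rewrite lt_def yn0.
(* At this tau the second term equals a / 2, whence a^2 <= 4 x y. *)
have := h (2 * y / a); rewrite divr_gt0 ?mulr_gt0// => /(_ isT).
have -> : (2 * y / a)^-1 * y = a / 2 by field; rewrite yn0 an0.
have -> : 2 * y / a * x = 2 * (x * y) / a by field.
rewrite -lerBlDr ler_pdivlMr// expr2 => h2.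
have : a - a / 2 = a / 2 by field.
move=> h3; rewrite h3 in h2; lra.
Qed.

Lemma measurable_bool d (T : measurableType d) (b : T -> bool) :
  measurable_fun [set: T] b -> measurable [set x | b x].
Proof. by move=> mb; rewrite -[X in measurable X]setTI; exact: (mb measurableT [set true]). Qed.

Lemma measurable_natr_bool {R : realType} d (T : measurableType d) (b : T -> bool) :
  measurable_fun [set: T] b -> measurable_fun [set: T] (fun x => (b x)%:R : R).
Proof.
move=> mb; rewrite (_ : (fun _ => _) = (fun x => if b x then 1 else 0)).
  exact: measurable_fun_ifT.
by apply/funext => x; case: (b x).
Qed.

(** * Level sets far from the origin *)

Section far_level.
Context {R : realType} (n : nat) (s p : R).
Local Notation N := n.+1.
Local Notation mu := (@lebesgueN R N).
Local Notation al := ((N%:R - s * p) / p).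
Local Notation beta := (@rV_unit_ball_vol R N).
Hypotheses (p2 : 2 <= p) (s0 : 0 < s) (sN : s * p < N%:R).
Local Notation k := (riesz_kernel s p).
Variable u : 'rV[R]_N -> R.
Hypothesis mu_ : measurable_fun [set: 'rV[R]_N] u.

Let p0 : 0 < p. Proof. exact: lt_le_trans p2. Qed.
Let sp0 : 0 < s * p. Proof. by rewrite mulr_gt0. Qed.
Let al0 : 0 < al. Proof. by rewrite divr_gt0// subr_gt0. Qed.

Variables (l d r : R).
Hypotheses (l0 : 0 < l) (d0 : 0 < d) (r0 : 0 < r) (dr : (1 + 3 * d / r) `^ al <= 8 / 7).

(** The first factors come from [jensen_gap_ge_near], the last one from the kernel at distance at
    most 3 d. *)
Definition far_const : R := 2 `^ (- (p + 1)) * l `^ p * ((3 * d) `^ (N%:R + s * p))^-1.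
Local Notation c := far_const.

Lemma far_const_gt0 : 0 < c.
Proof. by rewrite !mulr_gt0 ?invr_gt0 ?powR_gt0// mulr_gt0. Qed.

(** Pushing x outwards by 2 d puts the whole ball of radius d around the new point inside the cone:
    there |x| + d <= |y| <= |x| + 3 d. *)
Let center (x : 'rV[R]_N) := (1 + 2 * d / enorm x) *: x.

(** The hypothesis [dr] yields t >= 7 / 8 and |Y| <= (l / 4)(8 / 7)|x|^al <= |X| / 2, which is what
    [jensen_gap_ge_near] requires. *)
Let far_pointwise x y : l < `|u x| -> r <= enorm x -> enorm (y - center x) <= d ->
  `|u y| <= l / 4 -> c <= cone_ind 1 x y * hardy_rem s p u x y * k x y.
Proof.
move=> ux xr yz uy; have x0 : 0 < enorm x by exact: lt_le_trans xr.
have zE : enorm (center x) = enorm x + 2 * d.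
  rewrite /center enormZ gtr0_norm ?addr_gt0 ?divr_gt0 ?mulr_gt0//.
  by rewrite mulrDl mul1r divfK// gt_eqF.
have zx : enorm (x - center x) = 2 * d.
  rewrite /center scalerDl scale1r opprD addrA subrr add0r enormN enormZ.
  by rewrite gtr0_norm ?divr_gt0 ?mulr_gt0// divfK// gt_eqF.
have y_ge : enorm x + d <= enorm y.
  have : enorm (center x) <= enorm y + enorm (y - center x).
    rewrite {1}(_ : center x = y - (y - center x)); last by rewrite opprB addrC subrK.
    exact: ler_enormB.
  rewrite zE => h; lra.
have y_le : enorm y <= enorm x + 3 * d.
  have : enorm y <= enorm (y - center x) + enorm (center x).
    by rewrite -{1}(subrK (center x) y); exact: ler_enormD.
  rewrite zE => h; lra.
have xy_le : enorm (x - y) <= 3 * d.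
  have : enorm (x - y) <= enorm (x - center x) + enorm (y - center x).
    by rewrite (_ : x - y = (x - center x) - (y - center x)) ?ler_enormB// opprB addrA subrK.
  rewrite zx => h; lra.
have xy : enorm x < enorm y by move: d0 => ?; lra.
have y0 : 0 < enorm y by exact: lt_trans xy.
have xy0 : 0 < enorm (x - y).
  rewrite enorm_gt0 subr_eq0; apply/eqP => h; by move: xy; rewrite h ltxx.
have yx_al : (enorm y / enorm x) `^ al <= 8 / 7.
  apply: le_trans dr; rewrite ge0_ler_powR ?(ltW al0) ?nnegrE ?divr_ge0 ?addr_ge0 ?mulr_ge0 ?invr_ge0 ?(ltW d0) ?(ltW r0) ?enorm_ge0//.
  rewrite ler_pdivrMr// mulrDl mul1r; apply: le_trans y_le _.
  by rewrite lerD2l mulrAC ler_pdivlMr// ler_wpM2l// mulr_ge0// ltW.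
rewrite /cone_ind mul1r x0 xy !mul1r /c /hardy_rem.
set t := (enorm x / enorm y) `^ al.
have tE : t = ((enorm y / enorm x) `^ al)^-1 by rewrite -powRV ?divr_ge0 ?enorm_ge0// invf_div.
have yxa0 : 0 < (enorm y / enorm x) `^ al by rewrite powR_gt0// divr_gt0.
have t78 : 7 / 8 <= t.
  rewrite tE -[leLHS]invrK lef_pV2 ?posrE ?invr_gt0//; apply: le_trans yx_al _.
  by rewrite invf_div.
have t1 : t < 1.
  rewrite -[ltRHS](congr1 (fun f : R -> R => f al) (@powR1 R)).
  apply: gt0_ltr_powR => //; rewrite ?nnegrE ?divr_ge0 ?enorm_ge0//.
  by rewrite ltr_pdivrMr// mul1r.
have xa0 : 0 <= enorm x `^ al by exact: powR_ge0.
have YX : `|u y * enorm y `^ al| <= `|u x * enorm x `^ al| / 2.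
  rewrite !normrM !(ger0_norm (powR_ge0 _ _)).
  have ya : enorm y `^ al <= 8 / 7 * enorm x `^ al.
    rewrite -{1}(divfK (negbT (gt_eqF x0)) (enorm y)) powRM ?divr_ge0 ?enorm_ge0//.
    by rewrite ler_wpM2r.
  apply: (@le_trans _ _ (l / 4 * (8 / 7 * enorm x `^ al))).
    by apply: ler_pM; rewrite ?powR_ge0.
  rewrite mulrA [leRHS]mulrAC ler_wpM2r//; move: l0 ux => ? ?; lra.
have gap := jensen_gap_ge_near p2 (introT andP (conj t78 t1)) YX.
have k_ge : ((3 * d) `^ (N%:R + s * p))^-1 <= k x y.
  rewrite /riesz_kernel lef_pV2 ?posrE ?powR_gt0 ?mulr_gt0//.
  rewrite ge0_ler_powR ?nnegrE ?enorm_ge0 ?mulr_ge0 ?(ltW d0)//.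
  by rewrite addr_ge0// ltW.
apply: ler_pM => //; rewrite ?invr_ge0 ?powR_ge0 ?mulr_ge0 ?powR_ge0//.
apply: (@le_trans _ _ (enorm x `^ (- (al * p)) *
   (2 `^ (- (p + 1)) * `|u x * enorm x `^ al| `^ p))); last by rewrite ler_wpM2l ?powR_ge0.
rewrite normrM (ger0_norm xa0) powRM// -(powRrM (enorm x) al p) (powRN (enorm x)).
have xap : 0 < enorm x `^ (al * p) by exact: powR_gt0.
have -> : (enorm x `^ (al * p))^-1 * (2 `^ (- (p + 1)) * (`|u x| `^ p * enorm x `^ (al * p))) =
    2 `^ (- (p + 1)) * `|u x| `^ p.
  move: (enorm x `^ (al * p)) (2 `^ _) (`|u x| `^ p) xap => a b e a0.
  by field; rewrite gt_eqF.
by rewrite ler_wpM2l ?powR_ge0// ge0_ler_powR ?nnegrE ?(ltW p0) ?(ltW l0) ?(ltW ux).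
Qed.

(** For each x of the far level set, the ball around [center x] has measure beta d^N, of which |u| >
    l / 4 occupies at most T; on the rest [far_pointwise] applies. *)
Lemma far_level (T : R) : (mu [set x | (l / 4 < `|u x|)%R] <= T%:E)%E -> T <= beta * d ^+ N ->
  ((c * (beta * d ^+ N - T))%:E * mu [set x | (l < `|u x|)%R && (r <= enorm x)%R]
     <= hardy_rem_integral s p u 1)%E.
Proof.
move=> mT Tb; have me := @measurable_enorm R N.
have c0 := ltW far_const_gt0.
pose f x y := cone_ind 1 x y * hardy_rem s p u x y * k x y.
have f0 x y : 0 <= f x y by exact: mulr_ge0 (cone_rem_ge0 p2 sN u _ _ (lexx 1)) (riesz_kernel_ge0 _ _ _ _).
have mf : measurable_fun [set: 'rV[R]_N * 'rV[R]_N] (fun z => f z.1 z.2).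
  apply: measurable_funM; last exact: measurable_riesz_kernel.
  apply: measurable_funM; last exact: measurable_hardy_rem.
  by rewrite /cone_ind; mfun.
pose ix x : R := ((l < `|u x|) && (r <= enorm x))%:R.
have mau : measurable_fun [set: 'rV[R]_N] (fun x => `|u x|) by mfun.
have mb : measurable_fun [set: 'rV[R]_N] (fun x => (l < `|u x|) && (r <= enorm x)).
  by apply: measurable_and; [exact: measurable_fun_ltr|exact: measurable_fun_ler].
have mset : measurable [set x | (l < `|u x|) && (r <= enorm x)] by exact: measurable_bool.
have mi : measurable_fun [set: 'rV[R]_N] ix by exact: measurable_natr_bool.
rewrite -(integral_boolE mu mset) -ge0_integralZl_real; last 3 first.
- by rewrite mulr_ge0// subr_ge0.
- exact: mi.
- by [].
apply: ge0_le_integral => //.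
- by move=> x _; rewrite lee_fin mulr_ge0// mulr_ge0// subr_ge0.
- by apply/measurable_EFinP; exact: measurable_funM.
- exact: (@measurable_integral_real _ _ _ _ _ mu f mf f0).
move=> x _; case: (boolP ((l < `|u x|) && (r <= enorm x))) => [/andP[ux xr]|_]; last first.
  by rewrite mulr0 integral_ge0// => y _; rewrite lee_fin; exact: f0.
rewrite mulr1.
pose iB y : R := (enorm (y - center x) <= d)%R%:R.
pose iT y : R := (l / 4 < `|u y|)%R%:R.
have miB : measurable_fun [set: 'rV[R]_N] iB by rewrite /iB; mfun.
have miT : measurable_fun [set: 'rV[R]_N] iT by rewrite /iT; mfun.
have mset4 : measurable [set x | l / 4 < `|u x|].
  by apply: measurable_bool; exact: measurable_fun_ltr.
have hT : (\int[mu]_y (iT y)%:E <= T%:E)%E by rewrite (integral_boolE mu mset4).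
have hB : (\int[mu]_y (iB y)%:E = (beta * d ^+ N)%:E)%E.
  rewrite (@ge0_integral_rV_shift R N _ (center x)).
  - rewrite [beta * _]mulrC -lebesgueN_ballE// -integral_rV_ball.
    by apply: eq_integral => y _; rewrite /iB addrC addKr.
  - exact/measurable_EFinP.
  - by move=> y; rewrite lee_fin.
have mfx : measurable_fun [set: 'rV[R]_N] (f x) by exact: measurable_section2 mf.
have : (\int[mu]_y (c * iB y)%:E <= \int[mu]_y (f x y + c * iT y)%:E)%E.
  apply: ge0_le_integral_real.
  - exact: measurable_funM.
  - by apply: measurable_funD => //; exact: measurable_funM.
  - by move=> y; rewrite mulr_ge0.
  - move=> y; rewrite /iB; have [yB|_] := leP (enorm (y - center x)) d; last first.
      by rewrite mulr0; exact: addr_ge0 (f0 _ _) (mulr_ge0 c0 (ler0n _ _)).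
    rewrite mulr1 /iT; have [uy|uy] := ltP (l / 4) `|u y|; first by rewrite mulr1 lerDr.
    by rewrite mulr0 addr0; exact: far_pointwise.
rewrite ge0_integralZl_real// hB ge0_integralD_real//; last 2 first.
- exact: measurable_funM.
- by move=> y; rewrite mulr_ge0.
rewrite ge0_integralZl_real// => h.
have : (c%:E * (beta * d ^+ N)%:E <= \int[mu]_y (f x y)%:E + (c * T)%:E)%E.
  by apply: (le_trans h); apply: leeD2l; exact: (@lee_wpmul2l R c%:E c0 _ _ hT).
by rewrite -EFinM -leeBlDr// -EFinB mulrBr.
Qed.
End far_level.

(** * The estimate at one level *)

Section level_set.
Context {R : realType} (n : nat) (s p : R).
Local Notation N := n.+1.
Local Notation mu := (@lebesgueN R N).
Local Notation al := ((N%:R - s * p) / p).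
Local Notation P := (@sobolev_exp R N s p).
Local Notation beta := (@rV_unit_ball_vol R N).
Hypotheses (p2 : 2 <= p) (s0 : 0 < s) (sN : s * p < N%:R).

Let p0 : 0 < p. Proof. exact: lt_le_trans p2. Qed.
Let sp0 : 0 < s * p. Proof. by rewrite mulr_gt0. Qed.
Let al0 : 0 < al. Proof. by rewrite divr_gt0// subr_gt0. Qed.
Let b0 : 0 < beta. Proof. exact: rV_unit_ball_vol_gt0. Qed.

Let rt (x : R) := x `^ N%:R^-1.

Let rtK x : 0 <= x -> rt x ^+ N = x.
Proof.
by move=> x0; rewrite /rt -powR_mulrn ?powR_ge0// -powRrM mulVf ?gt_eqF// powRr1.
Qed.

Let rt_gt0 x : 0 < x -> 0 < rt x.
Proof. exact: powR_gt0. Qed.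

(* Radii, relative to that of a ball of the measure of the level set: [d0] makes
   the balls of [far_level] absorb the level set at height l/4, [K0] makes t >= 7/8
   there, and [eta] makes the ball of radius [eta] carry a quarter of the level set. *)
Let d0 : R := rt (4 * 4 `^ P / beta).
Let eps : R := (8 / 7) `^ al^-1 - 1.
Let K0 : R := 3 * d0 / eps.
Let eta : R := Num.min (K0 / 2) (rt (4 * beta)^-1).
(** Ratio of the radii of the annulus between eta and K0; the bound eta <= K0 / 2 makes it exceed
    1. *)
Let q : R := K0 / eta.

Let d0_gt0 : 0 < d0.
Proof. by rewrite rt_gt0// divr_gt0// mulr_gt0// powR_gt0. Qed.

Let eps_gt0 : 0 < eps.
Proof.
rewrite subr_gt0 -[ltLHS](congr1 (fun f : R -> R => f al^-1) (@powR1 R)).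
apply: gt0_ltr_powR; rewrite ?invr_gt0 ?nnegrE//; lra.
Qed.

Let K0_gt0 : 0 < K0. Proof. by rewrite divr_gt0// mulr_gt0. Qed.

Let eta_gt0 : 0 < eta.
Proof. by rewrite lt_min divr_gt0//= rt_gt0// invr_gt0 mulr_gt0. Qed.

Let q1 : 1 < q.
Proof.
rewrite ltr_pdivlMr// mul1r; apply: (@le_lt_trans _ _ (K0 / 2)).
  by rewrite ge_min lexx.
by rewrite ltr_pdivrMr// ltr_pMr// ltr1n.
Qed.

Let far_K0 : (1 + 3 * d0 / K0) `^ al <= 8 / 7.
Proof.
have -> : 1 + 3 * d0 / K0 = (8 / 7) `^ al^-1.
  rewrite /K0 invf_div mulrCA divff ?mulr1 ?gt_eqF ?mulr_gt0// /eps addrC subrK //.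
by rewrite -powRrM mulVf ?gt_eqF// powRr1.
Qed.

Let eta_ball : beta * eta ^+ N <= 4^-1.
Proof.
have h : eta ^+ N <= (4 * beta)^-1.
  rewrite -[leRHS]rtK ?invr_ge0 ?mulr_ge0 ?(ltW b0)//.
  by rewrite lerXn2r ?nnegrE ?powR_ge0 ?(ltW eta_gt0)// ge_min lexx orbT.
apply: (@le_trans _ _ (beta * (4 * beta)^-1)); first by rewrite ler_wpM2l// ltW.
by rewrite invfM mulrCA mulfV ?mulr1// gt_eqF.
Qed.

(** All radii are multiples of rho = m^{1/N}. If less than half of the level set lies beyond K0 rho,
    then, as the ball of radius eta rho takes at most a quarter, the annulus in between holds at
    least a quarter, and there |x|^{-sp} >= (K0 rho)^{-sp}. *)
Lemma level_set : exists2 C : R, 0 < C &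
  forall (u : 'rV[R]_N -> R) (l m : R), measurable_fun [set: 'rV[R]_N] u ->
  (hardy_energy s p u < +oo)%E -> (hardy_rem_integral s p u 1 < +oo)%E ->
  0 < l -> 0 < m -> mu [set x | (l < `|u x|)%R] = m%:E ->
  (mu [set x | (l / 4 < `|u x|)%R] <= (2 * 4 `^ P * m)%:E)%E ->
  (l `^ p * m `^ (1 - s * p / N%:R)) ^+ 2 <=
  C * (fine (hardy_rem_integral s p u 1) *
       (fine (hardy_rem_integral s p u 1) + fine (hardy_energy s p u))).
Proof.
have me := @measurable_enorm R N.
pose cb : R := 2 `^ (- (p + 1)) * ((3 * d0) `^ (N%:R + s * p))^-1 * 4 `^ P.
have cb0 : 0 < cb by rewrite !mulr_gt0 ?invr_gt0 ?powR_gt0// mulr_gt0.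
pose ca : R := K0 `^ (- (s * p)) / 4.
have ca0 : 0 < ca by rewrite divr_gt0// powR_gt0.
pose c1 : R := (annulus_const n s p q)^-1 * (fine (@shell_mass R n q))^-1.
have c10 : 0 <= c1.
  apply: mulr_ge0; rewrite invr_ge0.
    by apply: ltW; exact: annulus_const_gt0.
  by apply/fine_ge0/ltW; exact: shell_mass_gt0.
have ca1 : 0 <= 8 * c1 / ca ^+ 2.
  by apply: divr_ge0; [exact: mulr_ge0|exact: exprn_ge0 (ltW ca0)].
exists (cb ^- 2 + 8 * c1 / ca ^+ 2).
  by apply: ltr_pwDl => //; rewrite invr_gt0 exprn_gt0.
move=> u l m mu_ Hoo Eoo l0 m0 mE m4.
set E := fine (hardy_rem_integral s p u 1); set H := fine (hardy_energy s p u).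
have E0 : 0 <= E by rewrite fine_ge0// hardy_rem_integral_ge0.
have H0 : 0 <= H by rewrite fine_ge0// hardy_energy_ge0.
have Ef : hardy_rem_integral s p u 1 = E%:E.
  by rewrite fineK// ge0_fin_numE// hardy_rem_integral_ge0.
pose rho := rt m.
have rho0 : 0 < rho by exact: rt_gt0.
have rhoN : rho ^+ N = m by apply: rtK; exact: ltW.
set Y := l `^ p * m `^ (1 - s * p / N%:R).
have Y0 : 0 <= Y by rewrite mulr_ge0 ?powR_ge0.
have rhosp : m * rho `^ (- (s * p)) = m `^ (1 - s * p / N%:R).
  rewrite /rho /rt -(powRrM m) -{1}[m]powRr1 ?(ltW m0)// -powRD; last by rewrite (gt_eqF m0) implybT.
  by congr (_ `^ _); field.
have mau : measurable_fun [set: 'rV[R]_N] (fun x => `|u x|) by mfun.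
pose A := [set x | (l < `|u x|)%R].
have mA : measurable A by apply: measurable_bool; exact: measurable_fun_ltr.
pose Af := [set x | (l < `|u x|)%R && (K0 * rho <= enorm x)%R].
have mAf : measurable Af.
  by apply: measurable_bool; apply: measurable_and; [exact: measurable_fun_ltr|exact: measurable_fun_ler].
have Kr0 : 0 < K0 * rho by exact: mulr_gt0.
(* The far case bounds Y^2 by a multiple of E^2 and the annulus case by a multiple of E H; both are
   covered by E (E + H). *)
suff [hb|ha] : cb * Y <= E \/ (ca * Y) ^+ 2 <= 4 * (c1 * E * (2 * H)).
- rewrite mulrDl -[leLHS]addr0; apply: lerD; last first.
    exact: mulr_ge0 ca1 (mulr_ge0 E0 (addr_ge0 E0 H0)).
  rewrite ler_pdivlMl ?exprn_gt0// -exprMn.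
  apply: (@le_trans _ _ (E * E)); last by rewrite ler_wpM2l// lerDl.
  by rewrite -expr2 ler_sqr ?nnegrE// mulr_ge0// ltW.
- rewrite mulrDl -[leLHS]add0r; apply: lerD.
    apply: mulr_ge0 (mulr_ge0 E0 (addr_ge0 E0 H0)); by rewrite invr_ge0 exprn_ge0// ltW.
  rewrite mulrAC ler_pdivlMr ?exprn_gt0// mulrC -exprMn; apply: (le_trans ha).
  rewrite (_ : 4 * _ = 8 * c1 * (E * H)); last by ring.
  apply: ler_wpM2l; first exact: mulr_ge0.
  by apply: ler_wpM2l => //; rewrite lerDr.
have [far|near] := leP (m / 2)%:E (mu Af); [left|right].
  have dr : (1 + 3 * (d0 * rho) / (K0 * rho)) `^ al <= 8 / 7.
    by rewrite mulrA -mulf_div divff ?mulr1// gt_eqF.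
  (* Twice the bound [m4] on the set where |u| > l / 4, so that at least half of each ball is
     left. *)
  have bd : beta * (d0 * rho) ^+ N = 4 * 4 `^ P * m.
    rewrite exprMn rhoN /d0 rtK ?divr_ge0 ?mulr_ge0 ?powR_ge0 ?(ltW b0)//.
    by rewrite mulrA [beta * _]mulrC divfK// gt_eqF.
  have P4 : 0 <= 4 `^ P :> R by exact: powR_ge0.
  have Tb : 2 * 4 `^ P * m <= beta * (d0 * rho) ^+ N.
    rewrite bd ler_wpM2r ?(ltW m0)// ler_wpM2r//; lra.
  have := far_level p2 s0 sN mu_ l0 (mulr_gt0 d0_gt0 rho0) Kr0 dr m4 Tb.
  rewrite bd Ef => h.
  have c00 : 0 <= far_const n s p l (d0 * rho) * (4 * 4 `^ P * m - 2 * 4 `^ P * m).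
    rewrite mulr_ge0 ?subr_ge0 -?bd// ltW// far_const_gt0//; exact: mulr_gt0.
  have : ((far_const n s p l (d0 * rho) * (4 * 4 `^ P * m - 2 * 4 `^ P * m))%:E * (m / 2)%:E <= E%:E)%E.
    by apply: le_trans h; apply: lee_wpmul2l.
  rewrite -EFinM lee_fin; apply: le_trans; rewrite le_eqVlt; apply/orP; left; apply/eqP.
  rewrite /far_const /cb /Y -rhosp (mulrA 3 d0 rho).
  rewrite (powRM _ (mulr_ge0 (ler0n _ 3) (ltW d0_gt0)) (ltW rho0)).
  rewrite (powRD (_ : (N%:R + s * p == 0) ==> (rho != 0))); last by rewrite (gt_eqF rho0) implybT.
  rewrite powR_mulrn ?(ltW rho0)// rhoN (powRN rho).
  have rsp : 0 < rho `^ (s * p) by exact: powR_gt0.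
  have d3 : 0 < (3 * d0) `^ (N%:R + s * p) by rewrite powR_gt0// mulr_gt0.
  move: (rho `^ (s * p)) ((3 * d0) `^ _) rsp d3 => a4 a5 a40 a50.
  move: (2 `^ _) (l `^ p) (4 `^ P) => a1 a2 a3.
  by field; rewrite !gt_eqF.
apply: sqr_le_of_scaled_sum.
- by rewrite mulr_ge0// ltW.
- exact: mulr_ge0.
- exact: mulr_ge0.
move=> tau tau0.
have er0 : 0 <= eta * rho by rewrite mulr_ge0// ltW.
have := annulus_le p2 s0 sN q1 mu_ er0 tau0 Hoo Eoo.
have -> : q * (eta * rho) = K0 * rho by rewrite mulrA divfK// gt_eqF.
rewrite -/E -/H -/c1 -lee_fin; apply: le_trans.
pose B := [set x | (l < `|u x|)%R && ((eta * rho <= enorm x)%R && (enorm x < K0 * rho)%R)].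
have mBb : measurable_fun [set: 'rV[R]_N]
    (fun x => (l < `|u x|) && ((eta * rho <= enorm x) && (enorm x < K0 * rho))).
  apply: measurable_and; first exact: measurable_fun_ltr.
  by apply: measurable_and; [exact: measurable_fun_ler|exact: measurable_fun_ltr].
have mB : measurable B by exact: measurable_bool.
have mball t : measurable (@rV_ball R N t) by exact: measurable_rV_ball.
have muB : ((m / 4)%:E <= mu B)%E.
  have AU : A `<=` Af `|` (B `|` rV_ball (eta * rho)).
    move=> x Ax; rewrite /Af /B /rV_ball /= Ax/=.
    have [h1|h1] := leP (K0 * rho) (enorm x); [by left|right].
    by have [h2|h2] := leP (eta * rho) (enorm x); [left|right; exact: ltW].
  rewrite leNgt; apply/negP => Bm.
  have h1 : (mu A <= mu Af + (mu B + mu (rV_ball (eta * rho))))%E.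
    apply: (@le_trans _ _ (mu (Af `|` (B `|` rV_ball (eta * rho))))).
      by apply: le_measure; rewrite ?inE//; apply: measurableU => //; exact: measurableU.
    have : (mu (Af `|` (B `|` rV_ball (eta * rho))) <= mu Af + mu (B `|` rV_ball (eta * rho)))%E.
      by apply: measureU2 => //; exact: measurableU.
    move/le_trans; apply; apply: leeD2l; exact: measureU2.
  have h2 : (mu B + mu (rV_ball (eta * rho)) <= (m / 2)%:E)%E.
    rewrite (_ : m / 2 = m / 4 + m / 4); last by field.
    rewrite EFinD; apply: leeD; first exact: ltW.
    rewrite lebesgueN_ballE ?mulr_gt0// lee_fin exprMn rhoN.
    rewrite mulrC mulrA mulrC ler_wpM2l ?(ltW m0)//.
  have : (mu A < (m / 2)%:E + (m / 2)%:E)%E.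
    apply: (le_lt_trans h1); apply: lte_leD => //.
    rewrite ge0_fin_numE; first exact: le_lt_trans h2 (ltry _).
    by apply: adde_ge0; exact: measure_ge0.
  by rewrite /A mE -EFinD lte_fin -splitr ltxx.
pose cc := l `^ p * (K0 * rho) `^ (- (s * p)).
have cc0 : 0 <= cc by rewrite mulr_ge0 ?powR_ge0.
have -> : ca * Y = cc * (m / 4).
  rewrite /ca /cc /Y -rhosp powRM ?(ltW K0_gt0) ?(ltW rho0)//.
  move: (K0 `^ _) (rho `^ _) (l `^ p) => a1 a2 a3; by field.
rewrite EFinM; apply: (@le_trans _ _ (cc%:E * mu B)%E); first exact: lee_wpmul2l.
rewrite -(integral_boolE mu mB) -ge0_integralZl_real//; last exact: measurable_natr_bool mBb.
have mw : measurable_fun [set: 'rV[R]_N] (fun x => `|u x| `^ p * enorm x `^ (- (s * p))) by mfun.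
apply: ge0_le_integral_real.
- by apply: measurable_funM => //; exact: measurable_natr_bool mBb.
- by apply: measurable_funM => //; mfun.
- by move=> x; rewrite mulr_ge0.
move=> x; have ek : eta * rho <= K0 * rho.
  by rewrite ler_pM2r// ltW//; move: q1; rewrite ltr_pdivlMr// mul1r.
case: (boolP ((l < `|u x|) && ((eta * rho <= enorm x) && (enorm x < K0 * rho)))).
  move=> /andP[ux /andP[x1 x2]]; rewrite mulr1 x1 [K0 * rho <= _]leNgt x2/= subr0 mul1r.
  have x0 : 0 < enorm x by apply: lt_le_trans x1; exact: mulr_gt0.
  apply: ler_pM; rewrite ?powR_ge0//.
    by rewrite ge0_ler_powR ?nnegrE ?(ltW p0) ?(ltW l0) ?(ltW ux).
  rewrite !powRN lef_pV2 ?posrE ?powR_gt0//.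
  by rewrite ge0_ler_powR ?nnegrE ?(ltW sp0) ?(ltW x0) ?(ltW x2) ?(ltW Kr0).
move=> _; rewrite mulr0; apply: mulr_ge0; last by rewrite mulr_ge0 ?powR_ge0.
rewrite subr_ge0 ler_nat; case: (leP (K0 * rho) (enorm x)) => // h.
by rewrite (le_trans ek h).
Qed.
End level_set.

(** * Lorentz norms *)

Section layers.
Context {R : realType}.
Local Notation leb := (@lebesgue_measure R).

Let mbool (a b : R) : measurable_fun [set: R] (fun r => (a < r) && (r < b)).
Proof. by apply: measurable_and; exact: measurable_fun_ltr. Qed.

Let Iab (a b : R) : a <= b -> (\int[leb]_r (((a < r) && (r < b))%:R : R)%:E = (b - a)%:E)%E.
Proof.
move=> ab; rewrite integral_boolE; last exact: measurable_bool (mbool a b).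
rewrite (_ : [set x : R | _] = `]a, b[%classic); last first.
  by apply/seteqP; split => r /=; rewrite in_itv.
transitivity (lebesgue_measure (`]a, b[%classic : set R)) => //.
rewrite lebesgue_measure_itv/= lte_fin; case: ltP => h; first by rewrite EFinB.
by congr EFin; apply/esym/eqP; rewrite subr_eq0 eq_le h ab.
Qed.

Lemma integral_ind_oc (a b : R) : a <= b ->
  (\int[leb]_r (((a < r) && (r <= b))%:R : R)%:E = (b - a)%:E)%E.
Proof.
move=> ab; rewrite integral_boolE; last first.
  by apply: measurable_bool; apply: measurable_and; [exact: measurable_fun_ltr|exact: measurable_fun_ler].
rewrite (_ : [set x : R | _] = `]a, b]%classic); last first.
  by apply/seteqP; split => r /=; rewrite in_itv.
transitivity (lebesgue_measure (`]a, b]%classic : set R)) => //.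
rewrite lebesgue_measure_itv/= lte_fin; case: ltP => h; first by rewrite EFinB.
by congr EFin; apply/esym/eqP; rewrite subr_eq0 eq_le h ab.
Qed.

(** Only the layers between a / 2 and a are kept, where l^{p - 1} >= (a / 2)^{p - 1}. The next two
    bounds are equally crude, replacing the power by its value at the upper end of the range; only
    constants are lost. *)
Lemma powR_le_layer (p a : R) : 1 <= p -> 0 <= a ->
  ((a `^ p)%:E <=
   (2 `^ p)%:E * \int[leb]_l ((0 < l)%R%:R * (l < a)%R%:R * l `^ (p - 1) : R)%:E)%E.
Proof.
move=> p1 a0; have p0 : 0 < p by exact: lt_le_trans p1.
have [->|an0] := eqVneq a 0.
  rewrite powR0 ?gt_eqF// mule_ge0 ?lee_fin ?powR_ge0//.
  by apply: ge0_integral_real => l; rewrite !mulr_ge0 ?powR_ge0.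
have a1 : 0 < a by rewrite lt_def an0.
have a2 : 0 < a / 2 by rewrite divr_gt0.
have -> : a `^ p = 2 `^ p * ((a / 2) `^ (p - 1) * (a - a / 2)).
  have -> : a - a / 2 = a / 2 by field.
  rewrite -{2}(@powRr1 _ (a / 2)) ?(ltW a2)// -powRD ?(gt_eqF a2) ?implybT// subrK.
  by rewrite -powRM ?(ltW a2)// mulrC divfK.
rewrite [leLHS]EFinM; apply: lee_wpmul2l; first by rewrite lee_fin powR_ge0.
rewrite EFinM -Iab; last by rewrite ler_pdivrMr// ler_peMr// ler1n.
rewrite -ge0_integralZl_real ?powR_ge0//; last exact: measurable_natr_bool (mbool _ _).
apply: ge0_le_integral_real.
- by apply: measurable_funM => //; exact: measurable_natr_bool (mbool _ _).
- by mfun.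
- by move=> r; rewrite mulr_ge0 ?powR_ge0.
- move=> r; case: ltP => r1; last by rewrite mulr0 !mulr_ge0 ?powR_ge0.
  rewrite (lt_trans a2 r1); case: ltP => r2; last by rewrite mulr0 mulr_ge0 ?powR_ge0 ?mulr_ge0.
  rewrite mulr1 !mul1r ge0_ler_powR ?nnegrE ?subr_ge0 ?(ltW a2) ?(ltW r1)//.
  exact: ltW (lt_trans a2 r1).
Qed.

Lemma layer_le_powR (p a : R) : 1 <= p -> 0 <= a ->
  (\int[leb]_l ((0 < l)%R%:R * (l <= a)%R%:R * l `^ (p - 1) : R)%:E <= (a `^ p)%:E)%E.
Proof.
move=> p1 a0; have p0 : 0 < p by exact: lt_le_trans p1.
have mb : measurable_fun [set: R] (fun r => (0 < r) && (r <= a)).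
  by apply: measurable_and; [exact: measurable_fun_ltr|exact: measurable_fun_ler].
apply: (@le_trans _ _ (\int[leb]_l (a `^ (p - 1) * ((0 < l) && (l <= a))%:R)%:E)%E).
  apply: ge0_le_integral_real.
  - by mfun.
  - by apply: measurable_funM => //; exact: measurable_natr_bool mb.
  - by move=> l; rewrite !mulr_ge0 ?powR_ge0.
  - move=> l; case: ltP => l0; last by rewrite !mul0r mulr0.
    have [la|la] := leP l a; last by rewrite mulr0 mulr0 mul0r.
    by rewrite !mul1r mulr1 ge0_ler_powR ?nnegrE ?subr_ge0 ?(ltW l0).
rewrite ge0_integralZl_real ?powR_ge0//; last exact: measurable_natr_bool mb.
rewrite integral_ind_oc// subr0 -EFinM lee_fin.
have [->|an0] := eqVneq a 0; first by rewrite mulr0 powR_ge0.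
by rewrite -{2}[a]powRr1// -powRD ?subrK// an0 implybT.
Qed.

Lemma powR_le_singular_layer (t m : R) : 0 < t < 1 -> 0 <= m ->
  ((m `^ (1 - t))%:E <= \int[leb]_r ((0 < r)%R%:R * (r < m)%R%:R * r `^ (- t) : R)%:E)%E.
Proof.
move=> /andP[t0 t1] m0; have [->|mn0] := eqVneq m 0.
  rewrite powR0 ?subr_eq0 ?gt_eqF//.
  by apply: ge0_integral_real => l; rewrite !mulr_ge0 ?powR_ge0.
have m1 : 0 < m by rewrite lt_def mn0.
have -> : m `^ (1 - t) = m `^ (- t) * (m - 0).
  rewrite subr0 -{3}[m]powRr1// -powRD; last by rewrite (gt_eqF m1) implybT.
  by rewrite addrC.
rewrite EFinM -Iab// -ge0_integralZl_real ?powR_ge0//; last exact: measurable_natr_bool (mbool _ _).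
apply: ge0_le_integral_real.
- by apply: measurable_funM => //; exact: measurable_natr_bool (mbool _ _).
- by mfun.
- by move=> r; rewrite mulr_ge0 ?powR_ge0.
- move=> r; case: ltP => r0; last by rewrite mulr0 !mul0r.
  case: ltP => rm; last by rewrite !(mulr0, mul0r).
  rewrite mulr1 !mul1r !powRN lef_pV2 ?posrE ?powR_gt0//.
  by rewrite ge0_ler_powR ?nnegrE ?(ltW t0) ?(ltW r0) ?(ltW m1) ?(ltW rm).
Qed.
End layers.

Lemma poweR_invK {R : realType} (x : \bar R) (p : R) : (0 <= x)%E -> p != 0 ->
  ((x `^ p) `^ p^-1 = x)%E.
Proof. by move=> x0 p0; rewrite -poweRrM mulfV// poweRe1. Qed.

Section lorentz.
Context {R : realType} (n : nat) (s p : R).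
Local Notation N := n.+1.
Local Notation mu := (@lebesgueN R N).
Local Notation leb := (@lebesgue_measure R).
Local Notation P := (@sobolev_exp R N s p).
Local Notation th := (s * p / N%:R).
Hypotheses (p2 : 2 <= p) (s0 : 0 < s) (sN : s * p < N%:R).
Variable u : 'rV[R]_N -> R.
Hypothesis mu_ : measurable_fun [set: 'rV[R]_N] u.

Let p0 : 0 < p. Proof. exact: lt_le_trans p2. Qed.
Let sp0 : 0 < s * p. Proof. by rewrite mulr_gt0. Qed.
Let P0 : 0 < P. Proof. exact: sobolev_exp_gt0 p2 sN. Qed.

Let pP : p / P = 1 - th.
Proof.
rewrite /sobolev_exp; field.
by rewrite nat1r !gt_eqF ?subr_gt0.
Qed.

(** The distribution function of |u|, whose generalized inverse is [rearrangement u]. *)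
Definition level_measure (l : R) : \bar R := mu [set x | (l < `|u x|)%R].
Local Notation D := level_measure.

Let mset l : measurable [set x | l < `|u x|].
Proof. by apply: measurable_bool; apply: measurable_fun_ltr => //; mfun. Qed.

Lemma level_measure_homo l l' : l <= l' -> (D l' <= D l)%E.
Proof. by move=> ll'; apply: le_measure; rewrite ?inE// => x /=; exact: le_lt_trans. Qed.

Lemma rearrangement_le l t : 0 < l -> (D l <= t%:E)%E -> (rearrangement u t <= l%:E)%E.
Proof. by move=> l0 Dl; apply: ereal_inf_lbound; exists l. Qed.

Lemma rearrangement_ge0 t : (0 <= rearrangement u t)%E.
Proof. by apply: le_ereal_inf_tmp => _ [l [l0 _] <-]; rewrite lee_fin ltW. Qed.

Lemma rearrangement_ge l t : (t%:E < D l)%E -> (l%:E <= rearrangement u t)%E.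
Proof.
move=> tD; apply: le_ereal_inf_tmp => _ [l' [l'0 Dl'] <-]; rewrite lee_fin leNgt; apply/negP => ll'.
by move: (lt_le_trans tD (le_trans (level_measure_homo (ltW ll')) Dl')); rewrite ltxx.
Qed.

Lemma rearrangement_homo t t' : t <= t' -> (rearrangement u t' <= rearrangement u t)%E.
Proof.
move=> tt'; apply: le_ereal_inf_tmp => _ [l [l0 Dl] <-].
by apply: rearrangement_le => //; apply: (le_trans Dl); rewrite lee_fin.
Qed.

(** The weak-type bound; the power 1 / P of M then dominates the weak norm. *)
Let chebyshev M := forall l, 0 < l -> (D l <= (M / l `^ P)%:E)%E.

Lemma rearrangement_chebyshev M t : 0 < M -> chebyshev M -> 0 < t ->
  (rearrangement u t <= ((M / t) `^ P^-1)%:E)%E.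
Proof.
move=> M0 hM t0; have Mt : 0 < M / t by rewrite divr_gt0.
apply: rearrangement_le; first exact: powR_gt0.
apply: le_trans (hM _ (powR_gt0 _ Mt)) _.
rewrite -powRrM mulVf ?gt_eqF// powRr1 ?(ltW Mt)// invf_div mulrC divfK// gt_eqF//.
Qed.

Lemma weak_lorentz_le M : 0 < M -> chebyshev M ->
  (weak_lorentz_norm P u <= (M `^ P^-1)%:E)%E.
Proof.
move=> M0 hM; apply: ge_ereal_sup => _ [t /= t0 <-].
apply: (@le_trans _ _ ((t `^ P^-1)%:E * ((M / t) `^ P^-1)%:E)%E).
  by apply: lee_wpmul2l; rewrite ?lee_fin ?powR_ge0//; exact: rearrangement_chebyshev.
rewrite -EFinM lee_fin -powRM ?(ltW t0) ?(ltW (divr_gt0 M0 t0))//.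
by rewrite mulrC divfK// gt_eqF.
Qed.

Lemma weak_lorentz_ge0 : (0 <= weak_lorentz_norm P u)%E.
Proof.
apply: (@le_trans _ _ ((1 `^ P^-1)%:E * rearrangement u 1)%E).
  by rewrite mule_ge0 ?lee_fin ?powR_ge0// rearrangement_ge0.
by apply: ereal_sup_ubound; exists 1 => //=; exact: ltr01.
Qed.

(** The integral of a nonnegative function is a supremum over the simple functions below it, hence
    monotone for arbitrary integrands, such as those built on [rearrangement u]. *)
Lemma le_integral_nonmeasurable d (T : measurableType d) (m : {measure set T -> \bar R})
    (A : set T) (f g : T -> \bar R) :
  (forall x, A x -> 0 <= f x)%E -> (forall x, A x -> f x <= g x)%E ->
  (\int[m]_(x in A) f x <= \int[m]_(x in A) g x)%E.
Proof.
move=> f0 fg; have g0 x : A x -> (0 <= g x)%E by move=> Ax; exact: le_trans (f0 _ Ax) (fg _ Ax).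
rewrite !ge0_integralE//; apply: ge_ereal_sup => _ [h hf <-].
apply: ereal_sup_ubound; exists h => // x; apply: le_trans (hf x) _.
by rewrite !patchE; case: ifPn => // /set_mem; exact: fg.
Qed.

(** Since p / P = 1 - th, the density (t^{1/P} g)^p / t of the Lorentz norm is t^{-th} g^p. *)
Lemma lorentz_ge (g : R -> R) : (forall t, 0 <= g t) ->
  (forall t, 0 < t -> ((g t)%:E <= rearrangement u t)%E) ->
  (\int[leb]_t ((0 < t)%R%:R * (t `^ (- th) * g t `^ p))%R%:E <= lorentz_norm P p u `^ p)%E.
Proof.
move=> g0 gu.
rewrite /lorentz_norm -poweRrM mulVf ?gt_eqF// poweRe1; last first.
  apply: integral_ge0 => t /=; rewrite in_itv/= andbT => t0.
  by rewrite mule_ge0 ?poweR_ge0// lee_fin invr_ge0 ltW.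
apply: (@le_trans _ _ (\int[leb]_(t in `]0%R, +oo[) (t `^ (- th) * g t `^ p)%:E)%E).
  rewrite [leRHS]integral_mkcond le_eqVlt; apply/orP; left; apply/eqP.
  apply: eq_integral => t _; rewrite patchE mem_setE in_itv/= andbT.
  by case: (0 < t); rewrite ?mul1r ?mul0r.
apply: le_integral_nonmeasurable => t; rewrite /= in_itv/= andbT => t0.
  by rewrite lee_fin mulr_ge0 ?powR_ge0.
have -> : t `^ (- th) * g t `^ p = (t `^ P^-1 * g t) `^ p * t^-1.
  have e : t `^ (- th) = t `^ (1 - th) * t^-1.
    rewrite -(powR_inv1 (ltW t0)) -powRD; last by rewrite (gt_eqF t0) implybT.
    by congr (_ `^ _); ring.
  rewrite e powRM ?powR_ge0// -(powRrM t P^-1 p) [P^-1 * p]mulrC pP.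
  by move: (t `^ _) (g t `^ _) => a b; ring.
rewrite EFinM; apply: lee_wpmul2r; first by rewrite lee_fin invr_ge0 ltW.
rewrite -poweR_EFin; apply: gt0_ler_poweR.
- exact: ltW.
- by rewrite in_itv/= leey andbT lee_fin mulr_ge0// powR_ge0.
- by rewrite in_itv/= leey andbT mule_ge0 ?lee_fin ?powR_ge0// rearrangement_ge0.
- by rewrite EFinM; apply: lee_wpmul2l; [rewrite lee_fin powR_ge0|exact: gu].
Qed.

Lemma chebyshev_rearrangement_fin M t : 0 < M -> chebyshev M -> 0 < t ->
  rearrangement u t = (fine (rearrangement u t))%:E.
Proof.
move=> M0 hM t0; rewrite fineK// ge0_fin_numE ?rearrangement_ge0//.
exact: le_lt_trans (rearrangement_chebyshev M0 hM t0) (ltry _).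
Qed.

(* The integrand is bounded below on (0, t) by its value at t, as the
   rearrangement is nonincreasing. *)
Lemma weak_lorentz_le_lorentz M : 0 < M -> chebyshev M ->
  (weak_lorentz_norm P u <= lorentz_norm P p u)%E.
Proof.
move=> M0 hM; apply: ge_ereal_sup => _ [t /= t0 <-].
have Ef := chebyshev_rearrangement_fin M0 hM t0.
set a := fine (rearrangement u t) in Ef.
have a0 : 0 <= a by rewrite fine_ge0// rearrangement_ge0.
have th01 : 0 < th < 1 by rewrite divr_gt0//= ltr_pdivrMr// mul1r.
have /andP[th0 th1] := th01.
pose g (r : R) : R := (r <= t)%R%:R * a.
have h : ((((t `^ P^-1) * a) `^ p)%:E <= lorentz_norm P p u `^ p)%E.
  apply: le_trans (lorentz_ge (g := g) _ _); last 2 first.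
  - by move=> r; rewrite mulr_ge0.
  - move=> r r0; rewrite /g; have [rt|rt] := leP r t; last by rewrite mul0r rearrangement_ge0.
    by rewrite mul1r -Ef rearrangement_homo.
  have -> : (t `^ P^-1 * a) `^ p = t `^ (- th) * a `^ p * t.
    rewrite powRM ?powR_ge0// -(powRrM t P^-1 p) [P^-1 * p]mulrC pP.
    rewrite powRD; last by rewrite (gt_eqF t0) implybT.
    by rewrite powRr1 ?(ltW t0)// -mulrA mulrC.
  have It : (\int[leb]_r (((0 < r) && (r <= t))%:R : R)%:E = t%:E)%E.
    by rewrite integral_ind_oc ?subr0// ltW.
  rewrite EFinM -It -ge0_integralZl_real ?mulr_ge0 ?powR_ge0//; last first.
    by apply: measurable_natr_bool; apply: measurable_and; [exact: measurable_fun_ltr|exact: measurable_fun_ler].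
  apply: ge0_le_integral_real.
  - apply: measurable_funM => //; apply: measurable_natr_bool.
    by apply: measurable_and; [exact: measurable_fun_ltr|exact: measurable_fun_ler].
  - by rewrite /g; mfun.
  - by move=> r; rewrite mulr_ge0// mulr_ge0 ?powR_ge0.
  - move=> r; rewrite /g; case: ltP => r0/=; last by rewrite mulr0 mul0r.
    have [rt|rt] := leP r t; last by rewrite mul0r powR0 ?gt_eqF// !mulr0.
    rewrite mulr1 !mul1r ler_wpM2r ?powR_ge0// !powRN lef_pV2 ?posrE ?powR_gt0//.
    by rewrite ge0_ler_powR ?nnegrE ?(ltW th0) ?(ltW r0) ?(ltW t0).
have L0 : (0 <= lorentz_norm P p u)%E by exact: poweR_ge0.
rewrite Ef -EFinM; move: h; rewrite -poweR_EFin => h.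
have pi0 : 0 <= p^-1 by rewrite invr_ge0 ltW.
have i1 : ((t `^ P^-1 * a)%:E `^ p)%E \in `[0%E, +oo%E] by rewrite in_itv; apply/andP; split; [exact: poweR_ge0|exact: leey].
have i2 : (lorentz_norm P p u `^ p)%E \in `[0%E, +oo%E] by rewrite in_itv; apply/andP; split; [exact: poweR_ge0|exact: leey].
have := gt0_ler_poweR pi0 i1 i2 h.
have ta0 : (0 <= (t `^ P^-1 * a)%:E)%E by rewrite lee_fin mulr_ge0 ?powR_ge0.
by rewrite (poweR_invK ta0 (lt0r_neq0 p0)) (poweR_invK L0 (lt0r_neq0 p0)).
Qed.

Let g (t : R) : R := (0 < t)%R%:R * fine (rearrangement u t).

Let g0 t : 0 <= g t.
Proof. by rewrite mulr_ge0// fine_ge0// rearrangement_ge0. Qed.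

Let th01 : 0 < th < 1.
Proof. by rewrite divr_gt0//= ltr_pdivrMr// mul1r. Qed.

Let Dr l := fine (D l).

Let DrE M l : chebyshev M -> 0 < l -> D l = (Dr l)%:E.
Proof.
move=> hM l0; rewrite fineK// ge0_fin_numE; last exact: measure_ge0.
exact: le_lt_trans (hM _ l0) (ltry _).
Qed.

Let Dr0 l : 0 <= Dr l. Proof. by rewrite fine_ge0// measure_ge0. Qed.

Let mDr : measurable_fun [set: R] Dr.
Proof.
have mu2 := measurableT_comp mu_ (@measurable_snd _ _ [the measurableType _ of measurableTypeR R] [the measurableType _ of 'rV[R]_N]).
pose f (l : measurableTypeR R) (x : 'rV[R]_N) : R := (l < `|u x|)%R%:R.
have mf : measurable_fun [set: measurableTypeR R * 'rV[R]_N] (fun z => f z.1 z.2) by rewrite /f; mfun.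
have h := @measurable_integral_real R _ _ _ _ mu f mf (fun _ _ => ler0n _ _).
apply: measurableT_comp => //.
rewrite (_ : D = (fun l => \int[mu]_x ((l < `|u x|)%R%:R : R)%:E)%E)//.
by apply/funext => l; rewrite integral_boolE.
Qed.

(** The radius whose N-th power is the measure of the level set balances the two terms of [bathtub].
    If that measure is 0, radii tending to 0 make the bound vanish. *)
Let bathtub_level K M l : 0 <= K ->
  (forall (i : 'rV[R]_N -> R) (r : R),
    measurable_fun [set: 'rV[R]_N] i -> (forall x, 0 <= i x <= 1) -> 0 < r ->
    (\int[mu]_x (i x * enorm x `^ (- (s * p)))%:E <=
     (r `^ (- (s * p)))%:E * \int[mu]_x (i x)%:E + (K * r `^ (N%:R - s * p))%:E)%E) ->
  chebyshev M -> 0 < l ->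
  (\int[mu]_x ((l < `|u x|)%R%:R * enorm x `^ (- (s * p)))%:E <= ((1 + K) * Dr l `^ (1 - th))%:E)%E.
Proof.
move=> K0 bt hM l0.
have mi : measurable_fun [set: 'rV[R]_N] (fun x => (l < `|u x|)%R%:R : R) by mfun.
have {}bt r := bt _ r mi (fun x => natr_bool01 (l < `|u x|)).
have ID : (\int[mu]_x ((l < `|u x|)%R%:R : R)%:E = (Dr l)%:E)%E.
  by rewrite (integral_boolE mu (mset l)) -(DrE hM l0).
rewrite ID in bt.
have [D0|Dn0] := eqVneq (Dr l) 0.
  rewrite D0 powR0 ?mulr0; last by have /andP[_ ?] := th01; rewrite subr_eq0 gt_eqF.
  apply/lee_addgt0Pr => z z0; rewrite add0e.
  have K1 : 0 < K + 1 by rewrite ltr_wpDl.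
  have Ns : 0 < N%:R - s * p by rewrite subr_gt0.
  (* The radius r with r^{N - sp} = z / (K + 1) leaves an error of at most z. *)
  have zK : 0 < z / (K + 1) by rewrite divr_gt0.
  apply: le_trans (bt _ (powR_gt0 (N%:R - s * p)^-1 zK)) _.
  rewrite D0 mule0 add0e lee_fin -powRrM mulVf ?gt_eqF// powRr1 ?(ltW zK)//.
  rewrite mulrA ler_pdivrMr// mulrC ler_pM2l// lerDl//.
have D1 : 0 < Dr l by rewrite lt_def Dn0 Dr0.
apply: le_trans (bt _ (powR_gt0 N%:R^-1 D1)) _.
rewrite -EFinM -EFinD lee_fin -!(powRrM (Dr l)) mulrDl mul1r.
have e1 : Dr l `^ (N%:R^-1 * - (s * p)) * Dr l = Dr l `^ (1 - th).
  rewrite -{2}[Dr l]powRr1// -powRD; last by rewrite (gt_eqF D1) implybT.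
  by congr (_ `^ _); ring.
rewrite e1 lerD2l ler_wpM2l// le_eqVlt; apply/orP; left; apply/eqP; congr (_ `^ _).
by field; rewrite nat1r gt_eqF.
Qed.

(** Cut |u|^p into layers and apply [bathtub] at each level l, which produces D(l)^{1 - th}; bound
    this by the integral of t^{-th} over t < D(l). After exchanging the integrals, t < D(l) forces l
    to be at most the rearrangement at t, so the l-integral is at most its p-th power. *)
Lemma hardy_energy_le_lorentz K M : 0 <= K ->
  (forall (i : 'rV[R]_N -> R) (r : R),
    measurable_fun [set: 'rV[R]_N] i -> (forall x, 0 <= i x <= 1) -> 0 < r ->
    (\int[mu]_x (i x * enorm x `^ (- (s * p)))%:E <=
     (r `^ (- (s * p)))%:E * \int[mu]_x (i x)%:E + (K * r `^ (N%:R - s * p))%:E)%E) ->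
  0 < M -> chebyshev M ->
  (hardy_energy s p u <= (2 `^ p * (1 + K))%:E * lorentz_norm P p u `^ p)%E.
Proof.
move=> K0 bt M0 hM.
have p1 : 1 <= p by apply: le_trans p2; rewrite ler1n.
have me := @measurable_enorm R N.
have mu1 := measurableT_comp mu_ (@measurable_fst _ _ [the measurableType _ of 'rV[R]_N] [the measurableType _ of measurableTypeR R]).
pose f (x : 'rV[R]_N) (l : measurableTypeR R) : R := (0 < l)%R%:R * (l < `|u x|)%R%:R * l `^ (p - 1) * enorm x `^ (- (s * p)).
have f0 x l : 0 <= f x l by rewrite !mulr_ge0 ?powR_ge0.
have mf : measurable_fun [set: 'rV[R]_N * measurableTypeR R] (fun z => f z.1 z.2) by rewrite /f; mfun.
have h1 : (hardy_energy s p u <= (2 `^ p)%:E * \int[mu]_x \int[leb]_l (f x l)%:E)%E.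
  have mF := @measurable_integral_real R _ _ _ _ leb f mf f0.
  have F0 x : [set: 'rV[R]_N] x -> (0 <= \int[leb]_l (f x l)%:E)%E.
    by move=> _; apply: ge0_integral_real => l; exact: f0.
  have c0 : (0 <= (2 `^ p)%:E)%E by rewrite lee_fin powR_ge0.
  rewrite -(ge0_integralZl mu measurableT mF F0 c0).
  apply: le_integral_nonmeasurable => x _; first by rewrite lee_fin mulr_ge0 ?powR_ge0.
  have -> : (\int[leb]_l (f x l)%:E = (enorm x `^ (- (s * p)))%:E *
      \int[leb]_l ((0 < l)%R%:R * (l < `|u x|)%R%:R * l `^ (p - 1) : R)%:E)%E.
    rewrite -ge0_integralZl_real ?powR_ge0//; last 2 first.
    - by mfun.
    - by move=> l; rewrite !mulr_ge0 ?powR_ge0.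
    by apply: eq_integral => l _; rewrite mulrC.
  rewrite muleCA [leLHS]EFinM [leLHS]muleC; apply: lee_wpmul2l; first by rewrite lee_fin powR_ge0.
  exact: powR_le_layer.
apply: (le_trans h1); rewrite EFinM -muleA; apply: lee_wpmul2l; first by rewrite lee_fin powR_ge0.
rewrite (tonelli_real mu leb mf f0).
pose w (l t : measurableTypeR R) : R := (0 < l)%R%:R * l `^ (p - 1) * ((0 < t)%R%:R * (t < Dr l)%R%:R * t `^ (- th)).
have w0 l t : 0 <= w l t by rewrite !mulr_ge0 ?powR_ge0.
have mDr1 := measurableT_comp mDr (@measurable_fst _ _ [the measurableType _ of measurableTypeR R] [the measurableType _ of measurableTypeR R]).
have mw : measurable_fun [set: measurableTypeR R * measurableTypeR R] (fun z => w z.1 z.2) by rewrite /w; mfun.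
apply: (@le_trans _ _ ((1 + K)%:E * \int[leb]_l \int[leb]_t (w l t)%:E)%E).
  have mF := @measurable_integral_real R _ _ _ _ leb w mw w0.
  have F0 l : [set: measurableTypeR R] l -> (0 <= \int[leb]_t (w l t)%:E)%E.
    by move=> _; apply: ge0_integral_real => t; exact: w0.
  have c0 : (0 <= (1 + K)%:E)%E by rewrite lee_fin addr_ge0.
  rewrite -(ge0_integralZl leb measurableT mF F0 c0).
  apply: le_integral_nonmeasurable => l _; first by apply: ge0_integral_real => x; exact: f0.
  have [l0|l0] := ltP 0 l; last first.
    rewrite integral0_eq; last by move=> x _; rewrite /f [0 < l]ltNge l0/= !mul0r.
    rewrite mule_ge0 ?lee_fin ?addr_ge0//; apply: ge0_integral_real => t; exact: w0.
  have -> : (\int[mu]_x (f x l)%:E = (l `^ (p - 1))%:E *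
      \int[mu]_x ((l < `|u x|)%R%:R * enorm x `^ (- (s * p)))%:E)%E.
    rewrite -ge0_integralZl_real ?powR_ge0//; last 2 first.
    - by mfun.
    - by move=> x; rewrite mulr_ge0 ?powR_ge0.
    by apply: eq_integral => x _; congr EFin; rewrite /f l0 mul1r mulrA [l `^ _ * _]mulrC.
  have -> : (\int[leb]_t (w l t)%:E = (l `^ (p - 1))%:E *
      \int[leb]_t ((0 < t)%R%:R * (t < Dr l)%R%:R * t `^ (- th) : R)%:E)%E.
    rewrite -ge0_integralZl_real ?powR_ge0//; last 2 first.
    - by mfun.
    - by move=> t; rewrite !mulr_ge0 ?powR_ge0.
    by apply: eq_integral => t _; rewrite /w l0 mul1r.
  rewrite muleCA; apply: lee_wpmul2l; first by rewrite lee_fin powR_ge0.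
  apply: le_trans (bathtub_level K0 bt hM l0) _.
  rewrite EFinM; apply: lee_wpmul2l; first by rewrite lee_fin addr_ge0.
  exact: powR_le_singular_layer.
apply: lee_wpmul2l; first by rewrite lee_fin addr_ge0.
rewrite (tonelli_real leb leb mw w0).
apply: le_trans (lorentz_ge g0 _); last first.
  by move=> t t0; rewrite /g t0 mul1r -(chebyshev_rearrangement_fin M0 hM t0).
apply: le_integral_nonmeasurable => t _; first by apply: ge0_integral_real => l; exact: w0.
have [t0|t0] := ltP 0 t; last first.
  by rewrite mul0r integral0_eq// => l _; rewrite /w [0 < t]ltNge t0/= !mul0r mulr0.
rewrite mul1r EFinM.
apply: (@le_trans _ _ ((t `^ (- th))%:E *
    \int[leb]_l ((0 < l)%R%:R * (l <= g t)%R%:R * l `^ (p - 1) : R)%:E)%E); last first.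
  by apply: lee_wpmul2l; [rewrite lee_fin powR_ge0|exact: layer_le_powR].
rewrite -ge0_integralZl_real ?powR_ge0//; last 2 first.
- by mfun.
- by move=> l; rewrite !mulr_ge0 ?powR_ge0.
apply: le_integral_nonmeasurable => l _; first by rewrite lee_fin; exact: w0.
rewrite lee_fin /w t0 mul1r; have [l0|l0] := ltP 0 l; last by rewrite !mul0r mulr0.
have [tD|tD] := ltP t (Dr l); last by rewrite mul0r mulr0 !mulr_ge0 ?powR_ge0.
have -> : l <= g t.
  rewrite /g t0 mul1r -lee_fin -(chebyshev_rearrangement_fin M0 hM t0).
  by apply: rearrangement_ge; rewrite (DrE hM l0) lte_fin.
by rewrite !mul1r mulrC.
Qed.
End lorentz.

(** * Stability *)

(** The supremum need not be attained; the factor 2 buys a level that realizes it approximately. *)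
Lemma near_max {R : realType} (g : R -> R) (S : R) :
  (forall l, 0 < l -> g l <= S) -> (exists2 l, 0 < l & 0 < g l) ->
  exists l, [/\ 0 < l, 0 < g l & forall l', 0 < l' -> g l' <= 2 * g l].
Proof.
move=> gS [l0 l00 gl0]; pose A := [set g l | l in [set l : R | 0 < l]].
have hA : has_sup A by split; [exists (g l0), l0|exists S => _ [l ? <-]; exact: gS].
have A0 : 0 < sup A by apply: lt_le_trans gl0 _; apply: (ub_le_sup hA.2); exists l0.
have [_ [l lpos <-] hl] := sup_adherent (divr_gt0 A0 (ltr0n _ 2)) hA.
exists l; split => //.
  by apply: lt_trans hl; rewrite subr_gt0 ltr_pdivrMr// ltr_pMr// ltr1n.
move=> l' l'0; apply: (@le_trans _ _ (sup A)); first by apply: (ub_le_sup hA.2); exists l'.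
lra.
Qed.

Section stability.
Context {R : realType} (n : nat) (s p : R).
Local Notation N := n.+1.
Local Notation mu := (@lebesgueN R N).
Local Notation P := (@sobolev_exp R N s p).
Local Notation th := (s * p / N%:R).
Hypotheses (p2 : 2 <= p) (s0 : 0 < s) (s1 : s < 1) (sN : s * p < N%:R).

Let p0 : 0 < p. Proof. exact: lt_le_trans p2. Qed.
Let sp0 : 0 < s * p. Proof. by rewrite mulr_gt0. Qed.
Let P0 : 0 < P. Proof. exact: sobolev_exp_gt0 p2 sN. Qed.

Let pP : p / P = 1 - th.
Proof.
rewrite /sobolev_exp; field.
by rewrite nat1r !gt_eqF ?subr_gt0.
Qed.

Lemma level_measure_chebyshev (u : 'rV[R]_N -> R) (S l : R) :
  measurable_fun [set: 'rV[R]_N] u -> (\int[mu]_x (`|u x| `^ P)%:E = S%:E)%E -> 0 < l ->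
  (level_measure u l <= (S / l `^ P)%:E)%E.
Proof.
move=> mu_ SE l0; have lP : 0 < l `^ P by exact: powR_gt0.
have mb : measurable_fun [set: 'rV[R]_N] (fun x => l < `|u x|).
  by apply: measurable_fun_ltr => //; mfun.
have h : ((l `^ P)%:E * level_measure u l <= S%:E)%E.
  rewrite /level_measure -(integral_boolE mu (measurable_bool mb)).
  rewrite -ge0_integralZl_real ?(ltW lP)//; last exact: measurable_natr_bool.
  rewrite -SE; apply: ge0_le_integral_real.
  - by apply: measurable_funM => //; exact: measurable_natr_bool.
  - by mfun.
  - by move=> x; rewrite mulr_ge0 ?powR_ge0.
  - move=> x; have [ux|ux] := ltP l `|u x|; last by rewrite mulr0 powR_ge0.
    by rewrite mulr1 ge0_ler_powR ?nnegrE ?(ltW P0) ?(ltW l0) ?(ltW ux).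
have {}h : (level_measure u l <= (l `^ P)^-1%:E * S%:E)%E.
  by rewrite lee_pdivlMl.
by rewrite mulrC EFinM.
Qed.

Lemma level_measure_gt0 (u : 'rV[R]_N -> R) : measurable_fun [set: 'rV[R]_N] u ->
  ~ {ae mu, forall x, u x = 0} -> exists2 l : R, 0 < l & (0 < level_measure u l)%E.
Proof.
move=> mu_ nae; apply: contrapT => /forall2NP h; apply: nae.
have mb l : measurable [set x | l < `|u x|].
  by apply: measurable_bool; apply: measurable_fun_ltr => //; mfun.
have D0 l : 0 < l -> level_measure u l = 0%E.
  move=> l0; have [//|] := h l; move=> /negP; rewrite -leNgt => Dl.
  by apply/eqP; rewrite eq_le Dl measure_ge0.
have neg : mu.-negligible (\bigcup_k [set x | k.+1%:R^-1 < `|u x|]).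
  apply: negligible_bigcup => k; exists [set x | k.+1%:R^-1 < `|u x|]; split => //.
  by apply: D0; rewrite invr_gt0.
apply: negligibleS neg => x /= ux.
have ux0 : 0 < `|u x| by rewrite normr_gt0; exact/eqP.
exists (Num.truncn `|u x|^-1) => //=.
by rewrite -[ltRHS]invrK ltf_pV2 ?posrE ?invr_gt0// truncnS_gt.
Qed.

Lemma hardy_dist_le (u : 'rV[R]_N -> R) :
  (hardy_dist s p u <= weak_lorentz_norm P u / lorentz_norm P p u)%E.
Proof.
have e : (u \- omega s p 0)%R = u by apply/funext => x /=; rewrite /omega mul0r subr0.
by apply: ereal_inf_lbound; exists 0; [exact: I|rewrite e].
Qed.

Lemma hardy_dist_ge0 (u : 'rV[R]_N -> R) : (0 <= hardy_dist s p u)%E.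
Proof.
apply: le_ereal_inf_tmp => _ [a _ <-]; apply: mule_ge0; first exact: weak_lorentz_ge0.
by rewrite inve_ge0; exact: poweR_ge0.
Qed.

Lemma hardy_dist_powR_le (u : 'rV[R]_N -> R) (d q : R) : 0 <= q -> (hardy_dist s p u <= d%:E)%E ->
  (hardy_dist s p u `^ q <= (d `^ q)%:E)%E.
Proof.
move=> q0 ud; rewrite -poweR_EFin; apply: gt0_ler_poweR => //.
- by rewrite in_itv; apply/andP; split; [exact: hardy_dist_ge0|exact: leey].
- rewrite in_itv; apply/andP; split; last exact: leey.
  exact: le_trans (hardy_dist_ge0 u) ud.
Qed.

(** The supremum of l^P D(l) is the P-th power of the weak norm. A level within a factor 2 of it
    provides M, and comparing with the level l / 4 gives the bound on its measure that [level_set]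
    requires. *)
Lemma weak_norm_bound : exists2 C : R, 0 < C &
  forall u : 'rV[R]_N -> R, measurable_fun [set: 'rV[R]_N] u ->
  (hardy_energy s p u < +oo)%E -> (hardy_rem_integral s p u 1 < +oo)%E ->
  (\int[mu]_x (`|u x| `^ P)%:E < +oo)%E -> ~ {ae mu, forall x, u x = 0} ->
  exists M : R, [/\ 0 < M, forall l, 0 < l -> (level_measure u l <= (M / l `^ P)%:E)%E &
    (M `^ P^-1) `^ (2 * p) <= C * (fine (hardy_rem_integral s p u 1) *
       (fine (hardy_rem_integral s p u 1) + fine (hardy_energy s p u)))].
Proof.
have [C C0 hC] := level_set p2 s0 sN.
exists (4 * C); first exact: mulr_gt0.
move=> u mu_ Hoo Eoo Soo nae.
have S0 : (0 <= \int[mu]_x (`|u x| `^ P)%:E)%E by apply: ge0_integral_real => x; exact: powR_ge0.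
have SE : (\int[mu]_x (`|u x| `^ P)%:E)%E = (fine (\int[mu]_x (`|u x| `^ P)%:E)%E)%:E.
  by rewrite fineK// ge0_fin_numE.
set S := fine _ in SE.
have ch l : 0 < l -> (level_measure u l <= (S / l `^ P)%:E)%E.
  exact: level_measure_chebyshev mu_ SE.
have DE l : 0 < l -> level_measure u l = (fine (level_measure u l))%:E.
  move=> l0; rewrite fineK// ge0_fin_numE ?measure_ge0//.
  exact: le_lt_trans (ch _ l0) (ltry _).
pose g l := l `^ P * fine (level_measure u l).
have [l [l0 gl hg]] : exists l, [/\ 0 < l, 0 < g l & forall l', 0 < l' -> g l' <= 2 * g l].
  apply: (@near_max _ _ S) => [l l0|].
    rewrite /g mulrC -ler_pdivlMr ?powR_gt0// -lee_fin -DE//; exact: ch.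
  have [l l0 Dl] := level_measure_gt0 mu_ nae.
  exists l => //; rewrite /g mulr_gt0 ?powR_gt0//.
  by rewrite -lte_fin -DE.
pose m := fine (level_measure u l).
have m0 : 0 < m by move: gl; rewrite /g pmulr_rgt0 ?powR_gt0.
exists (2 * g l); split; first exact: mulr_gt0.
  move=> l' l'0; rewrite DE// lee_fin ler_pdivlMr ?powR_gt0// mulrC; exact: hg.
have m4 : (mu [set x | (l / 4 < `|u x|)%R] <= (2 * 4 `^ P * m)%:E)%E.
  have l4 : 0 < l / 4 by rewrite divr_gt0.
  rewrite -/(level_measure u (l / 4)) DE// lee_fin.
  have := hg _ l4; rewrite /g -ler_pdivlMl ?powR_gt0// => /le_trans; apply.
  rewrite le_eqVlt; apply/orP; left; apply/eqP.
  rewrite powRM ?invr_ge0 ?(ltW l0)// powRV// -/m.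
  have lP : 0 < l `^ P by exact: powR_gt0.
  have fP : 0 < 4 `^ P :> R by exact: powR_gt0.
  move: (l `^ P) (4 `^ P) lP fP => a b a0 b0; field.
  by rewrite !gt_eqF.
have := hC u l m mu_ Hoo Eoo l0 m0 (DE _ l0) m4.
set X := fine _ * _ => hX.
rewrite -mulrA; apply: (@le_trans _ _ (4 * (l `^ p * m `^ (1 - th)) ^+ 2)); last first.
  by rewrite ler_pM2l.
(* As p / P = 1 - th, the power 2p / P of l^P m is the square of the quantity bounded by
   [level_set]; the leftover square of 2^{1 - th} is at most 4. *)
have e1 : (2 * g l) `^ P^-1 `^ (2 * p) = (2 `^ (1 - th) * (l `^ p * m `^ (1 - th))) ^+ 2.
  rewrite -powRrM -powR_mulrn ?mulr_ge0 ?powR_ge0//.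
  have -> : P^-1 * (2 * p) = (1 - th) * 2 by rewrite -pP; ring.
  rewrite (powRrM (2 * g l) (1 - th)); congr (_ `^ _).
  have lP0 : 0 <= l `^ P by exact: powR_ge0.
  rewrite (powRM _ (ler0n _ 2) (ltW gl)); congr (_ * _).
  rewrite /g -/m (powRM _ lP0 (ltW m0)); congr (_ * _).
  by rewrite -(powRrM l) -pP mulrCA mulfV ?gt_eqF// mulr1.
rewrite e1 exprMn ler_wpM2r ?sqr_ge0//.
have e2 : 2 `^ (1 - th) <= 2 :> R.
  rewrite -[leRHS](powRr1 (ler0n _ 2)) ler_powR ?ler1n// gerBl divr_ge0// ltW//.
rewrite [leRHS](_ : _ = 2 ^+ 2); last by ring.
by rewrite lerXn2r ?nnegrE ?powR_ge0.
Qed.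
End stability.

Theorem theorem1p1 (R : realType) (N : nat) (p s : R) :
  (1 <= N)%N -> 2 <= p -> 0 < s < 1 -> s * p < N%:R ->
  exists2 C : R, 0 < C &
    forall u : 'rV[R]_N -> R, dotW s p u ->
      ~ {ae lebesgueN N, forall x, u x = 0} ->
      (C%:E * hardy_dist s p u `^ (2 * p) * hardy_term s p u
         <= hardy_deficit s p u)%E.
Proof.
case: N => // n _ p2 /andP[s0 s1] sN.
have p0 : 0 < p by exact: lt_le_trans p2.
have sp0 : 0 < s * p by rewrite mulr_gt0.
have [C1 C10 hC1] := weak_norm_bound p2 s0 sN.
have [K K0 bt] := bathtub sp0 sN.
pose L : R := 2 `^ p * (1 + K).
have L0 : 0 < L by rewrite mulr_gt0 ?powR_gt0// ltr_pwDl.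
have P0 := sobolev_exp_gt0 p2 sN.
have k0 := hardy_const_gt0 p2 sN.
have koo := hardy_const_lty p2 s0 s1 sN.
(* The first term serves the case where the deficit is below H; the added 1 serves the case where it
   is at least H. *)
pose D : R := 2 * C1 * L ^+ 2 + 1.
have CL0 : 0 <= 2 * C1 * L ^+ 2.
  exact: mulr_ge0 (mulr_ge0 (ler0n _ 2) (ltW C10)) (exprn_ge0 2 (ltW L0)).
have D1 : 1 <= D by rewrite lerDr.
have D0 : 0 < D by exact: lt_le_trans D1.
exists D^-1; first by rewrite invr_gt0.
move=> u uW nae; have mu_ : measurable_fun [set: 'rV[R]_n.+1] u by case: uW.
have [Hoo Soo] := dotW_finite p2 s0 s1 sN uW.
have kE : @hardy_const R n.+1 s p = (fine (@hardy_const R n.+1 s p))%:E.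
  by rewrite fineK// ge0_fin_numE// ltW.
have hE : hardy_energy s p u = (fine (hardy_energy s p u))%:E.
  by rewrite fineK// ge0_fin_numE// hardy_energy_ge0.
rewrite /hardy_deficit hardy_energyE hE kE.
have rem := hardy_remainder p2 s0 sN mu_ Hoo.
rewrite kE hE in rem.
set k := fine (@hardy_const R n.+1 s p) in rem *.
set h := fine (hardy_energy s p u) in hE rem *.
have h0 : 0 <= h by rewrite fine_ge0// hardy_energy_ge0.
(* An infinite seminorm makes the deficit infinite, the Hardy term being finite. *)
have [->|gfin] := eqVneq (@gagliardo R n.+1 s p u) +oo%E.
  by rewrite -EFinM addye// leey.
have g0 : (0 <= @gagliardo R n.+1 s p u)%E.
  apply: integral_ge0 => x _; apply: integral_ge0 => y _.
  by rewrite lee_fin mulr_ge0 ?invr_ge0 ?powR_ge0.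
have gE : @gagliardo R n.+1 s p u = (fine (@gagliardo R n.+1 s p u))%:E.
  by rewrite fineK// ge0_fin_numE// lt_neqAle gfin leey.
set g := fine _ in gE; rewrite gE in rem *.
have E0 := hardy_rem_integral_ge0 p2 sN u (lexx 1).
have Eoo : (hardy_rem_integral s p u 1 < +oo)%E.
  rewrite ltey; apply/eqP => Ey; move: rem.
  by rewrite Ey gt0_muley ?lte_fin// -EFinM addye// leye_eq.
have Ef : hardy_rem_integral s p u 1 = (fine (hardy_rem_integral s p u 1))%:E.
  by rewrite fineK// ge0_fin_numE.
have [M [M0 ch wk]] := hC1 u mu_ Hoo Eoo Soo nae.
rewrite -/h in wk.
rewrite Ef in rem; set e := fine (hardy_rem_integral s p u 1) in Ef rem wk.
have e0 : 0 <= e by rewrite fine_ge0.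
rewrite -!EFinM -EFinD lee_fin in rem.
rewrite -EFinM -EFinB.
set dl := g - k * h.
have edl : e <= dl by rewrite /dl; lra.
have dl0 : 0 <= dl := le_trans e0 edl.
have [h00|hn0] := eqVneq h 0; first by rewrite h00 mule0 lee_fin.
have h1 : 0 < h by rewrite lt_def hn0.
have q0 : 0 <= 2 * p by rewrite mulr_ge0// ltW.
have lor := hardy_energy_le_lorentz p2 s0 sN mu_ K0 bt M0 ch.
rewrite hE -/L in lor.
have dist := hardy_dist_le s p u.
have lor0 : (0 <= lorentz_norm (@sobolev_exp R n.+1 s p) p u)%E by exact: poweR_ge0.
have wle := weak_lorentz_le p2 sN M0 ch.
have wll := weak_lorentz_le_lorentz p2 s0 sN M0 ch.
set lz := lorentz_norm _ p u in lor dist lor0 wll.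
have lz_neq0 : lz != 0%E.
  apply/eqP => lz0; move: lor; rewrite lz0 poweR0r ?gt_eqF// mule0 lee_fin.
  by rewrite leNgt h1.
suff [d [d0 distd dh]] : exists d : R, [/\ 0 <= d, (hardy_dist s p u <= d%:E)%E &
    D^-1 * d `^ (2 * p) * h <= dl].
  apply: (@le_trans _ _ ((D^-1 * d `^ (2 * p) * h)%:E)); last by rewrite lee_fin.
  rewrite !EFinM; apply: lee_wpmul2r; first by rewrite lee_fin.
  apply: lee_wpmul2l; first by rewrite lee_fin invr_ge0 ltW.
  exact: hardy_dist_powR_le q0 distd.
(* When the deficit is at least H, d = 1 is enough: the weak norm is at most the Lorentz norm, and D
   >= 1. *)
have [hdl|dlh] := leP h dl.
  exists 1; split => //.
    apply: (le_trans dist); have [->|lzoo] := eqVneq lz +oo%E; first by rewrite invey mule0.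
    have lzE : lz = (fine lz)%:E by rewrite fineK// ge0_fin_numE// lt_neqAle lzoo leey.
    have l0 : 0 < fine lz by rewrite -lte_fin -lzE lt_def lz_neq0.
    rewrite lzE inver gt_eqF//; rewrite lzE in wll.
    by rewrite lee_pdivrMr// mul1e.
  by rewrite powR1 mulr1 -ler_pdivlMl ?invr_gt0// invrK (le_trans hdl)// ler_peMl.
(* A quotient by an infinite norm is 0, so the distance vanishes. *)
have [lzoo|lzoo] := eqVneq lz +oo%E.
  exists 0; split => //; first by apply: (le_trans dist); rewrite lzoo invey mule0.
  by rewrite powR0 ?mulf_neq0 ?gt_eqF// mulr0 mul0r.
have lzE : lz = (fine lz)%:E by rewrite fineK// ge0_fin_numE// lt_neqAle lzoo leey.
have l0 : 0 < fine lz by rewrite -lte_fin -lzE lt_def lz_neq0.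
set l := fine lz in lzE l0.
set W := M `^ _ in wle wk.
have W0 : 0 <= W by exact: powR_ge0.
exists (W / l); split.
- by rewrite divr_ge0// ltW.
- apply: (le_trans dist); rewrite lzE inver gt_eqF// EFinM.
  by apply: lee_wpmul2r => //; rewrite lee_fin invr_ge0 ltW.
rewrite lzE poweR_EFin -EFinM lee_fin in lor.
rewrite powRM ?invr_ge0 ?(ltW l0)// powRV ?(ltW l0)//.
have l2 : 0 < l `^ (2 * p) by exact: powR_gt0.
have h2 : h ^+ 2 <= L ^+ 2 * l `^ (2 * p).
  rewrite (_ : l `^ (2 * p) = (l `^ p) ^+ 2); last first.
    by rewrite -powR_mulrn ?powR_ge0// -powRrM mulrC.
  by rewrite -exprMn !expr2; exact: (ler_pM h0 h0 lor lor).
(* Here e <= dl < h, so [wk] gives W^{2p} <= 2 C1 dl h; multiplying by h and using h <= L l^p makes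
   the Lorentz norm appear to the power 2p. *)
have wh : W `^ (2 * p) * h <= D * dl * l `^ (2 * p).
  apply: (@le_trans _ _ (2 * C1 * dl * h ^+ 2)).
    rewrite expr2 mulrA; apply: ler_wpM2r => //; apply: (le_trans wk).
    rewrite [leRHS](_ : _ = C1 * (dl * (2 * h))); last by ring.
    have eh : e + h <= 2 * h by rewrite mulr_natl mulr2n lerD2r (le_trans edl) ?(ltW dlh).
    by rewrite (ler_pM2l C10); exact: (ler_pM e0 (addr_ge0 e0 h0) edl eh).
  apply: (@le_trans _ _ (2 * C1 * dl * (L ^+ 2 * l `^ (2 * p)))).
    by apply: ler_wpM2l => //; exact: mulr_ge0 (mulr_ge0 (ler0n _ 2) (ltW C10)) dl0.
  have -> : 2 * C1 * dl * (L ^+ 2 * l `^ (2 * p)) = 2 * C1 * L ^+ 2 * dl * l `^ (2 * p) by ring.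
  by rewrite ler_pM2r// ler_wpM2r// /D lerDl.
rewrite -mulrA ler_pdivrMl// mulrAC ler_pdivrMr//.
Qed.
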